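(* Let $A$ be a finite dimensional algebra over an algebraically closed field $\mathbb{K}$. The following statements are equivalent. (1) $A$ is $\tau$-tilting finite. (2) Every torsion class $\mathcal{T}$ in $\mathrm{Mod}\text{-}A$ has the form $\mathcal{T}=\mathrm{Gen}(T)$ for a finite dimensional silting $A$-module $T$. (3) Every silting $A$-module is finite dimensional up to equivalence, i.e. every silting $A$-module is equivalent to a finite dimensional silting $A$-module. (4) There are only finitely many epiclasses of ring epimorphisms $A\to B$ with $\mathrm{Tor}_1^A(B,B)=0$.
   Context: Modules are right modules; $\mathrm{Mod}\text{-}A$ is the category of all right $A$-modules and $\mathrm{mod}\text{-}A$ its subcategory of finitely presented (here: finite dimensional) modules. For a module $M$, $\mathrm{Gen}(M)$ is the class of all quotients of direct sums $M^{(I)}$ ($I$ any set), and $\mathrm{Add}(M)$ is the class of all modules isomorphic to direct summands of direct sums of copies of $M$. A torsion class in $\mathrm{Mod}\text{-}A$ is a full subcategory closed under coproducts, quotients and extensions. Silting modules: for a morphism $\sigma$ between projective right $A$-modules, $\mathcal{D}_\sigma=\{X\in\mathrm{Mod}\text{-}A \mid \mathrm{Hom}_A(\sigma,X)\text{ is surjective}\}$. An $A$-module $T$ is silting if it admits a projective presentation $P\xrightarrow{\sigma}Q\to T\to 0$ (exact, with $P,Q$ projective, not necessarily finitely generated) such that $\mathcal{D}_\sigma=\mathrm{Gen}(T)$. Two silting modules $T,T'$ are equivalent if $\mathrm{Gen}(T)=\mathrm{Gen}(T')$ (equivalently $\mathrm{Add}(T)=\mathrm{Add}(T')$). $\tau$-tilting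 finiteness: let $\tau$ be the Auslander-Reiten translate. A finite dimensional $A$-module $M$ is $\tau$-rigid if $\mathrm{Hom}_A(M,\tau M)=0$, and $\tau$-tilting if in addition the number of non-isomorphic indecomposable direct summands of $M$ equals the number of isomorphism classes of simple $A$-modules. $A$ is called $\tau$-tilting finite if it satisfies the following conditions, which are known to be equivalent (Demonet-Iyama-Jasso): there are only finitely many isomorphism classes of indecomposable $\tau$-rigid $A$-modules; there are only finitely many isomorphism classes of basic $\tau$-tilting $A$-modules; there are only finitely many isomorphism classes of bricks in $\mathrm{mod}\text{-}A$ (finite dimensional modules whose endomorphism ring is a division ring); there are only finitely many torsion classes in $\mathrm{mod}\text{-}A$; every torsion class in $\mathrm{mod}\text{-}A$ is functorially finite. Ring epimorphisms: a ring epimorphism $A\to B$ is an epimorphism in the category of rings with unit (the target ring $B$ may be zero, and need not be finite dimensional). Two ring epimorphisms $f_1:A\to B_1$, $f_2:A\to B_2$ are equivalent (lie in the same epiclass of $A$) if there is a ring isomorphism $h:B_1\to B_2$ with $f_2=h\circ f_1$. *)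

(* Defs.v *)
From HB Require Import structures.
From mathcomp Require Import all_boot all_algebra all_field.

Set Implicit Arguments.
Unset Strict Implicit.
Unset Printing Implicit Defensive.

Import GRing.Theory.
Local Open Scope ring_scope.

(* MathComp modules are left modules: a right A-module is a left module over
   the converse ring A^c, with x . a written a *: x. *)
Notation rmodType A := (lmodType A^c).

(* The regular right module A_A: here a *: x = x * a, the product of A. *)
Notation regular_rmod A := ((A^c)^o).

Section Modules.

Context {R : pzRingType}.
Implicit Types M N P Q X Y Z : lmodType R.

Definition surj (X Y : Type) (f : X -> Y) : Prop :=
  forall y, exists x, f x = y.

Definition exact (X : Type) (Y Z : zmodType) (f : X -> Y) (g : Y -> Z) : Prop :=
  forall y, g y = 0 <-> exists x, f x = y.

Definition isom M N : Prop := exists h : {linear M -> N}, bijective h.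

Definition projective P : Prop :=
  forall X Y (p : {linear X -> Y}) (f : {linear P -> Y}), surj p ->
  exists g : {linear P -> X}, forall x, p (g x) = f x.

(* The universal property of the coproduct; I is any type, possibly empty. *)
Definition is_coproduct (I : Type) (M : I -> lmodType R) (S : lmodType R)
    (iota : forall i, {linear M i -> S}) : Prop :=
  forall (X : lmodType R) (f : forall i, {linear M i -> X}),
    (exists g : {linear S -> X}, forall i x, g (iota i x) = f i x) /\
    (forall g g' : {linear S -> X},
       (forall i x, g (iota i x) = g' (iota i x)) -> g =1 g').

Definition Gen M X : Prop :=
  exists (I : Type) (S : lmodType R) (iota : I -> {linear M -> S})
         (p : {linear S -> X}),
    @is_coproduct I (fun=> M) S iota /\ surj p.

Definition torsion_class (T : lmodType R -> Prop) : Prop :=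
  [/\ forall (I : Type) (M : I -> lmodType R) (S : lmodType R)
        (iota : forall i, {linear M i -> S}),
        is_coproduct iota -> (forall i, T (M i)) -> T S,
      forall X Y (p : {linear X -> Y}), surj p -> T X -> T Y
    & forall X Y Z (i : {linear X -> Y}) (p : {linear Y -> Z}),
        injective i -> exact i p -> surj p -> T X -> T Z -> T Y].

(* The class D_sigma. *)
Definition silting_class P Q (sigma : {linear P -> Q}) X : Prop :=
  forall f : {linear P -> X},
  exists g : {linear Q -> X}, forall x, g (sigma x) = f x.

Definition silting M : Prop :=
  exists P Q (sigma : {linear P -> Q}) (p : {linear Q -> M}),
    [/\ projective P, projective Q, exact sigma p, surj p
      & forall X, silting_class sigma X <-> Gen M X].

Definition silting_equiv M N : Prop := forall X, Gen M X <-> Gen N X.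

Definition indecomposable M : Prop :=
  (exists x : M, x != 0) /\
  forall X Y (h : {linear (X * Y)%type -> M}), bijective h ->
    (forall x : X, x = 0) \/ (forall y : Y, y = 0).

(* f : P -> X is essential onto the kernel of g: it maps onto that kernel, and
   any h : Y -> P such that f \o h still maps onto it is surjective. With P
   projective, this says that P -> ker g is a projective cover. *)
Definition essential_onto_ker P X (Y : zmodType) (f : {linear P -> X})
    (g : X -> Y) : Prop :=
  exact f g /\
  forall Z (h : {linear Z -> P}), exact (fun z => f (h z)) g -> surj h.

Definition minimal_projective_presentation P1 P0 M
    (d : {linear P1 -> P0}) (e : {linear P0 -> M}) : Prop :=
  [/\ projective P1, projective P0, essential_onto_ker d e
    & essential_onto_ker e (fun _ : M => 0 : M)].

End Modules.

Section FiniteDimensionalAlgebra.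

Context {K : fieldType} {A : falgType K}.

(* M is finite dimensional over K, which acts on M through K -> A. *)
Definition findim (M : rmodType A) : Prop :=
  exists (n : nat) (v : 'I_n -> M), forall x : M,
  exists c : 'I_n -> K, x = \sum_i ((c i)%:A : A^c) *: v i.

(* L, with the quotient map pi, is the cokernel, in left A-modules, of
   Hom_A(d, A) : Hom_A(P0, A) -> Hom_A(P1, A). The left A-module structure of
   Hom_A(P1, A) is (a alpha)(x) = a * alpha x, the product of A; the second
   condition says that pi is A-linear. For d from a minimal projective
   presentation of M, L is the transpose Tr M. *)
Definition is_coker_dual (P1 P0 : rmodType A) (d : {linear P1 -> P0})
    (L : lmodType A) (pi : {linear P1 -> regular_rmod A} -> L) : Prop :=
  [/\ surj pi,
      forall (a : A) (alpha beta gamma : {linear P1 -> regular_rmod A}),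
        (forall x, gamma x = a * (alpha x : A) + (beta x : A)) ->
        pi gamma = a *: pi alpha + pi beta
    & forall alpha : {linear P1 -> regular_rmod A},
        pi alpha = 0 <->
        exists beta : {linear P0 -> regular_rmod A},
        forall x, beta (d x) = alpha x].

(* The pairing identifies the right A-module N with the K-dual Hom_K(L, K) of
   the left A-module L, on which A acts by (phi . a)(l) = phi(a l). *)
Definition is_Kdual (L : lmodType A) (N : rmodType A) (pairing : N -> L -> K)
    : Prop :=
  let Klinear (phi : L -> K) :=
    forall (c : K) (l l' : L), phi ((c%:A : A) *: l + l') = c * phi l + phi l'
  in
  [/\ forall n, Klinear (pairing n),
      forall n n' l, pairing (n + n') l = pairing n l + pairing n' l,
      forall (a : A) n l, pairing ((a : A^c) *: n) l = pairing n (a *: l)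
    & forall phi : L -> K, Klinear phi ->
        exists! n : N, forall l, pairing n l = phi l].

(* N is isomorphic to the Auslander-Reiten translate D Tr M. *)
Definition is_AR_translate (M N : rmodType A) : Prop :=
  exists (P1 P0 : rmodType A) (d : {linear P1 -> P0}) (e : {linear P0 -> M})
         (L : lmodType A) (pi : {linear P1 -> regular_rmod A} -> L)
         (pairing : N -> L -> K),
    [/\ minimal_projective_presentation d e, is_coker_dual d pi
      & is_Kdual pairing].

Definition tau_rigid (M : rmodType A) : Prop :=
  findim M /\
  exists2 N : rmodType A, is_AR_translate M N
    & forall (f : {linear M -> N}) x, f x = 0.

End FiniteDimensionalAlgebra.

(* Among the equivalent conditions of Demonet-Iyama-Jasso: finitely many
   isomorphism classes of indecomposable tau-rigid modules. *)
Definition tau_tilting_finite (K : fieldType) (A : falgType K) : Prop :=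
  exists (n : nat) (M : 'I_n -> rmodType A),
  forall N : rmodType A, tau_rigid N -> indecomposable N ->
  exists i, isom (M i) N.

Section Tor.

Context {A : pzRingType}.

Definition balanced (M : rmodType A) (N : lmodType A) (T : zmodType)
    (t : M -> N -> T) : Prop :=
  [/\ forall x x' y, t (x + x') y = t x y + t x' y,
      forall x y y', t x (y + y') = t x y + t x y'
    & forall (a : A) x y, t ((a : A^c) *: x) y = t x (a *: y)].

Definition is_tensor (M : rmodType A) (N : lmodType A) (T : zmodType)
    (t : M -> N -> T) : Prop :=
  balanced t /\
  forall (U : zmodType) (u : M -> N -> U), balanced u ->
    (exists g : {additive T -> U}, forall x y, g (t x y) = u x y) /\
    (forall g g' : {additive T -> U},
       (forall x y, g (t x y) = g' (t x y)) -> g =1 g').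

(* Tor_1^A(M, N) = 0: D2 and D1 are d2 (x) N and d1 (x) N, where
   P2 -> P1 -> P0 -> M -> 0 is the start of a projective resolution of M, and
   Tor_1^A(M, N) is the homology at P1 (x) N. *)
Definition Tor1_vanishes (M : rmodType A) (N : lmodType A) : Prop :=
  exists (P2 P1 P0 : rmodType A) (d2 : {linear P2 -> P1})
         (d1 : {linear P1 -> P0}) (e : {linear P0 -> M}),
    [/\ projective P2, projective P1 & projective P0] /\
    [/\ exact d2 d1, exact d1 e & surj e] /\
    exists (T2 T1 T0 : zmodType) (t2 : P2 -> N -> T2) (t1 : P1 -> N -> T1)
           (t0 : P0 -> N -> T0) (D2 : {additive T2 -> T1})
           (D1 : {additive T1 -> T0}),
      [/\ is_tensor t2, is_tensor t1 & is_tensor t0] /\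
      [/\ forall x y, D2 (t2 x y) = t1 (d2 x) y,
          forall x y, D1 (t1 x y) = t0 (d1 x) y
        & exact D2 D1].

End Tor.

(* For f : A -> B, the ring B as a left A-module, a *: b = f a * b, and as a
   right A-module, b . a = b * f a. *)
Definition left_via (A B : pzRingType) (f : {rmorphism A -> B}) : Type := B.
Definition right_via (A B : pzRingType) (f : {rmorphism A -> B}) : Type := B.

Section RestrictionOfScalars.

Context (A B : pzRingType) (f : {rmorphism A -> B}).

HB.instance Definition _ := GRing.Zmodule.copy (left_via f) B.
HB.instance Definition _ := GRing.Zmodule.copy (right_via f) B.

Let lscale (a : A) (b : left_via f) : left_via f := f a * (b : B).
Let rscale (a : A^c) (b : right_via f) : right_via f := (b : B) * f a.

Fact lscaleA a b v : lscale a (lscale b v) = lscale (a * b) v.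
Proof. by rewrite /lscale rmorphM mulrA. Qed.
Fact lscale1 : left_id 1 lscale.
Proof. by move=> v; rewrite /lscale rmorph1 mul1r. Qed.
Fact lscaleDr : right_distributive lscale +%R.
Proof. by move=> a u v; rewrite /lscale mulrDr. Qed.
Fact lscaleDl v : {morph lscale^~ v : a b / a + b}.
Proof. by move=> a b; rewrite /lscale rmorphD mulrDl. Qed.
HB.instance Definition _ :=
  GRing.Zmodule_isLmodule.Build A (left_via f)
    lscaleA lscale1 lscaleDr lscaleDl.

Fact rscaleA a b v : rscale a (rscale b v) = rscale (a * b) v.
Proof. by rewrite /rscale -mulrA -rmorphM. Qed.
Fact rscale1 : left_id 1 rscale.
Proof. by move=> v; rewrite /rscale rmorph1 mulr1. Qed.
Fact rscaleDr : right_distributive rscale +%R.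
Proof. by move=> a u v; rewrite /rscale mulrDl. Qed.
Fact rscaleDl v : {morph rscale^~ v : a b / a + b}.
Proof. by move=> a b; rewrite /rscale rmorphD mulrDr. Qed.
HB.instance Definition _ :=
  GRing.Zmodule_isLmodule.Build A^c (right_via f)
    rscaleA rscale1 rscaleDr rscaleDl.

End RestrictionOfScalars.

(* Rings here are pzRingTypes, so that the zero ring is allowed. *)
Definition ring_epi (A B : pzRingType) (f : {rmorphism A -> B}) : Prop :=
  forall (C : pzRingType) (g h : {rmorphism B -> C}),
  (forall a, g (f a) = h (f a)) -> g =1 h.

Definition epi_equiv (A B1 B2 : pzRingType) (f1 : {rmorphism A -> B1})
    (f2 : {rmorphism A -> B2}) : Prop :=
  exists2 h : {rmorphism B1 -> B2}, bijective h & forall a, f2 a = h (f1 a).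

Definition finitely_many_Tor1_epiclasses (A : pzRingType) : Prop :=
  exists (n : nat) (B : 'I_n -> pzRingType) (f : forall i, {rmorphism A -> B i}),
  forall (C : pzRingType) (g : {rmorphism A -> C}),
    ring_epi g -> Tor1_vanishes (right_via g) (left_via g) ->
    exists i, epi_equiv (f i) g.

(* Main.v *)
(** All four conditions are equivalent to the finiteness of the set of torsion
classes Gen(M) with M finite dimensional and tau-rigid.

Let T = Gen(M) be such a class, A -> T0 a minimal left T-approximation and T1
its cokernel. The modules X in T with Hom(T1, X) = 0 form a wide subcategory W,
and B = T0 / tr_T1(T0) is the reflection of A in W; by Nakayama's lemma T is the
smallest torsion class containing B. A torsion class T' strictly inside T misses
one of the finitely many simple objects S of W, because every nonzero object of
W has a simple quotient. If X_S is a minimal T-submodule of T0 mapping onto S,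
then T' lies in Gen(G_S), where G_S is the sum of T1 and of the X_S' for
S' <> S, and Gen(G_S) is strictly inside T. So every torsion class that is not
of the form Gen(M) lies below an infinite strictly descending chain of classes that are.

Silting modules: if A -> M is a left Gen(M)-approximation and Gen(M) is contained
in D_sigma for a presentation sigma of M, then the cone of a lift of A -> M to
sigma has D = Gen(M), and completes M to a silting module. Conversely, along an
infinite descending chain the intersection D of the classes is solvability of a
family of linear systems; formal solutions generate a module M with D = Gen(M),
so D comes from a silting module. If it is finite dimensional, then D is the
class of the modules with no map to a finite dimensional N, namely a translate,
and the traces in N of the members of the chain stabilise, hence so does the
chain.

Ring epimorphisms: B is the underlying module of a ring, A -> B is an epimorphism
with Tor_1(B, B) = 0, and T is recovered from B. Conversely, given an epimorphism
A -> C with Tor_1(C, C) = 0, the torsion class generated by C determines its wide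
subcategory W, which consists of the C-modules, and hence the epiclass. *)

From HB Require Import structures.
Require Import Defs.
From mathcomp Require Import all_boot all_algebra all_field.
From mathcomp Require Import boolp.
From mathcomp Require classical_sets.

Set Implicit Arguments.
Unset Strict Implicit.
Unset Printing Implicit Defensive.

Import GRing.Theory.
Local Open Scope ring_scope.

(** * Modules and torsion classes *)

(** The working notion is [rigid]: a finite dimensional M lying in [silting_class sigma] for some
    projective presentation sigma of M. It amounts to tau-rigidity, because for a map d of finite
    dimensional projectives the class of d consists of the modules with no nonzero map to the K-dual
    of the cokernel of Hom(d, A). It also amounts to Ext^1(M, Gen(M)) = 0, the form [relproj] in
    which approximations produce it. The obstacle is that torsion classes here have infinite
    dimensional members, to which no length argument applies. Chain conditions are used only inside
    finite dimensional modules; arbitrary members are reached because a nonzero object of W has a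
    nonzero finite dimensional quotient in W, found by a linear functional, and because for rigid M
    the class Gen(M) is the solvability of a finite linear system over A. Finiteness is counted on
    the classes Gen(M) and not on modules. An indecomposable finite dimensional M is determined by
    Gen(M) among indecomposables, and a module is spanned by its indecomposable summands, so
    uniqueness of decompositions is never invoked. *)

Record quot_data (T : Type) := QuotData {
  qd_eqv : T -> T -> Prop;
  qd_refl : forall x, qd_eqv x x;
  qd_sym : forall x y, qd_eqv x y -> qd_eqv y x;
  qd_trans : forall x y z, qd_eqv x y -> qd_eqv y z -> qd_eqv x z }.

Section Quotient.
Context (T : Type) (E : quot_data T).

Definition quot : Type := {c : T -> Prop | exists x, c = qd_eqv E x}.
Definition qpi (x : T) : quot := exist _ (qd_eqv E x) (ex_intro _ x erefl).

Lemma qpi_eq x y : qpi x = qpi y <-> qd_eqv E x y.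
Proof.
split=> [[] e|xy]; first by rewrite e; exact: qd_refl.
apply: eq_exist; apply/funext => z; apply/propext; split.
  exact/qd_trans/qd_sym.
exact: qd_trans.
Qed.

Definition qrepr (c : quot) : T := projT1 (cid (svalP c)).

Lemma qreprK : cancel qrepr qpi.
Proof.
move=> [c Hc]; rewrite /qrepr; case: cid => x /= e.
by apply: eq_exist; rewrite e.
Qed.

End Quotient.

(** The axioms hold only up to the equivalence, so that subset types, formal sums and spaces of
    functionals can serve as carriers; the laws become equations in the quotient. *)
Record zmod_data := ZmodData {
  zd_car :> Type;
  zd_eqv : quot_data zd_car;
  zd_zero : zd_car;
  zd_opp : zd_car -> zd_car;
  zd_add : zd_car -> zd_car -> zd_car;
  zd_oppE : forall x y, qd_eqv zd_eqv x y -> qd_eqv zd_eqv (zd_opp x) (zd_opp y);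
  zd_addE : forall x x' y y', qd_eqv zd_eqv x x' -> qd_eqv zd_eqv y y' ->
    qd_eqv zd_eqv (zd_add x y) (zd_add x' y');
  zd_addA : forall x y z,
    qd_eqv zd_eqv (zd_add x (zd_add y z)) (zd_add (zd_add x y) z);
  zd_addC : forall x y, qd_eqv zd_eqv (zd_add x y) (zd_add y x);
  zd_add0 : forall x, qd_eqv zd_eqv (zd_add zd_zero x) x;
  zd_addN : forall x, qd_eqv zd_eqv (zd_add (zd_opp x) x) zd_zero }.

Definition zquot (Z : zmod_data) : Type := quot (zd_eqv Z).

Section ZmodQuotient.
Context (Z : zmod_data).
Local Notation pi := (qpi (zd_eqv Z)).

Let add (x y : zquot Z) : zquot Z := pi (zd_add (qrepr x) (qrepr y)).
Let opp (x : zquot Z) : zquot Z := pi (zd_opp (qrepr x)).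

Fact zquot_piD x y : pi (zd_add x y) = add (pi x) (pi y).
Proof. by apply/qpi_eq/zd_addE; apply/qpi_eq; rewrite qreprK. Qed.
Fact zquot_piN x : pi (zd_opp x) = opp (pi x).
Proof. by apply/qpi_eq/zd_oppE/qpi_eq; rewrite qreprK. Qed.

Fact zquot_addA : associative add.
Proof.
move=> x y z; rewrite -(qreprK x) -(qreprK y) -(qreprK z) -!zquot_piD.
exact/qpi_eq/zd_addA.
Qed.
Fact zquot_addC : commutative add.
Proof.
move=> x y; rewrite -(qreprK x) -(qreprK y) -!zquot_piD.
exact/qpi_eq/zd_addC.
Qed.
Fact zquot_add0 : left_id (pi (zd_zero Z)) add.
Proof. by move=> x; rewrite -(qreprK x) -zquot_piD; apply/qpi_eq/zd_add0. Qed.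
Fact zquot_addN : left_inverse (pi (zd_zero Z)) opp add.
Proof.
move=> x; rewrite -(qreprK x) -zquot_piN -zquot_piD.
exact/qpi_eq/zd_addN.
Qed.

HB.instance Definition _ := gen_eqMixin (zquot Z).
HB.instance Definition _ := gen_choiceMixin (zquot Z).
HB.instance Definition _ :=
  GRing.isZmodule.Build (zquot Z)
    zquot_addA zquot_addC zquot_add0 zquot_addN.

End ZmodQuotient.

Record lmod_data (R : pzRingType) := LmodData {
  ld_zmod :> zmod_data;
  ld_scale : R -> ld_zmod -> ld_zmod;
  ld_scaleE : forall a x y, qd_eqv (zd_eqv ld_zmod) x y ->
    qd_eqv (zd_eqv ld_zmod) (ld_scale a x) (ld_scale a y);
  ld_scaleA : forall a b x,
    qd_eqv (zd_eqv ld_zmod) (ld_scale a (ld_scale b x)) (ld_scale (a * b) x);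
  ld_scale1 : forall x, qd_eqv (zd_eqv ld_zmod) (ld_scale 1 x) x;
  ld_scaleDr : forall a x y,
    qd_eqv (zd_eqv ld_zmod) (ld_scale a (zd_add x y))
      (zd_add (ld_scale a x) (ld_scale a y));
  ld_scaleDl : forall x a b,
    qd_eqv (zd_eqv ld_zmod) (ld_scale (a + b) x)
      (zd_add (ld_scale a x) (ld_scale b x)) }.

Definition lquot (R : pzRingType) (L : lmod_data R) : Type := zquot L.

Section LmodQuotient.
Context (R : pzRingType) (L : lmod_data R).
Local Notation pi := (qpi (zd_eqv L)).

HB.instance Definition _ := GRing.Zmodule.copy (lquot L) (zquot L).

Let scale (a : R) (x : lquot L) : lquot L := pi (ld_scale a (qrepr x)).

Fact lquot_piZ a x : pi (ld_scale a x) = scale a (pi x).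
Proof. by apply/qpi_eq/ld_scaleE/qpi_eq; rewrite qreprK. Qed.
Fact lquot_piD x y : pi (zd_add x y) = (pi x : lquot L) + (pi y : lquot L).
Proof. exact: zquot_piD. Qed.

Fact lquot_scaleA a b v : scale a (scale b v) = scale (a * b) v.
Proof. by rewrite -(qreprK v) -!lquot_piZ; apply/qpi_eq/ld_scaleA. Qed.
Fact lquot_scale1 : left_id 1 scale.
Proof. by move=> v; rewrite -(qreprK v) -!lquot_piZ; apply/qpi_eq/ld_scale1. Qed.
Fact lquot_scaleDr : right_distributive scale +%R.
Proof.
move=> a u v; rewrite -(qreprK u) -(qreprK v) -[in RHS]lquot_piZ -[in RHS]lquot_piZ.
rewrite -[in RHS]lquot_piD -[in LHS]lquot_piD -lquot_piZ.
exact/qpi_eq/ld_scaleDr.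
Qed.
Fact lquot_scaleDl v : {morph scale^~ v : a b / a + b}.
Proof.
move=> a b; rewrite -(qreprK v) -!lquot_piZ -!lquot_piD.
exact/qpi_eq/ld_scaleDl.
Qed.
HB.instance Definition _ :=
  GRing.Zmodule_isLmodule.Build R (lquot L)
    lquot_scaleA lquot_scale1 lquot_scaleDr lquot_scaleDl.

Lemma lquotP : exists (Q : lmodType R) (pi : L -> Q),
  [/\ surj pi, forall x y, pi (zd_add x y) = pi x + pi y,
      forall a x, pi (ld_scale a x) = a *: pi x
    & forall x y, pi x = pi y <-> qd_eqv (zd_eqv L) x y].
Proof.
exists (lquot L), (pi : L -> lquot L); split.
- by move=> y; exists (qrepr y); rewrite qreprK.
- exact: lquot_piD.
- exact: lquot_piZ.
- exact: qpi_eq.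
Qed.

End LmodQuotient.

Section Submodules.
Context {R : pzRingType}.
Implicit Types M N P Q X Y Z : lmodType R.

Lemma linear_of X Y (f : X -> Y) :
  (forall a x y, f (a *: x + y) = a *: f x + f y) ->
  exists g : {linear X -> Y}, g =1 f.
Proof.
move=> H; pose m := GRing.isLinear.Build R X Y *:%R f H.
by exists (HB.pack_for {linear X -> Y} f m).
Qed.

Definition submod M (N : M -> Prop) : Prop :=
  N 0 /\ forall a x y, N x -> N y -> N (a *: x + y).

Lemma submodD M (N : M -> Prop) x y : submod N -> N x -> N y -> N (x + y).
Proof. by move=> [_ H] Nx Ny; rewrite -[x]scale1r; exact: H. Qed.
Lemma submodZ M (N : M -> Prop) a x : submod N -> N x -> N (a *: x).
Proof. by move=> [H0 H] Nx; rewrite -[_ *: _]addr0; exact: H. Qed.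
Lemma submodN M (N : M -> Prop) x : submod N -> N x -> N (- x).
Proof. by move=> sN Nx; rewrite -scaleN1r; exact: submodZ. Qed.
Lemma submod_sum M (N : M -> Prop) I (r : seq I) (P : pred I) (F : I -> M) :
  submod N -> (forall i, P i -> N (F i)) -> N (\sum_(i <- r | P i) F i).
Proof.
move=> sN H; elim/big_ind: _ => //; first by case: sN.
by move=> x y; exact: submodD.
Qed.

Lemma submod_all M : submod (fun _ : M => True).
Proof. by []. Qed.
Lemma submod_0 M : submod (fun x : M => x = 0).
Proof. by split=> // a x y -> ->; rewrite scaler0 addr0. Qed.
Lemma submod_ker X Y (f : {linear X -> Y}) : submod (fun x => f x = 0).
Proof.
split=> [|a x y fx fy]; first exact: linear0.
by rewrite linearP fx fy scaler0 addr0.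
Qed.
Lemma submod_pre X Y (f : {linear X -> Y}) (N : Y -> Prop) :
  submod N -> submod (fun x => N (f x)).
Proof.
move=> [N0 NP]; split=> [|a x y fx fy]; first by rewrite linear0.
by rewrite linearP; exact: NP.
Qed.
Lemma submod_im X Y (f : {linear X -> Y}) (N : X -> Prop) : submod N ->
  submod (fun y => exists2 x, N x & f x = y).
Proof.
move=> [N0 NP]; split=> [|a y y' [x Nx <-] [x' Nx' <-]].
  by exists 0; rewrite ?linear0.
by exists (a *: x + x'); rewrite ?linearP //; exact: NP.
Qed.
Lemma submod_range X Y (f : {linear X -> Y}) :
  submod (fun y => exists x, f x = y).
Proof.
split=> [|a y y' [x <-] [x' <-]]; first by exists 0; rewrite linear0.
by exists (a *: x + x'); rewrite linearP.
Qed.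
Lemma submodI M (N N' : M -> Prop) : submod N -> submod N' ->
  submod (fun x => N x /\ N' x).
Proof. by move=> [N0 NP] [N0' NP']; split=> // a x y [? ?] [? ?]; split; auto. Qed.
Hint Resolve submod_all submod_0 submod_ker submod_range : core.

Lemma quotient_ex M (N : M -> Prop) : submod N ->
  exists (Q : lmodType R) (q : {linear M -> Q}),
    surj q /\ forall x, q x = 0 <-> N x.
Proof.
move=> sN.
have [N0 NP] := sN.
pose E : quot_data M := @QuotData _ (fun x y => N (x - y))
  ltac:(move=> x; by rewrite /= subrr)
  ltac:(move=> x y /= H; rewrite -opprB; exact: submodN)
  ltac:(move=> x y z /= H1 H2; rewrite -(subrKA y); exact: submodD).
pose Z : zmod_data := @ZmodData M E 0 -%R +%R
  ltac:(move=> x y H; rewrite /E /= -opprD; exact: submodN)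
  ltac:(move=> x x' y y' H1 H2; rewrite /E /= opprD addrACA; exact: submodD)
  ltac:(move=> x y z; by rewrite /E /= addrA subrr)
  ltac:(move=> x y; by rewrite /E /= [x + y]addrC subrr)
  ltac:(move=> x; by rewrite /E /= add0r subrr)
  ltac:(move=> x; by rewrite /E /= addNr subrr).
pose L : lmod_data R := @LmodData R Z *:%R
  ltac:(move=> a x y H; rewrite /Z /E /= -scalerBr; exact: submodZ)
  ltac:(move=> a b x; by rewrite /Z /E /= scalerA subrr)
  ltac:(move=> x; by rewrite /Z /E /= scale1r subrr)
  ltac:(move=> a x y; by rewrite /Z /E /= scalerDr subrr)
  ltac:(move=> x a b; by rewrite /Z /E /= scalerDl subrr).
have [Q [pi [spi piD piZ piE]]] := lquotP L.
have [q qE] := @linear_of M Q pi ltac:(by move=> a x y; rewrite -piZ -piD).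
exists Q, q; split=> [y|x].
  by have [x <-] := spi y; exists x; rewrite qE.
by rewrite -(linear0 q) !qE piE /= subr0.
Qed.

Lemma submodule_ex M (N : M -> Prop) : submod N ->
  exists (S : lmodType R) (i : {linear S -> M}),
    injective i /\ forall x, N x <-> exists s, i s = x.
Proof.
move=> sN; have [N0 NP] := sN.
pose T := {x | N x}.
pose E : quot_data T := @QuotData _ (fun x y => sval x = sval y)
  ltac:(by []) ltac:(by []) ltac:(by move=> x y z /= -> ->).
pose Z : zmod_data := @ZmodData T E (exist _ 0 N0)
  (fun x => exist _ (- sval x) (submodN sN (svalP x)))
  (fun x y => exist _ (sval x + sval y) (submodD sN (svalP x) (svalP y)))
  ltac:(by rewrite /E => x y /= ->)
  ltac:(by rewrite /E => x x' y y' /= -> ->)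
  ltac:(move=> x y z; by rewrite /E /= addrA)
  ltac:(move=> x y; by rewrite /E /= addrC)
  ltac:(move=> x; by rewrite /E /= add0r)
  ltac:(move=> x; by rewrite /E /= addNr).
pose L : lmod_data R := @LmodData R Z
  (fun a x => exist _ (a *: sval x) (submodZ a sN (svalP x)))
  ltac:(by rewrite /Z /E => a x y /= ->)
  ltac:(move=> a b x; by rewrite /Z /E /= scalerA)
  ltac:(move=> x; by rewrite /Z /E /= scale1r)
  ltac:(move=> a x y; by rewrite /Z /E /= scalerDr)
  ltac:(move=> x a b; by rewrite /Z /E /= scalerDl).
have [S [pi [spi piD piZ piE]]] := lquotP L.
have [r rK] := choice spi.
have rD x y : sval (r (x + y)) = sval (r x) + sval (r y).
  have := piE (r (x + y)) (zd_add (r x) (r y)).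
  by rewrite rK piD !rK => -[+ _]; apply.
have rZ a x : sval (r (a *: x)) = a *: sval (r x).
  have := piE (r (a *: x)) (@ld_scale _ L a (r x)).
  by rewrite rK piZ !rK => -[+ _]; apply.
have [i iE] := @linear_of S M (fun s => sval (r s))
  ltac:(by move=> a x y /=; rewrite rD rZ).
exists S, i; split=> [x y|x].
  by rewrite !iE => /(piE (r x) (r y)).2; rewrite !rK.
split=> [Nx|[s <-]]; last by rewrite iE; exact: svalP.
exists (pi (exist _ x Nx)); rewrite iE.
by have /piE := rK (pi (exist _ x Nx)).
Qed.

Lemma factor_surj X Y Z (p : {linear X -> Y}) (f : {linear X -> Z}) :
  surj p -> (forall x, p x = 0 -> f x = 0) ->
  exists g : {linear Y -> Z}, forall x, g (p x) = f x.
Proof.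
move=> sp H; have [r rK] := choice sp.
have fr x : f (r (p x)) = f x.
  by apply/eqP; rewrite -subr_eq0 -linearB; apply/eqP/H; rewrite linearB /= rK subrr.
have [g gE] := @linear_of Y Z (fun y => f (r y)) ltac:(
  by move=> a x y /=; rewrite -{1}(rK x) -{1}(rK y) -linearP fr linearP).
by exists g => x; rewrite gE fr.
Qed.

Lemma factor_inj X Y Z (i : {linear X -> Y}) (f : {linear Z -> Y}) :
  injective i -> (forall z, exists x, i x = f z) ->
  exists g : {linear Z -> X}, forall z, i (g z) = f z.
Proof.
move=> ii H; have [g gE] := choice H.
have [h hE] := @linear_of Z X g ltac:(
  by move=> a x y; apply: ii; rewrite linearP !gE linearP).
by exists h => z; rewrite hE.
Qed.

(** Submodules are predicates, so N is tested for membership in T through some module embedded with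
    image N. By [smodP] the choice of that module is immaterial when T is closed under quotients. *)
Definition smod M (T : lmodType R -> Prop) (N : M -> Prop) : Prop :=
  exists (S : lmodType R) (i : {linear S -> M}),
    [/\ injective i, forall x, N x <-> exists s, i s = x & T S].

Lemma smod_submod M T (N : M -> Prop) : smod T N -> submod N.
Proof.
move=> [S [i [_ iE _]]]; have [H0 HP] := submod_range i.
split=> [|a x y]; first exact/iE.
by move=> /iE Hx /iE Hy; apply/iE; exact: HP.
Qed.

Section Class.
Context (T : lmodType R -> Prop).
Hypothesis TQ : forall X Y (p : {linear X -> Y}), surj p -> T X -> T Y.

Lemma smodP M (N : M -> Prop) (S : lmodType R) (i : {linear S -> M}) : injective i ->
  (forall x, N x <-> exists s, i s = x) -> smod T N -> T S.
Proof.
move=> ii iE [S' [j [ij jE TS']]].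
have [g gE] := @factor_inj _ _ _ i j ii ltac:(
  by move=> z; apply/iE/jE; exists z).
apply: (TQ (p := g) _ TS') => s.
have /jE[z zE] : N (i s) by apply/iE; exists s.
by exists z; apply: ii; rewrite gE.
Qed.

Lemma smod_range X Y (f : {linear X -> Y}) : T X ->
  smod T (fun y => exists x, f x = y).
Proof.
move=> TX; have [S [i [ii iE]]] := submodule_ex (submod_range f).
exists S, i; split=> //.
have [g gE] := @factor_inj _ _ _ i f ii ltac:(by move=> z; apply/iE; exists z).
apply: (TQ (p := g) _ TX) => s.
have [|x xE] := (iE (i s)).2; first by exists s.
by exists x; apply: ii; rewrite gE.
Qed.

Lemma smod_ext M (N N' : M -> Prop) : (forall x, N x <-> N' x) ->
  smod T N -> smod T N'.
Proof. by move=> H; have -> : N = N' by apply/funext => x; apply/propext. Qed.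

Lemma smod_im X Y (f : {linear X -> Y}) (N : X -> Prop) : smod T N ->
  smod T (fun y => exists2 x, N x & f x = y).
Proof.
move=> [S [i [ii iE TS]]].
apply: smod_ext (smod_range (f \o i) TS) => y; split=> [[s <-]|[x /iE[s <-] <-]].
  by exists (i s) => //; apply/iE; exists s.
by exists s.
Qed.

End Class.

Lemma smodT (T : lmodType R -> Prop) M : T M -> smod T (fun _ : M => True).
Proof.
move=> TM; exists M, idfun; split=> // x; split=> // _; by exists x.
Qed.

Lemma linear_eq_ker X Y (p : {linear X -> Y}) x x' :
  p x = p x' -> p (x - x') = 0.
Proof. by move=> e; rewrite linearB /= e subrr. Qed.

Lemma linear_iter M (g : {linear M -> M}) k :
  exists h : {linear M -> M}, forall x, h x = iter k g x.
Proof.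
elim: k => [|k [h hE]]; first by exists idfun.
by exists (g \o h) => x; rewrite /= hE.
Qed.

Lemma linear_inverse X Y (f : {linear X -> Y}) : bijective f ->
  exists g : {linear Y -> X}, cancel f g /\ cancel g f.
Proof.
move=> [g fK gK].
have [h hE] := @linear_of Y X g ltac:(
  by move=> a x y; apply: (can_inj fK); rewrite linearP !gK).
by exists h; split=> x; rewrite hE.
Qed.

Lemma linear_bij X Y (f : {linear X -> Y}) : injective f -> surj f -> bijective f.
Proof.
move=> fi /choice[g gK]; exists g => // x; exact/fi/gK.
Qed.

Lemma linear_inj X Y (f : {linear X -> Y}) :
  (forall x, f x = 0 -> x = 0) -> injective f.
Proof. by move=> H x y /linear_eq_ker/H/eqP; rewrite subr_eq0 => /eqP. Qed.

End Submodules.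
Hint Resolve submod_all submod_0 submod_ker submod_range : core.

(** * Coproducts, traces and the class Gen(M) *)

Section Coproducts.
Context {R : pzRingType}.
Implicit Types M N P Q X Y Z : lmodType R.

Section Construction.
Context (I : Type) (M : I -> lmodType R).

(* A formal sum is evaluated by any family of linear maps; formal sums with the
   same values under all families are identified. *)
Let eval X (f : forall i, {linear M i -> X}) (l : seq {i : I & M i}) : X :=
  \sum_(x <- l) f (tag x) (tagged x).
Let eqv (l l' : seq {i : I & M i}) : Prop :=
  forall X (f : forall i, {linear M i -> X}), eval f l = eval f l'.
Let opp (l : seq {i : I & M i}) : seq {i : I & M i} :=
  map (fun x : {i : I & M i} => existT (fun i => M i : Type) (tag x) (- (tagged x : M (tag x)))) l.
Let scale (a : R) (l : seq {i : I & M i}) : seq {i : I & M i} :=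
  map (fun x : {i : I & M i} => existT (fun i => M i : Type) (tag x) (a *: (tagged x : M (tag x)))) l.

Let evalN X (f : forall i, {linear M i -> X}) l : eval f (opp l) = - eval f l.
Proof.
rewrite /eval /opp big_map -sumrN; apply: eq_bigr => x _.
by rewrite linearN.
Qed.
Let evalZ X (f : forall i, {linear M i -> X}) a l :
  eval f (scale a l) = a *: eval f l.
Proof.
rewrite /eval /scale big_map scaler_sumr; apply: eq_bigr => x _.
by rewrite linearZ.
Qed.
Let evalD X (f : forall i, {linear M i -> X}) l l' :
  eval f (l ++ l') = eval f l + eval f l'.
Proof. by rewrite /eval big_cat. Qed.
Let eval0 X (f : forall i, {linear M i -> X}) : eval f [::] = 0.
Proof. by rewrite /eval big_nil. Qed.

Lemma coproduct_ex : exists (S : lmodType R) (iota : forall i, {linear M i -> S}),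
  is_coproduct iota.
Proof.
pose E : quot_data (seq {i : I & M i}) := @QuotData _ eqv
  ltac:(by []) ltac:(by move=> x y H X f; rewrite H)
  ltac:(by move=> x y z H1 H2 X f; rewrite H1).
pose Z : zmod_data := @ZmodData (seq {i : I & M i}) E [::] opp cat
  ltac:(rewrite /E => x y /= H X f; by rewrite !evalN H)
  ltac:(rewrite /E => x x' y y' /= H1 H2 X f; by rewrite !evalD H1 H2)
  ltac:(rewrite /E => x y z /= X f; by rewrite !evalD addrA)
  ltac:(rewrite /E => x y /= X f; by rewrite !evalD addrC)
  ltac:(rewrite /E => x /= X f; by [])
  ltac:(rewrite /E => x /= X f; by rewrite evalD evalN addNr eval0).
pose L : lmod_data R := @LmodData R Z scale
  ltac:(rewrite /Z /E => a x y /= H X f; by rewrite !evalZ H)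
  ltac:(rewrite /Z /E => a b x /= X f; by rewrite !evalZ scalerA)
  ltac:(rewrite /Z /E => x /= X f; by rewrite !evalZ scale1r)
  ltac:(rewrite /Z /E => a x y /= X f; by rewrite evalZ !evalD !evalZ scalerDr)
  ltac:(rewrite /Z /E => x a b /= X f; by rewrite evalD !evalZ scalerDl).
have [S [pi [spi piD piZ piE]]] := lquotP L.
have iotaP i : exists g : {linear M i -> S}, forall x, g x = pi [:: existT (fun i => M i : Type) i x].
  apply: linear_of => a x y; rewrite -piZ -piD; apply/piE => X f.
  transitivity (eval f (scale a [:: existT (fun i => M i : Type) i x] ++
    [:: existT (fun i => M i : Type) i y])) => //.
  by rewrite evalD evalZ /eval !big_seq1 /= linearP.
pose iota i := sval (cid (iotaP i)).
have iotaE i x : iota i x = pi [:: existT (fun i => M i : Type) i x] by exact: svalP (cid (iotaP i)) x.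
have pi0 : pi [::] = 0.
  by apply: (@addrI _ (pi [::])); rewrite -piD addr0.
have piS l : pi l = \sum_(x <- l) iota (tag x) (tagged x).
  elim: l => [|x l IH]; first by rewrite big_nil.
  by rewrite big_cons -IH iotaE -piD /=; case: x.
exists S, iota => X f; split.
  have [r rK] := choice spi.
  have H l l' : pi l = pi l' -> eval f l = eval f l' by move=> /piE; apply.
  have [g gE] := @linear_of _ S X (fun s => eval f (r s)) ltac:(
    move=> a x y /=; rewrite -evalZ -evalD; apply: H;
    by rewrite rK piD piZ !rK).
  exists g => i x; rewrite gE (H _ [:: existT (fun i => M i : Type) i x]); last by rewrite rK iotaE.
  by rewrite /eval big_seq1.
move=> g g' H s; have [l <-] := spi s.
by rewrite piS !linear_sum; apply: eq_bigr => x _; exact: H.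
Qed.

End Construction.

(** The projection to S / N and the zero map agree on every summand, hence are equal. *)
Lemma coproduct_span I (M : I -> lmodType R) (S : lmodType R) (iota : forall i, {linear M i -> S})
    (N : S -> Prop) : is_coproduct iota -> submod N ->
  (forall i x, N (iota i x)) -> forall s, N s.
Proof.
move=> cop sN H; have [Q [q [sq qE]]] := quotient_ex sN.
have [_ U] := cop Q (fun i => q \o iota i).
have [g0 g0E] := @linear_of _ S Q (fun=> 0) ltac:(by move=> a x y; rewrite scaler0 addr0).
move=> s; apply/qE; rewrite (U q g0) ?g0E // => i x.
by rewrite g0E; apply/qE.
Qed.

Lemma linear_zero X Y : exists g : {linear X -> Y}, forall x, g x = 0.
Proof. by apply: linear_of => a x y; rewrite scaler0 addr0. Qed.

Lemma linear_add X Y (f g : {linear X -> Y}) :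
  exists h : {linear X -> Y}, forall x, h x = f x + g x.
Proof. by apply: linear_of => a x y; rewrite !linearP scalerDr addrACA. Qed.
Lemma linear_sub X Y (f g : {linear X -> Y}) :
  exists h : {linear X -> Y}, forall x, h x = f x - g x.
Proof.
by apply: linear_of => a x y; rewrite (linearP f) (linearP g) scalerBr opprD addrACA.
Qed.

Section ConstantFamily.
Context (I : Type) (M S : lmodType R) (iota : I -> {linear M -> S}).
Hypothesis cop : @is_coproduct R I (fun=> M) S iota.

Lemma coproduct_proj i : exists pi : {linear S -> M},
  (forall x, pi (iota i x) = x) /\ forall j x, j <> i -> pi (iota j x) = 0.
Proof.
have [z zE] := linear_zero M M.
have [[g gE] _] := cop (X := M) (fun j =>
  if pselect (j = i) then (idfun : {linear M -> M}) else z).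
exists g; split=> [x|j x ne]; rewrite gE; by case: pselect.
Qed.

Lemma coproduct_joint_inj s :
  (forall pi : {linear S -> M},
    (exists i, (forall x, pi (iota i x) = x) /\
      forall j x, j <> i -> pi (iota j x) = 0) -> pi s = 0) -> s = 0.
Proof.
have [p pE] := choice coproduct_proj => H.
pose J : eqType := {classic I}.
(* [l] is a support of s. The formula is required for all larger duplicate-free lists, so that the
   supports of two elements can be merged. *)
suff [l lE] : exists l : seq J, forall l' : seq J, {subset l <= l'} -> uniq l' ->
    s = \sum_(i <- l') iota i (p i s).
  rewrite (lE (undup l)) ?undup_uniq //; last by move=> x; rewrite mem_undup.
  rewrite big1 // => i _.
  by rewrite H ?linear0 //; exists i; exact: (pE i).
move: s {H}; apply: (coproduct_span cop).
  split; first by exists [::] => l' _ _; rewrite big1 // => i _; rewrite !linear0.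
  move=> a x y [l lE] [m mE]; exists (l ++ m) => l' sl ul.
  have ex : x = \sum_(i <- l') iota i (p i x).
    by apply: lE => // i Hi; apply: sl; rewrite mem_cat Hi.
  have ey : y = \sum_(i <- l') iota i (p i y).
    by apply: mE => // i Hi; apply: sl; rewrite mem_cat Hi orbT.
  rewrite [in LHS]ex [in LHS]ey scaler_sumr -big_split /=.
  by apply: eq_bigr => i _; rewrite !linearP.
move=> i x; exists [:: (i : J)] => l' sl ul.
rewrite (bigD1_seq (i : J)) ?sl ?mem_head //= big1 ?addr0 => [|j ne].
  by rewrite (pE i).1.
rewrite (pE j).2 ?linear0 // => e; by rewrite e eqxx in ne.
Qed.

End ConstantFamily.

(** The trace as an intersection of submodules: membership is an induction principle, and no finite
    sums of images have to be written. [GenE] turns Gen(M) into the condition that a module is its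
    own trace. *)
Definition trace M X (x : X) : Prop :=
  forall N : X -> Prop, submod N -> (forall (f : {linear M -> X}) m, N (f m)) ->
  N x.
Definition gen M X : Prop := forall x : X, trace M x.

Lemma trace_submod M X : submod (@trace M X).
Proof.
split=> [N sN _|a x y Hx Hy N sN H]; first by case: sN.
by apply: (sN.2); [exact: Hx|exact: Hy].
Qed.
Hint Resolve trace_submod : core.

Lemma trace_image M X (f : {linear M -> X}) m : trace M (f m).
Proof. by move=> N _; apply. Qed.

Lemma trace_map M X Y (f : {linear X -> Y}) x : trace M x -> trace M (f x).
Proof.
move=> Hx; apply: (Hx (fun x => trace M (f x))); first exact: submod_pre.
by move=> g m; exact: (trace_image (f \o g)).
Qed.

Lemma gen_refl M : gen M M.
Proof. by move=> x; exact: (trace_image idfun). Qed.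

Lemma gen_quot M X Y (p : {linear X -> Y}) : surj p -> gen M X -> gen M Y.
Proof. by move=> sp gX y; have [x <-] := sp y; apply: trace_map. Qed.

Lemma trace_trans M N X (x : X) : gen M N -> trace N x -> trace M x.
Proof.
move=> gN tx; apply: tx; first exact: trace_submod.
by move=> f n; apply: trace_map; exact: gN.
Qed.

Lemma gen_trans M N X : gen M N -> gen N X -> gen M X.
Proof. by move=> gN gX x; exact: trace_trans gN (gX x). Qed.

Lemma gen_coproduct M I (X : I -> lmodType R) (S : lmodType R)
    (iota : forall i, {linear X i -> S}) :
  is_coproduct iota -> (forall i, gen M (X i)) -> gen M S.
Proof.
move=> cop H; apply: (coproduct_span cop); first exact: trace_submod.
by move=> i x; apply: trace_map; exact: H.
Qed.

Lemma gen_cover M X : gen M X ->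
  exists (I : Type) (S : lmodType R) (iota : I -> {linear M -> S})
         (p : {linear S -> X}),
    @is_coproduct R I (fun=> M) S iota /\ surj p /\
    forall f : {linear M -> X}, exists i, forall m, p (iota i m) = f m.
Proof.
move=> gX; pose I := {linear M -> X}.
have [S [iota cop]] := coproduct_ex (fun _ : I => M).
have [[p pE] _] := cop X (fun f => f).
exists I, S, iota, p; split=> //; split=> [x|f]; last by exists f.
apply: (gX x (fun x => exists s, p s = x)); first exact: submod_range.
by move=> f m; exists (iota f m); rewrite pE.
Qed.

Lemma GenE M X : Gen M X <-> gen M X.
Proof.
split=> [[I [S [iota [p [cop sp]]]]]|/gen_cover[I [S [iota [p [cop [sp _]]]]]]].
  by apply: gen_quot sp _; apply: (gen_coproduct cop) => _; exact: gen_refl.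
by exists I, S, iota, p.
Qed.

Section TorsionClass.
Context (T : lmodType R -> Prop) (torT : torsion_class T).

Lemma tors_quot X Y (p : {linear X -> Y}) : surj p -> T X -> T Y.
Proof. by case: torT => _ H _; exact: H. Qed.
Lemma tors_ext X Y Z (i : {linear X -> Y}) (p : {linear Y -> Z}) :
  injective i -> exact i p -> surj p -> T X -> T Z -> T Y.
Proof. by case: torT => _ _; exact. Qed.

Lemma tors_gen M X : T M -> gen M X -> T X.
Proof.
move=> TM /gen_cover[I [S [iota [p [cop [sp _]]]]]].
by apply: tors_quot sp _; case: torT => H _ _; apply: (H _ _ _ _ cop).
Qed.

Lemma tors_extk Y Z (p : {linear Y -> Z}) : surj p ->
  smod T (fun y => p y = 0) -> T Z -> T Y.
Proof.
move=> sp [X [i [ii iE TX]]] TZ.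
exact: (tors_ext ii _ sp TX TZ).
Qed.

Lemma tors_iso X Y (h : {linear X -> Y}) : bijective h -> T X -> T Y.
Proof. by move=> [g _ hK]; apply: tors_quot => y; exists (g y). Qed.

Lemma tors_zero X : (forall x : X, x = 0) -> T X.
Proof.
move=> H; case: torT => C _ _.
pose M (v : void) : lmodType R := match v with end.
have iota (v : void) : {linear M v -> X} by case: v.
apply: (C void M X iota); last by case.
move=> Y f; split; last first.
  by move=> g g' _ x; rewrite (H x) !linear0.
by have [g _] := linear_zero X Y; exists g; case.
Qed.

(** The preimage of N is an extension of N by the kernel of f. *)
Lemma smod_tors_pre X Y (f : {linear X -> Y}) (N : Y -> Prop) :
  (forall y, N y -> exists x, f x = y) ->
  smod T (fun x => f x = 0) -> smod T N -> smod T (fun x => N (f x)).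
Proof.
move=> fN [K [k [ik kE TK]]] [S [i [ii iE TS]]].
have sN : submod N by apply: (@smod_submod _ _ T); exists S, i.
have [P [j [ij jE]]] := submodule_ex (submod_pre f sN).
exists P, j; split=> //.
have [g gE] := @factor_inj _ _ _ _ i (f \o j) ii ltac:(
  by move=> z; apply/iE/jE; exists z).
have [l lE] := @factor_inj _ _ _ _ j k ij ltac:(
  by move=> z; apply/jE; rewrite (_ : f (k z) = 0); [case: sN|apply/kE; exists z]).
apply: (@tors_ext _ _ _ l g) => //.
- by move=> x y e; apply: ik; rewrite -!lE e.
- move=> x; split=> [gx|[z <-]].
    have /kE[z zE] : f (j x) = 0 by rewrite -[f (j x)]gE gx linear0.
    by exists z; apply: ij; rewrite lE.
  by apply: ii; rewrite gE /= lE linear0; apply/kE; exists z.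
- move=> s; have Ns : N (i s) by apply/iE; exists s.
  have [x xE] := fN _ Ns.
  have /jE[y yE] : N (f x) by rewrite xE.
  by exists y; apply: ii; rewrite gE /= yE.
Qed.

Lemma tors_pair X Y : T X -> T Y -> T (X * Y)%type.
Proof.
move=> TX TY.
have [p pE] := @linear_of _ (X * Y)%type Y snd ltac:(by []).
have [i iE] := @linear_of _ X (X * Y)%type (fun x => (x, 0)) ltac:(
  by move=> a x y; congr (_, _); rewrite /= scaler0 addr0).
apply: (@tors_ext X (X * Y)%type Y i p) => //.
- by move=> x y; rewrite !iE => -[].
- move=> [x y]; rewrite pE /=; split=> [->|[z]]; first by exists x; rewrite iE.
  by rewrite iE => -[_ <-].
- by move=> y; exists (0, y); rewrite pE.
Qed.

End TorsionClass.

(** Only closure under extensions needs the hypothesis: maps from M to the quotient lift, so the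
    trace of M in the middle term maps onto the quotient, and it contains the kernel. *)
Lemma gen_torsion M :
  (forall Y N (p : {linear Y -> N}) (u : {linear M -> N}), surj p ->
     smod (gen M) (fun y => p y = 0) -> exists v : {linear M -> Y}, forall m, p (v m) = u m) ->
  torsion_class (gen M).
Proof.
move=> H; split=> [I X S iota cop gX|X Y p|X Y Z i p ii ex sp gX gZ].
- exact: gen_coproduct cop gX.
- exact: gen_quot.
have K : smod (gen M) (fun y => p y = 0) by exists X, i.
have trX x : trace M (i x) by apply: trace_map; exact: gX.
suff: forall z : Z, exists2 y, trace M y & p y = z.
  move=> Hz y; have [y' ty' e] := Hz (p y).
  have /(ex _)[x xE] := linear_eq_ker (esym e).
  rewrite -(subrK y' y) -xE; exact: (submodD (trace_submod M Y) (trX x) ty').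
move=> z; apply: (gZ z (fun z => exists2 y, trace M y & p y = z)); first exact: submod_im (trace_submod _ _).
move=> f m; have [v vE] := H _ _ p f sp K.
by exists (v m) => //; exact: trace_image.
Qed.

End Coproducts.
#[export] Hint Resolve trace_submod : core.

(** * Modules of finite length *)

Section FiniteLength.
Context {K : fieldType} {A : falgType K}.
Local Notation R := A^c.
Implicit Types M X Y Z : rmodType A.

Definition kscale M (c : K) (x : M) : M := (c%:A : A^c) *: x.

Lemma kscaleZ M c (a : A^c) (x : M) : kscale c (a *: x) = a *: kscale c x.
Proof.
rewrite /kscale !scalerA; congr (_ *: x).
have e : (a : A) * c%:A = c%:A * (a : A) by rewrite mulr_algl mulr_algr.
exact: e.
Qed.
Lemma kscaleDr M c (x y : M) : kscale c (x + y) = kscale c x + kscale c y.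
Proof. exact: scalerDr. Qed.
Lemma kscaleDl M c d (x : M) : kscale (c + d) x = kscale c x + kscale d x.
Proof. by rewrite /kscale -scalerDl; congr (_ *: x); exact: scalerDl. Qed.
Lemma kscaleA M c d (x : M) : kscale c (kscale d x) = kscale (c * d) x.
Proof.
rewrite /kscale !scalerA; congr (_ *: x).
have e : d%:A * c%:A = (c * d)%:A :> A by rewrite mulr_algl scalerA mulrC.
exact: e.
Qed.
Lemma kscale1 M (x : M) : kscale 1 x = x.
Proof. by rewrite /kscale scale1r; exact: scale1r. Qed.
Lemma kscale0 M (x : M) : kscale 0 x = 0.
Proof. by rewrite /kscale scale0r; exact: scale0r. Qed.
Lemma kscaleNl M c (x : M) : kscale (- c) x = - kscale c x.
Proof. by rewrite /kscale scaleNr; exact: scaleNr. Qed.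
Lemma kscaleNr M c (x : M) : kscale c (- x) = - kscale c x.
Proof. exact: scalerN. Qed.
Lemma kscaleBr M c (x y : M) : kscale c (x - y) = kscale c x - kscale c y.
Proof. by rewrite kscaleDr kscaleNr. Qed.
Lemma linear_kscale X Y (f : {linear X -> Y}) c x : f (kscale c x) = kscale c (f x).
Proof. by rewrite /kscale linearZ. Qed.
Lemma kscale_sum M c I (r : seq I) (P : pred I) (F : I -> M) :
  kscale c (\sum_(i <- r | P i) F i) = \sum_(i <- r | P i) kscale c (F i).
Proof. exact: scaler_sumr. Qed.
Lemma linear_kscale_ex X Y (f : {linear X -> Y}) c :
  exists g : {linear X -> Y}, forall x, g x = kscale c (f x).
Proof. by apply: linear_of => a x y; rewrite linearP kscaleDr kscaleZ. Qed.

Definition ksub M (N : M -> Prop) : Prop :=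
  [/\ N 0, forall x y, N x -> N y -> N (x + y) & forall c x, N x -> N (kscale c x)].

Lemma submod_ksub M (N : M -> Prop) : submod N -> ksub N.
Proof.
move=> sN; split; first by case: sN.
  by move=> x y; exact: submodD.
by move=> c x; exact: submodZ.
Qed.
Hint Resolve submod_ksub : core.

(** A strictly monotone rank on K-subspaces: an extremal member of a nonempty family of subspaces is
    then one of extremal rank. *)
Definition finlen M : Prop :=
  exists r : (M -> Prop) -> nat, forall N N' : M -> Prop,
    ksub N -> ksub N' -> (forall x, N x -> N' x) ->
    (r N <= r N')%N /\ ((r N' <= r N)%N -> forall x, N' x -> N x).

Lemma max_submod M (P : (M -> Prop) -> Prop) N0 : finlen M ->
  (forall N, P N -> ksub N) -> P N0 ->
  exists N, P N /\ forall N', P N' -> (forall x, N x -> N' x) ->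
    forall x, N' x -> N x.
Proof.
move=> [r rP] Psub PN0.
have bnd N : P N -> (r N <= r (fun=> True))%N.
  by move=> /Psub sN; case: (rP N (fun=> True)).
have ex : exists n, `[< exists2 N, P N & r N = n >].
  by exists (r N0); apply/asboolP; exists N0.
have ub n : `[< exists2 N, P N & r N = n >] -> (n <= r (fun=> True))%N.
  by move=> /asboolP[N /bnd + <-].
case: (ex_maxnP ex ub) => n /asboolP[N PN <-] nmax.
exists N; split=> // N' PN' NN'.
have [_] := rP N N' (Psub _ PN) (Psub _ PN') NN'; apply.
by apply: nmax; apply/asboolP; exists N'.
Qed.

Lemma min_submod M (P : (M -> Prop) -> Prop) N0 : finlen M ->
  (forall N, P N -> ksub N) -> P N0 ->
  exists N, P N /\ forall N', P N' -> (forall x, N' x -> N x) ->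
    forall x, N x -> N' x.
Proof.
move=> [r rP] Psub PN0.
have ex : exists n, `[< exists2 N, P N & r N = n >].
  by exists (r N0); apply/asboolP; exists N0.
case: (ex_minnP ex) => n /asboolP[N PN <-] nmin.
exists N; split=> // N' PN' NN'.
have [_] := rP N' N (Psub _ PN') (Psub _ PN) NN'; apply.
by apply: nmin; apply/asboolP; exists N'.
Qed.

Lemma iter_ker_stable M (g : {linear M -> M}) : finlen M ->
  exists k, forall j x, iter j g x = 0 -> iter k g x = 0.
Proof.
move=> fM.
have sK k : submod (fun x => iter k g x = 0).
  have [h hE] := linear_iter g k.
  have -> : (fun x => iter k g x = 0) = (fun x => h x = 0); last exact: submod_ker.
  by apply/funext => x; rewrite hE.
have [||N [[k ->] Hk]] := @max_submod M
    (fun N => exists k, N = (fun x => iter k g x = 0)) (fun x => x = 0) fM.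
- by move=> N [k ->]; exact: submod_ksub.
- by exists 0%N.
exists k => j x jx.
have mono m n y : (m <= n)%N -> iter m g y = 0 -> iter n g y = 0.
  move=> /subnK <- e; rewrite iterD e.
  by elim: (n - m)%N => //= p ->; rewrite linear0.
case: (leqP j k) => [jk|kj]; first exact: mono jx.
by apply: (Hk (fun x => iter j g x = 0)) => //; [exists j|move=> y; apply: mono; exact: ltnW].
Qed.

Lemma iter_im_stable M (g : {linear M -> M}) : finlen M ->
  exists k, forall j x, exists y, iter k g x = iter j g y.
Proof.
move=> fM.
have sK k : submod (fun x => exists y, x = iter k g y).
  have [h hE] := linear_iter g k.
  have -> : (fun x => exists y, x = iter k g y) = (fun x => exists y, h y = x);
    last exact: submod_range.
  by apply/funext => x; apply/propext; split=> -[y e]; exists y; rewrite -?e hE.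
have [||N [[k ->] Hk]] := @min_submod M
    (fun N => exists k, N = (fun x => exists y, x = iter k g y))
    (fun x => exists y, x = iter 0 g y) fM.
- by move=> N [k ->]; exact: submod_ksub.
- by exists 0%N.
exists k => j x.
have mono m n y : (m <= n)%N -> exists z, iter n g y = iter m g z.
  by move=> /subnKC <-; exists (iter (n - m) g y); rewrite iterD.
case: (leqP j k) => [jk|kj]; first exact: mono jk.
apply: (Hk (fun x => exists y, x = iter j g y)) => //; [by exists j| |by exists x].
by move=> _ [z ->]; apply: mono; exact: ltnW.
Qed.

Lemma finlen_surj_inj M (g : {linear M -> M}) : finlen M -> surj g -> bijective g.
Proof.
move=> fM sg; apply: linear_bij => //; apply: linear_inj => x gx.
have [k Hk] := iter_ker_stable g fM.
have [y yE] : exists y, iter k g y = x.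
  have sk : surj (iter k g).
    elim: k {Hk} => [|k IH] z; first by exists z.
    by have [y <-] := sg z; have [w <-] := IH y; exists w.
  exact: sk.
by rewrite -yE; apply: (Hk k.+1); rewrite iterS yE.
Qed.

Lemma finlen_inj_surj M (g : {linear M -> M}) : finlen M -> injective g ->
  bijective g.
Proof.
move=> fM ig; apply: linear_bij => // x.
have [k Hk] := iter_im_stable g fM.
have [y yE] := Hk k.+1 x; exists y; apply/esym.
elim: k yE {Hk} => // k IH; rewrite [LHS]iterS [RHS]iterS => /ig; exact: IH.
Qed.

(** Fitting's lemma: M is the direct sum of the image and the kernel of a high power of g, and one
    of the two summands is zero. *)
Lemma fitting M (g : {linear M -> M}) : finlen M -> indecomposable M ->
  bijective g \/ exists k, forall x, iter k g x = 0.
Proof.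
move=> fM [_ ind].
have [k Hk] := iter_ker_stable g fM.
have [l Hl] := iter_im_stable g fM.
(* Kernels are stable from the k-th power on and images from the l-th, so the power k + l serves
   both. *)
have [h hE] := linear_iter g (k + l).
have [I [i [ii iE]]] := submodule_ex (submod_range h).
have [J [j [ij jE]]] := submodule_ex (submod_ker h).
have [s sE] := @linear_of _ (I * J)%type M (fun x => i x.1 + j x.2) ltac:(
  by move=> a x y; rewrite /= !linearP scalerDr addrACA).
have : bijective s.
  apply: linear_bij.
    apply: linear_inj => -[x y]; rewrite sE /= => e.
    have [z zE] : exists z, h z = i x by apply/iE; exists x.
    have hj : h (j y) = 0 by apply/jE; exists y.
    have : h (i x) = 0 by rewrite -(addrK (j y) (i x)) e sub0r linearN /= hj oppr0.
    rewrite -zE [h (h z)]hE [h z]hE -iterD => /Hk hz.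
    have x0 : x = 0.
      by apply: ii; rewrite -zE hE addnC iterD hz linear0; elim: (l) => //= m ->; rewrite linear0.
    have y0 : y = 0 by apply: ij; move: e; rewrite x0 linear0 add0r linear0.
    by rewrite x0 y0.
  move=> x.
  have [y yE] : exists y, h x = h (h y).
    have [z zE] := Hl (k + l + l)%N x.
    exists z; rewrite [h (h z)]hE [h z]hE hE iterD zE -!iterD.
    by congr (iter _ g z); rewrite -!addnA [(k + (l + l))%N]addnCA.
  have /iE[u uE] : exists z, h z = h y by exists y.
  have /jE[v vE] : h (x - h y) = 0 by rewrite linearB /= -yE subrr.
  by exists (u, v); rewrite sE /= uE vE addrC subrK.
move=> /ind[I0|J0]; [right; exists (k + l)%N => x|left].
  have /iE[u uE] : exists z, h z = h x by exists x.
  by rewrite -hE -uE (I0 u) linear0.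
apply: finlen_inj_surj => //; apply: linear_inj => x gx.
have /jE[u <-] : h x = 0.
  rewrite hE addnC iterD (Hk 1%N) //.
  by elim: (l) => //= m ->; rewrite linear0.
by rewrite (J0 u) linear0.
Qed.

(* Nakayama's lemma I L <> L, for I in the radical of End M. *)
Lemma nakayama M (I : {linear M -> M} -> Prop) (L : M -> Prop) : finlen M ->
  (forall (e r u : {linear M -> M}), I r -> (forall x, u x = x - e (r x)) ->
     bijective u) ->
  ksub L -> (forall (e : {linear M -> M}) x, L x -> L (e x)) ->
  (exists2 x, L x & x <> 0) ->
  exists2 x, L x & ~ forall N : M -> Prop, ksub N ->
    (forall r y, I r -> L y -> N (r y)) -> N x.
Proof.
move=> fM HI sL eL [x0 Lx0 x0n].
(* L' is a maximal proper End(M)-stable subspace of L. The claim reduces to I L being contained in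
   L', as the radical kills the simple module L / L'. *)
have [||L' [[sL' eL' L'L [x1 Lx1 L'x1]] mL']] := @max_submod M (fun N =>
  [/\ ksub N, forall (e : {linear M -> M}) x, N x -> N (e x),
      forall x, N x -> L x & exists2 x, L x & ~ N x]) (fun x => x = 0) fM.
- by move=> N [].
- split; first exact/submod_ksub/submod_0.
  + by move=> e x ->; rewrite linear0.
  + by move=> x ->; case: sL.
  + by exists x0.
exists x1 => // H; apply: L'x1; apply: H => // r y Ir Ly.
apply: contrapT => nry.
(* N = End(M) r y + L'. If r y is outside L', then N = L contains y = e (r y) + l; inverting 1 - e r
   puts y, and with it r y, into L'. *)
pose N z := exists (e : {linear M -> M}) l, L' l /\ z = e (r y) + l.
have [z zE] := linear_zero M M.
have [L'0 L'D L'Z] := sL'.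
have [L0 LD LZ] := sL.
have sN : ksub N.
  split; first by exists z, 0; rewrite zE addr0.
    move=> _ _ [e [l [Ll ->]]] [e' [l' [Ll' ->]]].
    have [h hE] := linear_add e e'.
    by exists h, (l + l'); split; [exact: L'D|rewrite hE addrACA].
  move=> c _ [e [l [Ll ->]]]; have [h hE] := linear_kscale_ex e c.
  by exists h, (kscale c l); split; [exact: L'Z|rewrite hE kscaleDr].
have NL' x : N x -> L x.
  by move=> [e [l [Ll ->]]]; apply: LD; [exact/eL/eL|exact: L'L].
have L'N x : L' x -> N x by move=> ?; exists z, x; rewrite zE add0r.
have NL : forall x, L x -> N x.
  move=> x Lx; apply: contrapT => Nx; apply: nry.
  apply: (mL' N) => //; last by exists idfun, 0; rewrite addr0.
  split=> //; last by exists x.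
  move=> e _ [e' [l [Ll ->]]]; exists (e \o e'), (e l).
  by rewrite linearD; split=> //; exact: eL'.
have [e [l [Ll yE]]] := NL _ Ly.
have [u uE] := linear_sub idfun (e \o r).
have bu : bijective u by apply: (HI e r u).
have [v [uK vK]] := linear_inverse bu.
have : L' (v (u y)) by apply: eL'; rewrite uE /= {1}yE addrAC subrr add0r.
by rewrite uK => /eL'.
Qed.

Lemma rowspace_ex n (U : 'rV[K]_n -> Prop) : U 0 ->
  (forall c x y, U x -> U y -> U (c *: x + y)) ->
  exists B : 'M[K]_n, forall x, U x <-> (x <= B)%MS.
Proof.
move=> U0 UP.
have ex : exists r, `[< exists B : 'M[K]_n, (forall x, (x <= B)%MS -> U x) /\ \rank B = r >].
  exists 0%N; apply/asboolP; exists 0; split; last exact: mxrank0.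
  by move=> x; rewrite submx0 => /eqP ->.
have ub r : `[< exists B : 'M[K]_n, (forall x, (x <= B)%MS -> U x) /\ \rank B = r >] -> (r <= n)%N.
  by move=> /asboolP[B [_ <-]]; exact: rank_leq_row.
case: (ex_maxnP ex ub) => r /asboolP[B [BU <-]] rmax.
exists B => x; split; last exact: BU.
move=> Ux; case: (boolP (x <= B)%MS) => // nxB.
have lt : (\rank B < \rank (B + x)%MS)%N.
  apply: rank_ltmx; rewrite ltmxE addsmxSl /=.
  by apply: contra nxB; apply: submx_trans; exact: addsmxSr.
suff : (\rank (B + x)%MS <= \rank B)%N by rewrite leqNgt lt.
apply: rmax; apply/asboolP; exists (B + x)%MS; split=> // y /sub_addsmxP[[u v] /= ->].
rewrite addrC [v]mx11_scalar mul_scalar_mx; apply: UP => //; apply: BU; exact: submxMl.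
Qed.

Section Span.
Context (M : rmodType A) (n : nat) (v : 'I_n -> M).

Let ev (x : 'rV[K]_n) : M := \sum_i kscale (x 0 i) (v i).

Let evP c x y : ev (c *: x + y) = kscale c (ev x) + ev y.
Proof.
rewrite /ev kscale_sum -big_split /=; apply: eq_bigr => i _.
by rewrite !mxE kscaleDl kscaleA.
Qed.

Let ev_pre (N : M -> Prop) : ksub N ->
  exists B : 'M[K]_n, forall x, N (ev x) <-> (x <= B)%MS.
Proof.
move=> [N0 ND NZ]; apply: rowspace_ex => [|c x y Nx Ny].
  rewrite (_ : ev 0 = 0) //; rewrite /ev big1 // => i _.
  by rewrite mxE kscale0.
by rewrite evP; auto.
Qed.

Hypothesis vP : forall x : M, exists c : 'I_n -> K, x = \sum_i kscale (c i) (v i).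

Let ev_surj x : exists y, ev y = x.
Proof.
have [c ->] := vP x; exists (\row_i c i); apply: eq_bigr => i _.
by rewrite mxE.
Qed.

(** The rank of a subspace is that of its preimage under K^n -> M, a row space. *)
Lemma span_finlen : finlen M.
Proof.
have H (N : M -> Prop) : exists B : 'M[K]_n,
    ksub N -> forall x, N (ev x) <-> (x <= B)%MS.
  case: (EM (ksub N)) => [/ev_pre[B BE]|nN]; first by exists B.
  by exists 0 => /nN.
have [r rE] := choice H; exists (fun N => \rank (r N)) => N N' sN sN' NN'.
have le : (r N <= r N')%MS.
  by apply/rV_subP => x /(rE N sN)/NN'/(rE N' sN').
split=> [|le' x]; first exact: mxrankS.
have [y <-] := ev_surj x => /(rE N' sN') yN'; apply/(rE N sN).
by apply: submx_trans yN' _; rewrite -(mxrank_leqif_sup le).2 eqn_leq le' mxrankS.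
Qed.

Lemma span_sub (N : M -> Prop) : ksub N ->
  exists (m : nat) (w : 'I_m -> M), (forall i, N (w i)) /\
    forall x, N x -> exists c : 'I_m -> K, x = \sum_i kscale (c i) (w i).
Proof.
move=> /ev_pre[B BE]; exists n, (fun i => ev (row i B)); split=> [i|x].
  by apply/BE; exact: row_sub.
have [y <-] := ev_surj x => /BE/submxP[D ->]; exists (fun i => D 0 i).
rewrite mulmx_sum_row; elim/big_rec2: _ => [|i y1 y2 _ <-]; last by rewrite evP.
by rewrite /ev big1 // => i _; rewrite mxE kscale0.
Qed.
End Span.

Lemma findim_finlen M : findim M -> finlen M.
Proof. by move=> [n [v vP]]; exact: (@span_finlen M n v). Qed.

End FiniteLength.

(** * Projective presentations *)

Section Projectives.
Context {R : pzRingType}.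
Implicit Types M P Q X Y Z : lmodType R.

Lemma linear_pair X Y Z (f : {linear X -> Z}) (g : {linear Y -> Z}) :
  exists h : {linear (X * Y)%type -> Z}, forall x, h x = f x.1 + g x.2.
Proof.
by apply: linear_of => a x y; rewrite /= !linearP scalerDr addrACA.
Qed.
Lemma linear_fst X Y : exists h : {linear (X * Y)%type -> X}, forall x, h x = x.1.
Proof. exact: linear_of. Qed.
Lemma linear_snd X Y : exists h : {linear (X * Y)%type -> Y}, forall x, h x = x.2.
Proof. exact: linear_of. Qed.
Lemma linear_inl X Y : exists h : {linear X -> (X * Y)%type}, forall x, h x = (x, 0).
Proof.
by apply: linear_of => a x y; congr (_, _); rewrite /= scaler0 addr0.
Qed.
Lemma linear_inr X Y : exists h : {linear Y -> (X * Y)%type}, forall x, h x = (0, x).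
Proof.
by apply: linear_of => a x y; congr (_, _); rewrite /= scaler0 addr0.
Qed.
Lemma linear_into X Y Z (f : {linear Z -> X}) (g : {linear Z -> Y}) :
  exists h : {linear Z -> (X * Y)%type}, forall z, h z = (f z, g z).
Proof. by apply: linear_of => a x y; rewrite !linearP. Qed.

Lemma projective_pair P Q : projective P -> projective Q -> projective (P * Q)%type.
Proof.
move=> pP pQ X Y p f sp.
have [i iE] := linear_inl P Q; have [j jE] := linear_inr P Q.
have [g gE] := pP X Y p (f \o i) sp.
have [h hE] := pQ X Y p (f \o j) sp.
have [k kE] := linear_pair g h; exists k => x.
rewrite kE linearD gE hE /= iE jE -linearD; congr (f _).
by case: x => x y; congr (_, _); rewrite /= ?addr0 ?add0r.
Qed.

Lemma projective_retract P Q (i : {linear Q -> P}) (r : {linear P -> Q}) :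
  (forall x, r (i x) = x) -> projective P -> projective Q.
Proof.
move=> ri pP X Y p f sp; have [g gE] := pP X Y p (f \o r) sp.
by exists (g \o i) => x; rewrite /= gE /= ri.
Qed.

Lemma projective_exact P X Y (Z : lmodType R) (f : {linear X -> Y})
    (g : {linear Y -> Z}) (u : {linear P -> Y}) :
  projective P -> exact f g -> (forall x, g (u x) = 0) ->
  exists v : {linear P -> X}, forall x, f (v x) = u x.
Proof.
move=> pP ex gu; have [S [i [ii iE]]] := submodule_ex (submod_ker g).
have [f' f'E] := @factor_inj _ _ _ _ i f ii ltac:(
  by move=> x; apply/iE/ex; exists x).
have [u' u'E] := @factor_inj _ _ _ _ i u ii ltac:(by move=> x; apply/iE/gu).
have [v vE] := pP _ _ f' u' ltac:(
  move=> s; have /ex[x xE] : g (i s) = 0 by [apply/iE; exists s];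
  by exists x; apply: ii; rewrite f'E).
by exists v => x; rewrite -f'E vE u'E.
Qed.

Definition presentation M P Q (sigma : {linear P -> Q}) (p : {linear Q -> M}) : Prop :=
  [/\ projective P, projective Q, exact sigma p & surj p].

Section SiltingClass.
Context (P Q : lmodType R) (sigma : {linear P -> Q}).
Hypothesis projP : projective P.

Lemma silting_class_quot X Y (p : {linear X -> Y}) : surj p ->
  silting_class sigma X -> silting_class sigma Y.
Proof.
move=> sp DX f; have [g gE] := projP f sp.
by have [h hE] := DX g; exists (p \o h) => x; rewrite /= hE gE.
Qed.

Lemma silting_class_pair X Y : silting_class sigma X -> silting_class sigma Y ->
  silting_class sigma (X * Y)%type.
Proof.
move=> DX DY f; have [p pE] := linear_fst X Y; have [q qE] := linear_snd X Y.
have [g gE] := DX (p \o f); have [h hE] := DY (q \o f).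
have [k kE] := linear_into g h; exists k => x.
by rewrite kE gE hE /= pE qE; case: (f x).
Qed.

Lemma silting_class_zero X : (forall x : X, x = 0) -> silting_class sigma X.
Proof.
move=> H f; have [z zE] := linear_zero Q X; exists z => x.
by rewrite (H (f x)) zE.
Qed.

Lemma silting_class_ext X Y Z (i : {linear X -> Y}) (p : {linear Y -> Z}) :
  projective Q -> injective i -> exact i p -> surj p ->
  silting_class sigma X -> silting_class sigma Z -> silting_class sigma Y.
Proof.
move=> pQ ii ex sp DX DZ f.
have [g gE] := DZ (p \o f); have [h hE] := pQ _ _ p g sp.
have [u uE] := linear_sub f (h \o sigma).
have [v vE] := @factor_inj _ _ _ _ i u ii ltac:(
  by move=> x; apply/ex; rewrite uE linearB /= hE gE subrr).
have [w wE] := DX v; have [k kE] := linear_add h (i \o w).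
by exists k => x; rewrite kE /= wE vE uE addrC subrK.
Qed.

End SiltingClass.

Lemma smod_add (T : lmodType R -> Prop) M (N N' : M -> Prop) :
  (forall X Y (p : {linear X -> Y}), surj p -> T X -> T Y) ->
  (forall X Y, T X -> T Y -> T (X * Y)%type) ->
  smod T N -> smod T N' ->
  smod T (fun x => exists y z, [/\ N y, N' z & x = y + z]).
Proof.
move=> TQ TP [S [i [ii iE TS]]] [S' [i' [ii' iE' TS']]].
have [h hE] := linear_pair i i'.
apply: smod_ext (smod_range TQ h (TP _ _ TS TS')) => x; split.
  move=> [[s s'] <-]; exists (i s), (i' s'); rewrite hE; split=> //.
    by apply/iE; exists s.
  by apply/iE'; exists s'.
move=> [_ [_ [/iE[s <-] /iE'[s' <-] ->]]]; exists (s, s'); exact: hE.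
Qed.

(** Meant for classes not known to be closed under infinite coproducts: finitely many elements of X
    involve only finitely many maps M -> X, so a finite sum of copies of M suffices. *)
Lemma gen_finite (T : lmodType R -> Prop) M X n (x : 'I_n -> X) :
  (forall X Y (p : {linear X -> Y}), surj p -> T X -> T Y) ->
  (forall X Y, T X -> T Y -> T (X * Y)%type) ->
  (forall X, (forall x : X, x = 0) -> T X) ->
  T M -> gen M X -> exists N, smod T N /\ forall i, N (x i).
Proof.
move=> TQ TP T0 TM gX.
have sT0 : smod T (fun x : X => x = 0).
  have [S [i [ii iE]]] := submodule_ex (submod_0 X).
  exists S, i; split=> //; apply: T0 => s; apply: ii; rewrite linear0.
  by apply/iE; exists s.
have H (y : X) : exists N : X -> Prop, smod T N /\ N y.
  apply: (gX y (fun y => exists N, smod T N /\ N y)).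
    split; first by exists (fun x => x = 0).
    move=> a u v [N [TN Nu]] [N' [TN' Nv]].
    exists (fun x => exists y z, [/\ N y, N' z & x = y + z]); split.
      exact: smod_add.
    exists (a *: u), v; split=> //; exact: submodZ (smod_submod TN) _.
  move=> f m; exists (fun y => exists x, f x = y); split; last by exists m.
  exact: smod_range.
elim: n x => [|n IH] x; first by exists (fun x => x = 0); split=> // -[].
have [N [TN Nx]] := IH (fun i => x (lift ord0 i)).
have [N' [TN' Nx']] := H (x ord0).
exists (fun x => exists y z, [/\ N y, N' z & x = y + z]); split.
  exact: smod_add.
move=> i; case: (unliftP ord0 i) => [j ->|->].
  by exists (x (lift ord0 j)), 0; rewrite addr0; split=> //; case: (smod_submod TN').
by exists 0, (x ord0); rewrite add0r; split=> //; case: (smod_submod TN).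
Qed.

(** This is Ext^1(M, X) = 0 for all X in T, phrased as a lifting property. *)
Definition relproj (T : lmodType R -> Prop) M : Prop :=
  forall Y (N : lmodType R) (p : {linear Y -> N}) (u : {linear M -> N}), surj p ->
  smod T (fun y => p y = 0) -> exists v : {linear M -> Y}, forall m, p (v m) = u m.

Lemma relproj_retract T M (N : lmodType R) (i : {linear N -> M}) (r : {linear M -> N}) :
  (forall x, r (i x) = x) -> relproj T M -> relproj T N.
Proof.
move=> ri pM X Y p f sp TK; have [g gE] := pM X Y p (f \o r) sp TK.
by exists (g \o i) => x; rewrite /= gE /= ri.
Qed.

Lemma relproj_pair T M (N : lmodType R) : relproj T M -> relproj T N -> relproj T (M * N)%type.
Proof.
move=> pM pN X Y p f sp TK.
have [i iE] := linear_inl M N; have [j jE] := linear_inr M N.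
have [g gE] := pM X Y p (f \o i) sp TK.
have [h hE] := pN X Y p (f \o j) sp TK.
have [k kE] := linear_pair g h; exists k => x.
rewrite kE linearD gE hE /= iE jE -linearD; congr (f _).
by case: x => x y; congr (_, _); rewrite /= ?addr0 ?add0r.
Qed.

(* The pushout along c of the extension of M by the image of d splits. *)
Lemma relproj_extend (T : lmodType R -> Prop) M P1 P0 Z (d : {linear P1 -> P0})
    (e : {linear P0 -> M}) (c : {linear P1 -> Z}) :
  relproj T M -> T Z -> exact d e -> surj e -> (forall x, d x = 0 -> c x = 0) ->
  exists h : {linear P0 -> Z}, forall x, h (d x) = c x.
Proof.
move=> rM TZ ex se H.
pose N (y : (Z * P0)%type) := exists x, y = (c x, - d x).
have sN : submod N.
  split; first by exists 0; rewrite !linear0.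
  move=> a _ _ [x ->] [x' ->]; exists (a *: x + x').
  by rewrite (linearP c) (linearP d); congr (_, _); rewrite /= opprD scalerN.
have [Y [q [sq qE]]] := quotient_ex sN.
have [k kE] := linear_snd Z P0.
have [p pE] := @factor_surj _ _ _ _ q (e \o k) sq ltac:(
  move=> [z y] /qE[x [_ ->]]; rewrite /= kE /=;
  by rewrite linearN /= (_ : e (d x) = 0) ?oppr0 //; apply/ex; exists x).
have [i iE] := linear_inl Z P0; have [j jE] := linear_inr Z P0.
have qi : injective (q \o i).
  apply: linear_inj => z /= /qE[x]; rewrite iE => -[-> /esym/eqP].
  by rewrite oppr_eq0 => /eqP/H.
have kerp y : p y = 0 <-> exists z, q (i z) = y.
  split=> [|[z <-]]; last by rewrite pE iE /= kE /= linear0.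
  have [[z x] <-] := sq y; rewrite pE /= kE /= => /ex[w wE].
  exists (z + c w); apply/eqP; rewrite -subr_eq0 -linearB; apply/eqP/qE.
  exists w; rewrite iE; congr (_, _); rewrite /= -?wE ?sub0r //.
  by rewrite addrAC subrr add0r.
have sp : surj p.
  by move=> m; have [x xE] := se m; exists (q (0, x)); rewrite pE /= kE.
have [s sE] := rM _ _ p idfun sp ltac:(by exists Z, (q \o i); split).
have [u uE] := linear_sub (q \o j) (s \o e).
have [h hE] := @factor_inj _ _ _ _ (q \o i) u qi ltac:(
  by move=> x; apply/kerp; rewrite uE linearB /= sE pE jE /= kE subrr).
exists h => x; apply: qi; rewrite hE uE /=.
have -> : e (d x) = 0 by apply/ex; exists x.
rewrite linear0 subr0; apply/esym/eqP; rewrite -subr_eq0 -linearB; apply/eqP/qE.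
by exists x; rewrite iE jE; congr (_, _); rewrite /= ?subr0 ?sub0r.
Qed.

(** Ext^1(M, X) embeds into the cokernel of Hom(sigma, X). *)
Lemma presentation_relproj M P Q (sigma : {linear P -> Q}) (p : {linear Q -> M})
    (T : lmodType R -> Prop) : presentation sigma p ->
  (forall X, T X -> silting_class sigma X) -> relproj T M.
Proof.
move=> [pP pQ ex sp] TD Y N q u sq [S [i [ii iE TS]]].
have [g gE] := pQ _ _ q (u \o p) sq.
have [h hE] := @factor_inj _ _ _ _ i (g \o sigma) ii ltac:(
  move=> x; apply/iE; rewrite gE /= (_ : p (sigma x) = 0) ?linear0 //;
  by apply/ex; exists x).
have [k kE] := TD _ TS h.
have [v vE] := linear_sub g (i \o k).
have [w wE] := @factor_surj _ _ _ _ p v sp ltac:(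
  by move=> x /ex[y <-]; rewrite vE /= kE hE subrr).
exists w => m; have [x <-] := sp m; rewrite wE vE linearB /= gE /=.
by rewrite (_ : q (i (k x)) = 0) ?subr0 //; apply/iE; exists (k x).
Qed.

End Projectives.

(** * Minimal presentations and rigid modules over a finite dimensional algebra *)

Section FiniteDimension.
Context {K : fieldType} {A : falgType K}.
Implicit Types M P Q X Y Z : rmodType A.

Lemma findim_quot X Y (p : {linear X -> Y}) : surj p -> findim X -> findim Y.
Proof.
move=> sp [n [v vP]]; exists n, (fun i => p (v i)) => y.
have [x <-] := sp y; have [c {1}->] := vP x; exists c.
by rewrite linear_sum; apply: eq_bigr => i _; rewrite linearZ.
Qed.

Lemma findim_inj X Y (i : {linear X -> Y}) : injective i -> findim Y -> findim X.
Proof.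
move=> ii [n [v vP]].
have [m [w [wi wP]]] := span_sub vP (submod_ksub (submod_range i)).
have [u uE] := choice wi; exists m, u => x.
have [c cE] := wP (i x) (ex_intro _ x erefl); exists c; apply: ii.
by rewrite linear_sum cE; apply: eq_bigr => j _; rewrite linearZ uE.
Qed.

Lemma findim_pair X Y : findim X -> findim Y -> findim (X * Y)%type.
Proof.
move=> [n [v vP]] [m [w wP]].
exists (n + m)%N, (fun i => match split i with inl j => (v j, 0) | inr j => (0, w j) end).
move=> [x y]; have [c cE] := vP x; have [d dE] := wP y.
exists (fun i => match split i with inl j => c j | inr j => d j end).
rewrite big_split_ord /=.
have -> : (x, y) = (x, 0) + (0, y) by congr (_, _); rewrite /= ?addr0 ?add0r.
have [f fE] := linear_inl X Y; have [g gE] := linear_inr X Y.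
rewrite -fE -gE cE dE !linear_sum; congr (_ + _); apply: eq_bigr => i _.
  by rewrite linearZ /= fE (unsplitK (inl i)).
by rewrite linearZ /= gE (unsplitK (inr i)).
Qed.

Lemma findim_zero X : (forall x : X, x = 0) -> findim X.
Proof. by move=> H; exists 0%N, (fun=> 0) => x; exists (fun=> 0); rewrite big_ord0. Qed.

Lemma findim_regular : findim (regular_rmod A : rmodType A).
Proof.
exists (\dim {: A}), (fun i => (vbasis {: A})`_i : regular_rmod A) => x.
exists (fun i => coord (vbasis {: A}) i x).
rewrite {1}(coord_vbasis (memvf (x : A))); apply: eq_bigr => i _.
by have e : coord (vbasis {: A}) i x *: (vbasis {: A})`_i =
  (vbasis {: A})`_i * (coord (vbasis {: A}) i x)%:A :> A by rewrite mulr_algr.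
Qed.

Lemma regular_hom X (x : X) : exists h : {linear regular_rmod A -> X},
  forall a, h a = (a : A^c) *: x.
Proof.
apply: linear_of => a b c.
have e : (a *: b + c : regular_rmod A) = (a * (b : A^c) + (c : A^c) : A^c) by [].
by rewrite e scalerDl scalerA.
Qed.

Lemma regular_homE X (h : {linear regular_rmod A -> X}) (a : regular_rmod A) :
  h a = (a : A^c) *: h (1 : A).
Proof.
rewrite -linearZ; congr (h _).
by have e : a = 1 * (a : A) :> A by rewrite mul1r.
Qed.

Lemma projective_regular : projective (regular_rmod A : rmodType A).
Proof.
move=> X Y p f sp; have [x xE] := sp (f (1 : A)).
have [h hE] := regular_hom x; exists h => a.
by rewrite hE linearZ /= xE -regular_homE.
Qed.

Lemma projective_zero P : (forall x : P, x = 0) -> projective P.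
Proof.
move=> H X Y p f sp; have [z zE] := linear_zero P X; exists z => x.
by rewrite (H x) !linear0.
Qed.

Lemma cover_ex M : findim M -> exists (P : rmodType A) (p : {linear P -> M}),
  [/\ projective P, findim P & surj p].
Proof.
move=> [n [v vP]].
suff [P [p [pP fP vp]]] : exists (P : rmodType A) (p : {linear P -> M}),
    [/\ projective P, findim P & forall i, exists x, p x = v i].
  exists P, p; split=> // x; have [c ->] := vP x.
  apply: (@submod_sum _ M (fun y => exists x, p x = y)) => // i _.
  exact: (submodZ _ (submod_range p) (vp i)).
elim: n v {vP} => [|n IH] v.
  have [S [i [ii iE]]] := submodule_ex (submod_0 (regular_rmod A)).
  have S0 (s : S) : s = 0 by apply: ii; rewrite linear0; apply/iE; exists s.
  have [z _] := linear_zero S M; exists S, z; split; last by case.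
    exact: projective_zero.
  exact: findim_zero.
have [P [p [pP fP vp]]] := IH (fun i => v (lift ord0 i)).
have [h hE] := regular_hom (v ord0).
have [k kE] := linear_pair h p.
exists (regular_rmod A * P)%type, k; split.
- by apply: projective_pair => //; exact: projective_regular.
- by apply: findim_pair => //; exact: findim_regular.
move=> i; case: (unliftP ord0 i) => [j ->|->].
  by have [x xE] := vp j; exists (0, x); rewrite kE /= linear0 add0r.
by exists ((1 : A), 0); rewrite kE /= linear0 addr0 hE; exact: scale1r.
Qed.

(** P is a minimal submodule, among those mapping onto M, of a finite dimensional projective Q
    covering M. Minimality makes P a retract of Q, hence projective. *)
Lemma projective_cover M : findim M -> exists (P : rmodType A) (p : {linear P -> M}),
  [/\ projective P, findim P, surj p &
    forall Z (h : {linear Z -> P}), surj (fun z => p (h z)) -> surj h].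
Proof.
move=> /cover_ex[Q [q [pQ fQ sq]]].
have [||N [[sN NM] mN]] := @min_submod _ _ Q
  (fun N => submod N /\ forall m, exists2 x, N x & q x = m) (fun=> True)
  (findim_finlen fQ).
- by move=> N [/submod_ksub].
- by split=> // m; have [x] := sq m; exists x.
have [P [i [ii iE]]] := submodule_ex sN.
have sp : surj (q \o i).
  by move=> m; have [_ /iE[x <-] xE] := NM m; exists x.
have [g gE] := pQ _ _ (q \o i) q sp.
have fP := findim_inj ii fQ.
have min Z (h : {linear Z -> P}) : surj (fun z => q (i (h z))) -> surj h.
  move=> sh s.
  have [|||z _ e] := mN (fun x => exists2 z, True & i (h z) = x) _ _ (i s) _.
  - split; first exact: (submod_im (i \o h)).
    by move=> m; have [z zE] := sh m; exists (i (h z)) => //; exists z.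
  - by move=> _ [z _ <-]; apply/iE; exists (h z).
  - by apply/iE; exists s.
  by exists z; exact: ii.
(* [g \o i] commutes with the projection to M, so it is surjective by minimality, and bijective by
   dimension. *)
have bg : bijective (g \o i).
  apply: (finlen_surj_inj (g := g \o i) (findim_finlen fP)).
  apply: min => m; have [x xE] := sp m; exists x.
  by have := gE (i x); rewrite /= in xE * => ->.
have [c [cK Kc]] := linear_inverse bg.
exists P, (q \o i); split=> //.
exact: (projective_retract (i := i) (r := c \o g)).
Qed.

Lemma minimal_presentation_ex M : findim M ->
  exists (P1 P0 : rmodType A) (d : {linear P1 -> P0}) (e : {linear P0 -> M}),
    [/\ findim P1, findim P0 & minimal_projective_presentation d e].
Proof.
move=> /projective_cover[P0 [e [pP0 fP0 se min0]]].
have [S [i [ii iE]]] := submodule_ex (submod_ker e).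
have [P1 [c [pP1 fP1 sc min1]]] := projective_cover (findim_inj ii fP0).
exists P1, P0, (i \o c), e; split=> //; split=> //; split.
- move=> y; split=> [/iE[s <-]|[x <-]]; last by apply/iE; exists (c x).
  by have [x <-] := sc s; exists x.
- move=> Z h ex; apply: min1 => s.
  have /ex[z zE] : e (i s) = 0 by apply/iE; exists s.
  by exists z; exact: ii.
- by move=> m; split=> // _; have [x] := se m; exists x.
- by move=> Z h ex; apply: min0 => m; apply/ex.
Qed.

Lemma minimal_presentation_findim M P1 P0 (d : {linear P1 -> P0})
    (e : {linear P0 -> M}) :
  findim M -> minimal_projective_presentation d e -> findim P1 /\ findim P0.
Proof.
move=> fM [pP1 pP0 [ex1 min1] [ex0 min0]].
have se : surj e by move=> m; apply/ex0.
have fP0 : findim P0.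
  have [Q [q [pQ fQ sq]]] := cover_ex fM.
  have [h hE] := pQ _ _ e q se.
  apply: (findim_quot _ fQ); apply: (min0 _ h) => m; split=> // _.
  by have [x <-] := sq m; exists x.
split=> //.
have [S [i [ii iE]]] := submodule_ex (submod_ker e).
have [Q [q [pQ fQ sq]]] := cover_ex (findim_inj ii fP0).
have [h hE] := @projective_exact _ _ _ _ _ d e (i \o q) pQ ex1 ltac:(
  by move=> x; apply/iE; exists (q x)).
apply: (findim_quot _ fQ); apply: (min1 _ h) => y; split=> [/iE[s <-]|[x <-]].
  by have [x <-] := sq s; exists x.
by apply/iE; exists (q x); rewrite hE.
Qed.

Lemma minimal_presentationP M P1 P0 (d : {linear P1 -> P0}) (e : {linear P0 -> M}) :
  minimal_projective_presentation d e -> presentation d e.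
Proof.
by move=> [pP1 pP0 [ex1 _] [ex0 _]]; split=> // m; apply/ex0.
Qed.

(** For a retract X of M, the inclusion and the retraction lift to maps of presentations from d to
    sigma and back. By minimality the composites on P0 and P1 are bijective, so d is a retract of
    sigma as a map. *)
Lemma minimal_silting_class M X P Q (sigma : {linear P -> Q}) (q : {linear Q -> M})
    (i : {linear X -> M}) (p : {linear M -> X}) P1 P0 (d : {linear P1 -> P0})
    (e : {linear P0 -> X}) : findim X -> (forall x, p (i x) = x) ->
  presentation sigma q -> minimal_projective_presentation d e ->
  forall Y, silting_class sigma Y -> silting_class d Y.
Proof.
move=> fX pi [pP pQ exs sq] mde Y DY f.
have [fP1 fP0] := minimal_presentation_findim fX mde.
have [pP1 pP0 exd se] := minimal_presentationP mde.
have [_ _ [_ min1] [_ min0]] := mde.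
have [b bE] := pP0 _ _ q (i \o e) sq.
have [b' b'E] := pQ _ _ e (p \o q) se.
have ed x : e (d x) = 0 by apply/exd; exists x.
have qs x : q (sigma x) = 0 by apply/exs; exists x.
have [a aE] := @projective_exact _ _ _ _ _ sigma q (b \o d) pP1 exs ltac:(
  by move=> x; rewrite /= bE /= ed linear0).
have [a' a'E] := @projective_exact _ _ _ _ _ d e (b' \o sigma) pP exd ltac:(
  by move=> x; rewrite /= b'E /= qs linear0).
have ebb y : e (b' (b y)) = e y by rewrite b'E /= bE /= pi.
have bb : bijective (b' \o b).
  apply: (finlen_surj_inj (g := b' \o b) (findim_finlen fP0)).
  apply: (min0 _ (b' \o b)) => m; split=> // _.
  by have [y <-] := se m; exists y; exact: ebb.
have daa x : d (a' (a x)) = b' (b (d x)) by rewrite a'E /= aE.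
have aa : bijective (a' \o a).
  apply: (finlen_surj_inj (g := a' \o a) (findim_finlen fP1)).
  apply: (min1 _ (a' \o a)) => y; split=> [ey|[x <-]]; last exact: ed.
  have [w wK Kw] := bb.
  have /exd[x xE] : e (w y) = 0 by rewrite -ebb -[b' _]/((b' \o b) _) Kw.
  by exists x; rewrite /= daa xE; exact: Kw.
have [c [cK _]] := linear_inverse aa.
have [g gE] := DY (f \o (c \o a')).
exists (g \o b) => x; rewrite /= -[b (d x)]/((b \o d) x) -aE gE /=.
by have /= -> := cK x.
Qed.

(** A map f : P1 -> Z need not vanish on ker d, so it is first extended modulo f(ker d), which needs
    T closed under quotients. The defect u = f - g d of a lift then satisfies u(P1) = u(ker d), that
    is ker u + ker d = P1, and minimality of d forces u = 0. *)
Lemma relproj_silting_class (T : rmodType A -> Prop) M P1 P0 (d : {linear P1 -> P0})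
    (e : {linear P0 -> M}) :
  (forall X Y (p : {linear X -> Y}), surj p -> T X -> T Y) ->
  minimal_projective_presentation d e -> relproj T M ->
  forall Z, T Z -> silting_class d Z.
Proof.
move=> TQ mde rM Z TZ f.
have [pP1 pP0 exd se] := minimal_presentationP mde.
have [_ _ [_ min1] _] := mde.
have [Z' [q [sq qE]]] := quotient_ex (submod_im f (submod_ker d)).
have [h hE] := @relproj_extend _ T M P1 P0 Z' d e (q \o f) rM (TQ _ _ q sq TZ) exd se ltac:(
  by move=> x dx; apply/qE; exists x).
have [g gE] := pP0 _ _ q h sq.
have [u uE] := linear_sub f (g \o d).
have [S [i [ii iE]]] := submodule_ex (submod_ker u).
have si : surj i.
  apply: (min1 _ i) => y; split=> [/exd[x <-]|[s <-]]; last by apply/exd; exists (i s).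
  have /qE[k dk kE] : q (u x) = 0 by rewrite uE linearB /= gE hE subrr.
  have /iE[s sE] : u (x - k) = 0.
    by rewrite linearB /= [u k]uE /= dk linear0 subr0 kE subrr.
  by exists s; rewrite sE linearB /= dk subr0.
exists g => x; have [s sE] := si x.
have : u x = 0 by apply/iE; exists s.
by rewrite uE /= => /eqP; rewrite subr_eq0 => /eqP.
Qed.

(** A map from the finite dimensional P lands in a quotient of a finite sum of copies of M, so
    closure of the class under finite sums and quotients is enough. *)
Lemma gen_silting_class P Q (sigma : {linear P -> Q}) M X : projective P ->
  findim P -> silting_class sigma M -> gen M X -> silting_class sigma X.
Proof.
move=> pP [n [v vP]] DM gX f.
have [|||||N [DN Nv]] := @gen_finite _ (silting_class sigma) M X n (fun i => f (v i)) => //.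
- by move=> ? ? ?; exact: silting_class_quot.
- by move=> ? ?; exact: silting_class_pair.
- by move=> ?; exact: silting_class_zero.
have sN := smod_submod DN.
have [S [i [ii iE DS]]] := DN.
have [g gE] := @factor_inj _ _ _ _ i f ii ltac:(
  move=> x; apply/iE; have [c ->] := vP x; rewrite linear_sum;
  by apply: submod_sum => // j _; rewrite linearZ; exact: submodZ).
by have [h hE] := DS g; exists (i \o h) => x; rewrite /= hE gE.
Qed.

(** The presentation is arbitrary here; [rigid_minimal] passes to minimal ones, and the equivalence
    with [tau_rigid] is established through the translate. *)
Definition rigid M : Prop := findim M /\
  exists P Q (sigma : {linear P -> Q}) (q : {linear Q -> M}),
    presentation sigma q /\ silting_class sigma M.

Lemma rigid_minimal M P1 P0 (d : {linear P1 -> P0}) (e : {linear P0 -> M}) :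
  rigid M -> minimal_projective_presentation d e ->
  forall X, gen M X -> silting_class d X.
Proof.
move=> [fM [P [Q [sigma [q [pres DM]]]]]] mde X gX.
have [fP1 fP0] := minimal_presentation_findim fM mde.
have [pP1 _ _ _] := minimal_presentationP mde.
apply: gen_silting_class gX => //.
exact: (minimal_silting_class (i := idfun) (p := idfun) fM _ pres mde).
Qed.

Lemma rigid_relproj M : rigid M -> relproj (gen M) M.
Proof.
move=> rM; have [fM _] := rM.
have [P1 [P0 [d [e [_ _ mde]]]]] := minimal_presentation_ex fM.
exact: presentation_relproj (minimal_presentationP mde) (rigid_minimal rM mde).
Qed.

Lemma rigid_torsion M : rigid M -> torsion_class (gen M).
Proof. by move=> rM; apply: gen_torsion; exact: rigid_relproj. Qed.

Lemma relproj_rigid (T : rmodType A -> Prop) M : findim M -> T M ->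
  (forall X Y (p : {linear X -> Y}), surj p -> T X -> T Y) -> relproj T M ->
  rigid M.
Proof.
move=> fM TM TQ rM; split=> //.
have [P1 [P0 [d [e [_ _ mde]]]]] := minimal_presentation_ex fM.
exists P1, P0, d, e; split; first exact: minimal_presentationP.
exact: relproj_silting_class mde rM _ TM.
Qed.

Lemma rigid_retract M X (i : {linear X -> M}) (p : {linear M -> X}) :
  (forall x, p (i x) = x) -> rigid M -> rigid X.
Proof.
move=> pi [fM [P [Q [sigma [q [pres DM]]]]]].
have sp : surj p by move=> x; exists (i x).
have fX := findim_quot sp fM.
have [P1 [P0 [d [e [_ _ mde]]]]] := minimal_presentation_ex fX.
split=> //; exists P1, P0, d, e; split; first exact: minimal_presentationP.
apply: (minimal_silting_class fX pi pres mde).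
by case: pres => pP _ _ _; exact: silting_class_quot sp DM.
Qed.

End FiniteDimension.

(** * Approximations and wide subcategories *)

Lemma trace_smod (R : pzRingType) (M X : lmodType R) : smod (gen M) (@trace R M X).
Proof.
have [S [i [ii iE]]] := submodule_ex (trace_submod M X).
exists S, i; split=> // s.
suff: exists2 s', trace M s' & i s' = i s by move=> [s' ? /ii <-].
have /iE : exists s', i s' = i s by exists s.
move=> /(_ (fun x => exists2 s', trace M s' & i s' = x)); apply.
  exact: submod_im (trace_submod _ _).
move=> f m.
have [g gE] := @factor_inj _ _ _ _ i f ii ltac:(
  by move=> z; apply/iE; exact: trace_image).
by exists (g m) => //; exact: trace_image.
Qed.

Section TorsionQuotient.
Context {R : pzRingType} (T : lmodType R -> Prop) (torT : torsion_class T).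
Implicit Types M N P Q X Y Z : lmodType R.

(** The kernel of q is a trace of M, hence in T, so f lifts to X, where its image falls into the
    trace. *)
Lemma relproj_trace_quot M X Y (q : {linear X -> Y}) : T M -> relproj T M ->
  surj q -> (forall x, q x = 0 <-> trace M x) ->
  forall (f : {linear M -> Y}) m, f m = 0.
Proof.
move=> TM rM sq qE f m.
have [|g gE] := rM _ _ q f sq.
  rewrite (_ : (fun y => q y = 0) = @trace R M X); last by apply/predeqP.
  have [S [i [ii iE gS]]] := trace_smod M X.
  by exists S, i; split=> //; exact: tors_gen gS.
by rewrite -gE; apply/qE; exact: trace_image.
Qed.

End TorsionQuotient.

Section Approximation.
Context {K : fieldType} {A : falgType K}.
Implicit Types M P Q X Y Z : rmodType A.

(* The approximation is the map A -> T0, a |-> t a. *)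
Definition min_approx (T : rmodType A -> Prop) (T0 : rmodType A) (t : T0) : Prop :=
  [/\ findim T0, T T0, forall X (x : X), T X -> exists h : {linear T0 -> X}, h t = x
    & forall g : {linear T0 -> T0}, g t = t -> bijective g].

(** The tuple of the spanning elements [v i] in M^n can be mapped to any element of any module of T.
    T0 is a minimal T-submodule of M^n containing this tuple. *)
Lemma min_approx_ex (T : rmodType A -> Prop) M : torsion_class T ->
  (forall X, T X <-> gen M X) -> findim M ->
  exists (T0 : rmodType A) (t : T0), min_approx T t.
Proof.
move=> torT TE fM; have [n [v vP]] := fM.
have TM : T M by apply/TE; exact: gen_refl.
have [Y [y [TY fY yv]]] : exists (Y : rmodType A) (y : Y), [/\ T Y, findim Y &
    forall i, exists h : {linear Y -> M}, h y = v i].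
  elim: n v {vP} => [|n IH] v.
    have [S [i [ii iE]]] := submodule_ex (submod_0 (regular_rmod A)).
    have S0 (s : S) : s = 0 by apply: ii; rewrite linear0; apply/iE; exists s.
    exists S, 0; split; [exact: tors_zero|exact: findim_zero|by case].
  have [Y [y [TY fY yv]]] := IH (fun i => v (lift ord0 i)).
  have [f fE] := linear_fst M Y; have [g gE] := linear_snd M Y.
  exists (M * Y)%type, (v ord0, y); split.
  - exact: tors_pair.
  - exact: findim_pair.
  move=> i; case: (unliftP ord0 i) => [j ->|->]; last by exists f; rewrite fE.
  by have [h hE] := yv j; exists (h \o g); rewrite /= gE.
have yM m : exists h : {linear Y -> M}, h y = m.
  have [c ->] := vP m; elim/big_rec: _ => [|i x _ [h hE]].
    by have [z zE] := linear_zero Y M; exists z.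
  have [g gE] := yv i; have [k kE] := linear_kscale_ex g (c i).
  by have [l lE] := linear_add k h; exists l; rewrite lE kE hE gE.
have yX X (x : X) : T X -> exists h : {linear Y -> X}, h y = x.
  move=> /TE/(_ x) tx.
  (* A multiple of a linear map by an element of A need not be linear, so stability under A is built
     into the predicate. *)
  pose Nx x := forall a : A^c, exists h : {linear Y -> X}, h y = a *: x.
  have sN : submod Nx.
    split=> [a|a u w Hu Hw b].
      by have [z zE] := linear_zero Y X; exists z; rewrite zE scaler0.
    have [f fE] := Hu (b * a); have [g gE] := Hw b.
    have [h hE] := linear_add f g.
    by exists h; rewrite hE fE gE scalerDr scalerA.
  have [f m a|h hE] := tx Nx sN _ 1.
    by have [h hE] := yM (a *: m); exists (f \o h); rewrite /= hE linearZ.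
  by exists h; rewrite hE scale1r.
have [||N [[TN Ny] mN]] := @min_submod _ _ Y (fun N => smod T N /\ N y)
  (fun=> True) (findim_finlen fY).
- by move=> N [/smod_submod/submod_ksub].
- by split=> //; exact: smodT.
have [T0 [i [ii iE TT0]]] := TN.
have [t tE] : exists t, i t = y by apply/iE.
have fT0 := findim_inj ii fY.
exists T0, t; split=> // [X x TX|g gt].
  by have [h hE] := yX X x TX; exists (h \o i); rewrite /= tE.
apply: (finlen_surj_inj (findim_finlen fT0)) => s.
have [|||z zE] := mN (fun x => exists z, (i \o g) z = x) _ _ (i s).
- split; last by exists t; rewrite /= gt.
  by apply: smod_range => // ? ? ?; exact: tors_quot.
- by move=> _ [z <-]; apply/iE; exists (g z).
- by apply/iE; exists s.
- by exists z; exact: ii.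
Qed.

Section Cokernel.
Context (T : rmodType A -> Prop) (T0 T1 : rmodType A) (t : T0).
Context (pi : {linear T0 -> T1}).
Hypothesis torT : torsion_class T.
Hypothesis appT : min_approx T t.
Hypothesis spi : surj pi.
Hypothesis piE : forall y, pi y = 0 <-> exists a : A^c, a *: t = y.

Let TQ X Y (p : {linear X -> Y}) : surj p -> T X -> T Y.
Proof. exact: tors_quot. Qed.

Lemma approx_T0 : T T0. Proof. by case: appT. Qed.
Lemma approx_T1 : T T1. Proof. exact: TQ spi approx_T0. Qed.
Lemma approx_findim0 : findim T0. Proof. by case: appT. Qed.
Lemma approx_findim1 : findim T1. Proof. exact: findim_quot spi approx_findim0. Qed.

Lemma approx_pi0 : pi t = 0.
Proof. by apply/piE; exists 1; rewrite scale1r. Qed.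

Lemma approx_factor X (f : {linear T0 -> X}) : f t = 0 ->
  exists g : {linear T1 -> X}, forall y, g (pi y) = f y.
Proof.
move=> ft; apply: factor_surj => // y /piE[a <-].
by rewrite linearZ /= ft scaler0.
Qed.

Lemma approx_gen X : T X -> gen T0 X.
Proof.
move=> TX x; case: appT => _ _ /(_ X x TX)[h <-] _; exact: trace_image.
Qed.

(** Wakamatsu's lemma. The pullback P of p along u is an extension in T, so T0 -> P exists over a
    chosen preimage of t; the composite T0 -> P -> T0 fixes t and is bijective by minimality. *)
Lemma approx_relproj0 : relproj T T0.
Proof.
have [_ TT0 app minT] := appT.
move=> Y N p u sp [S [i [ii iE TS]]].
have [f fE] := linear_fst Y T0; have [g gE] := linear_snd Y T0.
have [w wE] := linear_sub (p \o f) (u \o g).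
have [P [j [ij jE]]] := submodule_ex (submod_ker w).
have sgj : surj (g \o j).
  move=> s; have [y yE] := sp (u s).
  have /jE[x xE] : w (y, s) = 0 by rewrite wE /= fE gE /= yE subrr.
  by exists x; rewrite /= xE gE.
have TP : T P.
  apply: (tors_extk torT sgj) => //.
  have [k kE] := linear_inl Y T0.
  have [l lE] := @factor_inj _ _ _ _ j (k \o i) ij ltac:(
    move=> s; apply/jE; rewrite /= wE /= fE gE kE /= linear0 subr0;
    by apply/iE; exists s).
  exists S, l; split=> // [x y e|x].
    by have : k (i x) = k (i y) by [rewrite -[k _]/((k \o i) x) -lE e lE]; rewrite !kE => -[/ii].
  split=> [gx|[s <-]]; last by rewrite /= lE gE /= kE.
  have wx : w (j x) = 0 by apply/jE; exists x.
  have /iE[s sE] : p (f (j x)) = 0.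
    by have := wx; rewrite wE /= [g (j x)]gx linear0 subr0.
  exists s; apply: ij; rewrite lE /= kE sE fE.
  by have := gx; rewrite /= gE; case: (j x) => a b /= ->.
have [y1 y1E] := sp (u t).
have /jE[x xE] : w (y1, t) = 0 by rewrite wE /= fE gE /= y1E subrr.
have [h hE] := app P x TP.
have [|c [cK Kc]] := linear_inverse (minT ((g \o j) \o h) _).
  by rewrite /= hE xE gE.
exists (f \o (j \o (h \o c))) => s /=.
have : w (j (h (c s))) = 0 by apply/jE; exists (h (c s)).
by rewrite wE /= => /eqP; rewrite subr_eq0 => /eqP ->; rewrite -[in RHS](Kc s).
Qed.

(** A lift s of [u \o pi] sends t into ker p, which is in T. Subtracting a map T0 -> ker p with the
    same value at t makes s factor through T1. *)
Lemma approx_relproj1 : relproj T T1.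
Proof.
move=> Y N p u sp TK; have [S [i [ii iE TS]]] := TK.
have [s sE] := approx_relproj0 (u \o pi) sp TK.
have /iE[s' s'E] : p (s t) = 0 by rewrite sE /= approx_pi0 linear0.
have [_ _ app _] := appT; have [z zE] := app S s' TS.
have [v vE] := linear_sub s (i \o z).
have [w wE] := approx_factor (f := v) ltac:(by rewrite vE /= zE s'E subrr).
exists w => m; have [x <-] := spi m; rewrite wE vE linearB /= sE /=.
by rewrite (_ : p (i (z x)) = 0) ?subr0 //; apply/iE; exists (z x).
Qed.

(* A -> ker p extends to T0 -> Y; subtracting a lift of the induced map T1 -> N
   corrects this to a map T0 -> ker p. *)
Lemma approx_ker Y (N : rmodType A) (p : {linear Y -> N}) : T Y ->
  (forall l : {linear T1 -> N}, exists l' : {linear T1 -> Y}, forall x, p (l' x) = l x) ->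
  smod T (fun y => p y = 0).
Proof.
move=> TY lift; have [S [i [ii iE]]] := submodule_ex (submod_ker p).
exists S, i; split=> //; apply: (tors_gen torT approx_T0) => s.
have [_ _ app _] := appT; have [g gt] := app Y (i s) TY.
have [l lE] := approx_factor (f := p \o g) ltac:(
  by rewrite /= gt; apply/iE; exists s).
have [l' l'E] := lift l.
have [v vE] := linear_sub g (l' \o pi).
have [w wE] := @factor_inj _ _ _ _ i v ii ltac:(
  by move=> x; apply/iE; rewrite vE linearB /= l'E lE subrr).
rewrite (_ : s = w t); first exact: trace_image.
by apply: ii; rewrite wE vE /= approx_pi0 linear0 subr0.
Qed.

Definition wide X : Prop := T X /\ forall (u : {linear T1 -> X}) x, u x = 0.

Lemma wide_ker X (N : rmodType A) (p : {linear X -> N}) : T X -> wide N -> smod T (fun y => p y = 0).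
Proof.
move=> TX [_ wN]; apply: approx_ker => // l.
have [z zE] := linear_zero T1 X; exists z => x.
by rewrite zE linear0 wN.
Qed.

Lemma wide_inj X Y (i : {linear X -> Y}) : injective i -> wide Y -> T X -> wide X.
Proof.
move=> ii [_ wY] TX; split=> // u x; apply: ii; rewrite linear0.
exact: (wY (i \o u)).
Qed.

Lemma wide_quot X Y (p : {linear X -> Y}) : surj p -> smod T (fun x => p x = 0) ->
  wide X -> wide Y.
Proof.
move=> sp TK [TX wX]; split; first exact: TQ TX.
move=> u x; have [v vE] := approx_relproj1 u sp TK.
by rewrite -vE wX linear0.
Qed.

Lemma wide_ext X Y Z (i : {linear X -> Y}) (p : {linear Y -> Z}) :
  injective i -> exact i p -> surj p -> wide X -> wide Z -> wide Y.
Proof.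
move=> ii ex sp [TX wX] [TZ wZ]; split; first exact: (tors_ext torT ii ex sp).
move=> u x.
have [v vE] := @factor_inj _ _ _ _ i u ii ltac:(
  by move=> z; apply/ex; exact: (wZ (p \o u))).
by rewrite -vE wX linear0.
Qed.

Lemma wide_coproduct I X (S : rmodType A) (iota : I -> {linear X -> S}) :
  @is_coproduct A^c I (fun=> X) S iota -> wide X -> wide S.
Proof.
move=> cop [TX wX]; split; first by case: torT => H _ _; apply: (H _ _ _ _ cop).
move=> u x; apply: (coproduct_joint_inj cop) => p _.
exact: (wX (p \o u)).
Qed.

Section Reflection.
Context (B : rmodType A) (b : {linear T0 -> B}).
Hypothesis sb : surj b.
Hypothesis bE : forall y, b y = 0 <-> trace T1 y.

Lemma reflection_wide : wide B.
Proof.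
split; first exact: TQ sb approx_T0.
exact: (relproj_trace_quot torT approx_T1 approx_relproj1 sb bE).
Qed.

Lemma reflection_ex X (x : X) : wide X -> exists h : {linear B -> X}, h (b t) = x.
Proof.
move=> [TX wX]; have [_ _ app _] := appT; have [g gt] := app X x TX.
have [h hE] := @factor_surj _ _ _ _ b g sb ltac:(
  move=> y /bE ty; apply: (ty (fun y => g y = 0)); [exact: submod_ker|];
  by move=> f m; exact: (wX (g \o f))).
by exists h; rewrite hE.
Qed.

Lemma reflection_uniq X (h : {linear B -> X}) : wide X -> h (b t) = 0 ->
  forall y, h y = 0.
Proof.
move=> [TX wX] ht y; have [g gE] := approx_factor (f := h \o b) ht.
by have [x <-] := sb y; rewrite -[h _]/((h \o b) x) -gE wX.
Qed.

Let I (r : {linear T0 -> T0}) : Prop :=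
  exists j : {linear T1 -> T0}, forall x, r x = j (pi x).

(* L k is J^k T0 for the ideal J of the endomorphisms factoring through pi. *)
Let Fixpoint L (k : nat) : T0 -> Prop :=
  if k is k'.+1 then
    fun x => forall N, ksub N -> (forall r y, I r -> L k' y -> N (r y)) -> N x
  else fun=> True.

Let L_ksub k : ksub (L k).
Proof.
case: k => [|k]; first by [].
split=> [N [] //|x y Hx Hy N sN H|c x Hx N sN H]; case: (sN) => N0 ND NZ.
  by apply: ND; [exact: Hx|exact: Hy].
by apply: NZ; exact: Hx.
Qed.

Let L_stable k (e : {linear T0 -> T0}) x : L k x -> L k (e x).
Proof.
case: k => // k Lx; apply: (Lx (fun x => L k.+1 (e x))).
  have [N0 ND NZ] := L_ksub k.+1; split=> [|y z|c y].
  - by rewrite linear0.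
  - by rewrite linearD; exact: ND.
  - by rewrite linear_kscale; exact: NZ.
move=> r y [j jE] Ly N sN H; apply: (H (e \o r)) => //.
by exists (e \o j) => z /=; rewrite jE.
Qed.

Let L_zero : exists k, forall x, L k x -> x = 0.
Proof.
have [||N [[k ->] mN]] := @min_submod _ _ T0 (fun N => exists k, N = L k)
  (L 0) (findim_finlen approx_findim0).
- by move=> N [k ->]; exact: L_ksub.
- by exists 0%N.
exists k => x Lx; apply: contrapT => nx.
have [||||y Ly] := @nakayama _ _ _ I (L k) (findim_finlen approx_findim0).
(* As [pi t = 0], the map 1 - e r fixes t, and minimality of the approximation makes it
   bijective. *)
- move=> e r u [j jE] uE; case: appT => _ _ _; apply.
  by rewrite uE jE approx_pi0 !linear0 ?subr0 ?addr0.
- exact: L_ksub.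
- by move=> e z; exact: L_stable.
- by exists x.
apply; apply: (mN (L k.+1)) => //; first by exists k.+1.
by move=> z; apply; [exact: L_ksub|move=> r w _; exact: L_stable].
Qed.

(* T0 is filtered by quotients of sums of copies of B. *)
Lemma reflection_cogen F : T F -> (forall (h : {linear B -> F}) x, h x = 0) ->
  forall x : F, x = 0.
Proof.
move=> TF hF.
have f0 (f : {linear T0 -> F}) : forall y, f y = 0.
  have [k kz] := L_zero.
  have : forall y, L k y -> f y = 0 by move=> y /kz ->; rewrite linear0.
  elim: k f {kz} => [|k IH] f fL y; first exact: fL.
  (* [j \o pi] maps [L k] into [L k.+1], where f vanishes, so the induction hypothesis applies to
     the composite. Hence f kills the trace of T1 and factors through B. *)
  have fj (j : {linear T1 -> T0}) z : f (j z) = 0.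
    have [w <-] := spi z; apply: (IH (f \o (j \o pi))) => v Lv.
    by apply: fL => N sN H; apply: (H (j \o pi)) => //; exists j.
  have [h hE] := @factor_surj _ _ _ _ b f sb ltac:(
    move=> z /bE tz; apply: (tz (fun y => f y = 0)); [exact: submod_ker|exact: fj]).
  by rewrite -hE hF.
move=> x; have /(_ x) tx := approx_gen TF.
by apply: (tx (fun x => x = 0)); [exact: submod_0|move=> f m; rewrite f0].
Qed.

(** For a maximal T'-submodule N of T0 there is no nonzero map B -> T0 / N, since its image could be
    added to N. So T0 / N = 0 by [reflection_cogen]. *)
Lemma reflection_generates (T' : rmodType A -> Prop) : torsion_class T' -> T' B ->
  forall X, T X -> T' X.
Proof.
move=> torT' T'B.
have [||N [T'N mN]] := @max_submod _ _ T0 (fun N => smod T' N) (fun x => x = 0)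
  (findim_finlen approx_findim0).
- by move=> N /smod_submod/submod_ksub.
- have [S [i [ii iE]]] := submodule_ex (submod_0 T0).
  exists S, i; split=> //; apply: tors_zero => // s; apply: ii; rewrite linear0.
  by apply/iE; exists s.
have [F [q [sq qE]]] := quotient_ex (smod_submod T'N).
have F0 : forall x : F, x = 0.
  apply: reflection_cogen; first exact: TQ sq approx_T0.
  move=> h x; have [y yE] := sq (h x); rewrite -yE; apply/qE.
  apply: (mN (fun y => exists x, h x = q y)) => [|z /qE ->|].
  - apply: (smod_tors_pre torT' (f := q) (N := fun z => exists x, h x = z)).
    + by move=> z _; exact: sq.
    + by apply: smod_ext T'N => z; rewrite qE.
    + by apply: smod_range => // ? ? ?; exact: tors_quot.
  - by exists 0; rewrite linear0.
  - by exists x.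
have T'T0 : T' T0.
  apply: (@smodP _ T' _ T0 (fun=> True) T0 idfun) => //.
  - by move=> ? ? ?; exact: tors_quot.
  - by move=> x; split=> // _; exists x.
  - by apply: smod_ext T'N => x; split=> // _; apply/qE; exact: F0.
by move=> X TX; exact: (tors_gen torT' T'T0 (approx_gen TX)).
Qed.

End Reflection.

End Cokernel.

End Approximation.

(** * Maximal torsion subclasses *)

Section Functional.
Context {K : fieldType} {A : falgType K}.
Implicit Types M P Q X Y Z : rmodType A.

Lemma ksub_maximal X (I : X -> Prop) v : ksub I -> ~ I v ->
  exists M : X -> Prop, [/\ ksub M, forall x, I x -> M x, ~ M v
    & forall N, ksub N -> (forall x, M x -> N x) -> ~ N v -> forall x, N x -> M x].
Proof.
move=> [I0 ID IZ] nIv.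
(* The union with I accommodates the empty chain, whose union is empty. *)
pose P (N : X -> Prop) := ksub (fun x => I x \/ N x) /\ ~ N v.
have [F FP totF|M [[kM nMv] mM]] := @classical_sets.Zorn_bigcup X P.
  split; last by move=> [N /FP[_ nv] /nv].
  split; first by left.
    move=> x y [Ix|[N FN Nx]] [Iy|[N' FN' Ny]].
    - by left; exact: ID.
    - have [[_ D _] _] := FP _ FN'.
      by have [Ixy|Nxy] := D x y (or_introl Ix) (or_intror Ny); [left|right; exists N'].
    - have [[_ D _] _] := FP _ FN.
      by have [Ixy|Nxy] := D x y (or_intror Nx) (or_introl Iy); [left|right; exists N].
    - case: (totF _ _ FN FN') => NN'.
        have [[_ D _] _] := FP _ FN'.
        by have [Ixy|Nxy] := D x y (or_intror (NN' _ Nx)) (or_intror Ny); [left|right; exists N'].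
      have [[_ D _] _] := FP _ FN.
      by have [Ixy|Nxy] := D x y (or_intror Nx) (or_intror (NN' _ Ny)); [left|right; exists N].
  move=> c x [Ix|[N FN Nx]]; first by left; exact: IZ.
  have [[_ _ Z] _] := FP _ FN.
  by have [Icx|Ncx] := Z c x (or_intror Nx); [left|right; exists N].
exists (fun x => I x \/ M x); split=> //; [by left|by case|].
move=> N kN MN nNv x Nx; apply: contrapT => nMx.
apply: (mM N); last first.
  split=> //; have -> : (fun x => I x \/ N x) = N; last by [].
  by apply/funext => y; apply/propext; split=> [[Iy|]|]; [apply: MN; left| |right].
split=> [y My|NM]; first by apply: MN; right.
by apply: nMx; right; exact: NM.
Qed.

(** A subspace M maximal among those containing I and not v is a complement of the line through v; l
    x is the unique c with x - c v in M. *)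
Lemma functional_ex X (I : X -> Prop) v : ksub I -> ~ I v ->
  exists l : X -> K, [/\ forall x y, l (x + y) = l x + l y,
    forall c x, l (kscale c x) = c * l x, forall x, I x -> l x = 0 & l v = 1].
Proof.
move=> kI nIv; have [M [[M0 MD MZ] IM nMv mM]] := ksub_maximal kI nIv.
have MB x y : M x -> M y -> M (x - y).
  move=> Mx My; apply: MD => //.
  have -> : - y = kscale (-1) y by rewrite kscaleNl kscale1.
  exact: MZ.
have ex x : exists c, M (x - kscale c v).
  apply: contrapT => nex.
  have nMx : ~ M x by move=> Mx; apply: nex; exists 0; rewrite kscale0 subr0.
  pose N y := exists c, M (y - kscale c x).
  have kN : ksub N.
    split; first by exists 0; rewrite kscale0 subr0.
      move=> y z [c Mc] [d Md]; exists (c + d).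
      by rewrite kscaleDl opprD addrACA; exact: MD.
    move=> c y [d Md]; exists (c * d).
    have -> : kscale c y - kscale (c * d) x = kscale c (y - kscale d x).
      by rewrite kscaleBr kscaleA.
    exact: MZ.
  apply: nMx; apply: (mM N) => //.
  - by move=> y My; exists 0; rewrite kscale0 subr0.
  - move=> [c Mc]; have [c0|c0] := eqVneq c 0.
      by apply: nMv; rewrite -[v]subr0 -(kscale0 x) -c0.
    apply: nex; exists c^-1.
    have -> : x - kscale c^-1 v = kscale (- c^-1) (v - kscale c x).
      by rewrite kscaleBr !kscaleNl kscaleA mulVf // kscale1 opprK addrC.
    exact: MZ.
  - by exists 1; rewrite kscale1 subrr; exact: M0.
have uniq x c d : M (x - kscale c v) -> M (x - kscale d v) -> c = d.
  move=> Mc Md; apply/eqP; apply: contrapT => /negP ne.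
  have cd : c - d != 0 by rewrite subr_eq0.
  apply: nMv; rewrite -(kscale1 v) -(mulVf cd) -kscaleA; apply: MZ.
  have -> : kscale (c - d) v = (x - kscale d v) - (x - kscale c v).
    by rewrite opprB [RHS]addrC addrA subrK kscaleDl kscaleNl.
  exact: MB.
have [l lE] := choice ex; exists l; split.
- move=> x y; apply: (uniq (x + y)); first exact: lE.
  by rewrite kscaleDl opprD addrACA; exact: MD.
- move=> c x; apply: (uniq (kscale c x)); first exact: lE.
  by rewrite -kscaleA -kscaleBr; exact: MZ.
- move=> x Ix; apply: (uniq x); first exact: lE.
  by rewrite kscale0 subr0; exact: IM.
- by apply: (uniq v); [exact: lE|rewrite kscale1 subrr].
Qed.

Lemma findim_of_coordinates X Y (q : {linear X -> Y}) n (psi : X -> 'rV[K]_n) :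
  surj q -> (forall x y, psi (x + y) = psi x + psi y) ->
  (forall c x, psi (kscale c x) = c *: psi x) ->
  (forall x, psi x = 0 -> q x = 0) -> findim Y.
Proof.
move=> sq psiD psiZ psi0.
have psi00 : psi 0 = 0 by rewrite -(kscale0 0) psiZ scale0r.
have psiB u w : psi (u - w) = psi u - psi w.
  by rewrite psiD -{1}(kscale1 w) -kscaleNl psiZ scaleN1r.
have [|c x y [x' <-] [y' <-]|M ME] := @rowspace_ex K n (fun r => exists x, psi x = r).
- by exists 0.
- by exists (kscale c x' + y'); rewrite psiD psiZ.
have [x xE] := choice (fun i => (ME (row i M)).2 (row_sub i M)).
exists n, (fun i => q (x i)) => y; have [z <-] := sq y.
have /submxP[D DE] : (psi z <= M)%MS by apply/ME; exists z.
exists (fun i => D 0 i); apply/eqP; rewrite -subr_eq0; apply/eqP.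
have -> : \sum_i ((D 0 i)%:A : A^c) *: q (x i) = q (\sum_i kscale (D 0 i) (x i)).
  by rewrite linear_sum; apply: eq_bigr => i _; rewrite linearZ.
rewrite -linearB; apply: psi0.
have psiS : psi (\sum_i kscale (D 0 i) (x i)) = \sum_i D 0 i *: row i M.
  by rewrite (big_morph psi psiD psi00); apply: eq_bigr => i _; rewrite psiZ xE.
by rewrite psiB psiS DE mulmx_sum_row subrr.
Qed.

End Functional.

Section Covers.
Context {K : fieldType} {A : falgType K}.
Implicit Types M P Q S X Y Z : rmodType A.

Lemma finite_sum_ex (C : rmodType A -> Prop) n (P : 'I_n -> Prop)
    (X : 'I_n -> rmodType A) :
  (forall Y, (forall y : Y, y = 0) -> C Y) ->
  (forall Y Z, C Y -> C Z -> C (Y * Z)%type) -> (forall i, P i -> C (X i)) ->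
  exists G : rmodType A, C G /\ forall i, P i ->
    exists (u : {linear X i -> G}) (v : {linear G -> X i}), forall x, v (u x) = x.
Proof.
move=> C0 CP; elim: n P X => [|n IH] P X CX.
  have [S [i [ii iE]]] := submodule_ex (submod_0 (regular_rmod A)).
  have S0 (s : S) : s = 0 by apply: ii; rewrite linear0; apply/iE; exists s.
  by exists S; split; [exact: C0|case].
have [G [CG GP]] := IH (fun i => P (lift ord0 i)) (fun i => X (lift ord0 i))
  (fun i => CX _).
case: (EM (P ord0)) => [P0|nP0]; last first.
  exists G; split=> // i; case: (unliftP ord0 i) => [j ->|->] //; exact: GP.
exists (X ord0 * G)%type; split; first by apply: CP => //; exact: CX.
have [f fE] := linear_fst (X ord0) G; have [g gE] := linear_snd (X ord0) G.
have [k kE] := linear_inl (X ord0) G; have [l lE] := linear_inr (X ord0) G.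
move=> i; case: (unliftP ord0 i) => [j ->|->] Pi; last first.
  by exists k, f => x; rewrite fE kE.
have [u [v vu]] := GP j Pi; exists (l \o u), (v \o g) => x.
by rewrite /= gE lE /= vu.
Qed.

Section Simple.
Context (T : rmodType A -> Prop) (T0 T1 : rmodType A) (t : T0).
Context (pi : {linear T0 -> T1}).
Hypothesis torT : torsion_class T.
Hypothesis appT : min_approx T t.
Hypothesis spi : surj pi.
Hypothesis piE : forall y, pi y = 0 <-> exists a : A^c, a *: t = y.
Context (B : rmodType A) (b : {linear T0 -> B}).
Hypothesis sb : surj b.
Hypothesis bE : forall y, b y = 0 <-> trace T1 y.

Let TQ X Y (p : {linear X -> Y}) : surj p -> T X -> T Y.
Proof. exact: tors_quot. Qed.
Local Notation W := (wide T T1).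
Local Notation b1 := (b t).
Let TT0 : T T0. Proof. exact: approx_T0 appT. Qed.
Let TT1 : T T1. Proof. exact: approx_T1 torT appT spi. Qed.
Let WB : W B. Proof. exact: (reflection_wide torT appT spi piE sb bE). Qed.
Let Wker X (N : rmodType A) (p : {linear X -> N}) :
  T X -> W N -> smod T (fun y => p y = 0).
Proof. exact: wide_ker torT appT spi piE _ _ _. Qed.
Let Wquot X Y (p : {linear X -> Y}) : surj p -> smod T (fun x => p x = 0) -> W X -> W Y.
Proof. exact: wide_quot torT appT spi piE _ _ _. Qed.
Let Bex X (x : X) : W X -> exists h : {linear B -> X}, h b1 = x.
Proof. exact: (reflection_ex appT sb bE). Qed.
Let Buniq X (h : {linear B -> X}) : W X -> h b1 = 0 -> forall y, h y = 0.
Proof. exact: (reflection_uniq spi piE sb). Qed.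
Let fB : findim B. Proof. exact: findim_quot sb (approx_findim0 appT). Qed.

(** These are the simple objects of W: by [wide_inj], a submodule of S that is in T is already in
    W. *)
Definition wide_simple (S : rmodType A) : Prop :=
  [/\ W S, exists s : S, s <> 0 & forall N : S -> Prop, smod T N ->
    (forall x, N x -> x = 0) \/ forall x, N x].

Lemma simple_surj X S (f : {linear X -> S}) x : T X -> wide_simple S ->
  f x <> 0 -> surj f.
Proof.
move=> TX [WS _ sS] fx; case: (sS _ (smod_range TQ f TX)) => // H.
by case: fx; apply: H; exists x.
Qed.

Lemma simple_bij S S' (f : {linear S -> S'}) x : wide_simple S -> wide_simple S' ->
  f x <> 0 -> bijective f.
Proof.
move=> sS sS' fx; have [[TS _] _ S2] := sS; have [WS' _ _] := sS'.
apply: linear_bij; last exact: simple_surj fx.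
apply: linear_inj; case: (S2 _ (Wker f TS WS')) => //.
Qed.

Lemma findim_simple_quot X (x0 : X) : findim X -> W X -> x0 <> 0 ->
  exists S (q : {linear X -> S}), wide_simple S /\ surj q.
Proof.
move=> fX WX x0n; have [TX _] := WX.
have [||N [[TN [x1 Nx1]] mN]] := @max_submod _ _ X (fun N => smod T N /\ exists x, ~ N x)
  (fun x => x = 0) (findim_finlen fX).
- by move=> N [/smod_submod/submod_ksub].
- split; last by exists x0.
  have [S [i [ii iE]]] := submodule_ex (submod_0 X).
  exists S, i; split=> //; apply: tors_zero => // s; apply: ii; rewrite linear0.
  by apply/iE; exists s.
have [S [q [sq qE]]] := quotient_ex (smod_submod TN).
have kq : smod T (fun x => q x = 0) by apply: smod_ext TN => x; rewrite qE.
exists S, q; split=> //; split; first exact: Wquot kq WX.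
  by exists (q x1) => /qE.
move=> N' TN'.
have TNq : smod T (fun x => N' (q x)).
  by apply: smod_tors_pre => // y _; exact: sq.
have NN' x : N x -> N' (q x).
  by move=> /qE ->; case: (smod_submod TN').
case: (EM (exists x, ~ N' (q x))) => [ex|nex]; [left|right] => y.
  by have [x <-] := sq y => N'x; apply/qE; exact: (mN (fun x => N' (q x))).
by have [x <-] := sq y; apply: contrapT => nx; apply: nex; exists x.
Qed.

(* Kill the images of all maps B -> X on which a functional l with l x0 = 1
   vanishes; X / N embeds into the K-dual of B by x |-> l o (b1 |-> x). *)
Lemma findim_quot_ex X (x0 : X) : W X -> x0 <> 0 ->
  exists Y (q : {linear X -> Y}), [/\ findim Y, W Y, surj q & q x0 <> 0].
Proof.
move=> WX x0n; have [TX _] := WX.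
have [l [lD lZ _ l1]] := functional_ex (submod_ksub (submod_0 X)) x0n.
pose N x := forall N : X -> Prop, submod N ->
  (forall h : {linear B -> X}, (forall y, l (h y) = 0) -> forall y, N (h y)) -> N x.
have sN : submod N.
  split=> [N' [] //|a x y Hx Hy N' sN' H].
  by apply: sN'.2; [exact: Hx|exact: Hy].
have l0 : l 0 = 0 by apply: (@addrI _ (l 0)); rewrite -lD !addr0.
have TN : smod T N.
  have [S [i [ii iE]]] := submodule_ex sN.
  exists S, i; split=> //; apply: (tors_gen torT (M := B)); first by case: WB.
  move=> s; suff: exists2 s', trace B s' & i s' = i s by move=> [s' ? /ii <-].
  have /iE : exists s', i s' = i s by exists s.
  move=> /(_ (fun x => exists2 s', trace B s' & i s' = x)); apply.
    exact: submod_im (trace_submod _ _).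
  move=> h lh y.
  have [g gE] := @factor_inj _ _ _ _ i h ii ltac:(
    by move=> z; apply/iE => N' _; apply).
  by exists (g y) => //; exact: trace_image.
have nN : ~ N x0.
  move=> /(_ (fun x => forall a : A^c, l (a *: x) = 0)) H.
  have : l (1 *: x0) = 0.
    apply: H => [|h lh y a]; last by rewrite -linearZ lh.
    split=> [a|a x y Hx Hy c]; first by rewrite scaler0.
    by rewrite scalerDr lD scalerA Hx Hy addr0.
  by rewrite scale1r l1 => /eqP; rewrite oner_eq0.
have [Y [q [sq qE]]] := quotient_ex sN.
exists Y, q; split=> //; last by move=> /qE.
  have [n [v vP]] := fB.
  have [h hE] := choice (fun x => Bex x WX).
  have hD x y z : h (x + y) z = h x z + h y z.
    have [k kE] := linear_add (h x) (h y); have [m mE] := linear_sub (h (x + y)) k.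
    have e : forall z, m z = 0 by apply: (Buniq WX); rewrite mE kE !hE subrr.
    by move: (e z); rewrite mE kE => /eqP; rewrite subr_eq0 => /eqP.
  have hZ c x z : h (kscale c x) z = kscale c (h x z).
    have [k kE] := linear_kscale_ex (h x) c; have [m mE] := linear_sub (h (kscale c x)) k.
    have e : forall z, m z = 0 by apply: (Buniq WX); rewrite mE kE !hE subrr.
    by move: (e z); rewrite mE kE => /eqP; rewrite subr_eq0 => /eqP.
  (* [h x] is the map B -> X sending [b1] to x, and [psi x] records l along it on a spanning family.
     If [psi x] vanishes, [h x] is one of the maps whose images are killed, and x is in its
     image. *)
  pose psi x : 'rV[K]_n := \row_i l (h x (v i)).
  have psiD x y : psi (x + y) = psi x + psi y.
    by apply/rowP => i; rewrite !mxE hD lD.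
  have psiZ c x : psi (kscale c x) = c *: psi x.
    by apply/rowP => i; rewrite !mxE hZ lZ.
  have psi0 x : psi x = 0 -> N x.
    move=> px N' sN' H; rewrite -(hE x); apply: H => y.
    have [c ->] := vP y; rewrite linear_sum.
    elim/big_rec: _ => // i z _ IH; rewrite lD IH addr0 linearZ.
    rewrite [l _]lZ; have := congr1 (fun M : 'rV[K]_n => M 0 i) px.
    by rewrite !mxE => ->; rewrite mulr0.
  exact: (findim_of_coordinates sq psiD psiZ (fun x e => (qE x).2 (psi0 x e))).
apply: Wquot WX => //; apply: smod_ext TN => x; rewrite qE //.
Qed.

Lemma simple_quot_ex X (x0 : X) : W X -> x0 <> 0 ->
  exists S (q : {linear X -> S}), wide_simple S /\ surj q.
Proof.
move=> WX /(findim_quot_ex WX)[Y [q [fY WY sq qx]]].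
have [S [r [sS sr]]] := findim_simple_quot fY WY qx.
exists S, (r \o q); split=> // s; have [y <-] := sr s; have [x <-] := sq y.
by exists x.
Qed.

Definition simple_list n (S : 'I_n -> rmodType A) (Y : rmodType A) : Prop :=
  (forall i, wide_simple (S i)) /\
  forall S' (f : {linear Y -> S'}) y, wide_simple S' -> f y <> 0 ->
    exists i, isom (S i) S'.

(** A composition series of B in W, by a minimal counterexample among the T-submodules of B: a
    simple quotient is split off, and a map to a simple object is either nonzero on the kernel or
    factors through that quotient. Every simple object of W receives a nonzero map from B, so the
    list is complete. *)
Lemma simple_list_ex : exists n (S : 'I_n -> rmodType A), simple_list S B.
Proof.
pose Q N := forall Y (i : {linear Y -> B}), injective i ->
  (forall x, N x <-> exists y, i y = x) -> exists n (S : 'I_n -> rmodType A), simple_list S Y.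
suff H : Q (fun=> True) by apply: (H B idfun) => // x; split=> // _; exists x.
apply: contrapT => nQ.
have [||N [[TN nQN] mN]] := @min_submod _ _ B (fun N => smod T N /\ ~ Q N) (fun=> True)
  (findim_finlen fB).
- by move=> N [/smod_submod/submod_ksub].
- by split=> //; apply: smodT; case: WB.
apply: nQN => Y i ii iE.
have TY : T Y := smodP TQ ii iE TN.
have WY : W Y := wide_inj ii WB TY.
have fY := findim_inj ii fB.
case: (EM (exists y : Y, y <> 0)) => [[y yn]|Y0]; last first.
  exists 0%N, (fun=> B); split=> [[] //|S' f y _ fy].
  by case: Y0; exists y => y0; apply: fy; rewrite y0 linear0.
have [S0 [q [sS0 sq]]] := findim_simple_quot fY WY yn.
have [WS0 _ _] := sS0.
have TK := Wker q TY WS0.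
pose N' x := exists2 y, q y = 0 & i y = x.
have TN' : smod T N' by exact: smod_im.
have : Q N'.
  apply: contrapT => nQ'.
  have H : forall x, N x -> N' x.
    by apply: (mN N') => // _ [z _ <-]; apply/iE; exists z.
  case: sS0 => _ [s sn] _; have [z zE] := sq s.
  have [w qw /ii e] := H (i z) ((iE _).2 (ex_intro _ z erefl)).
  by apply: sn; rewrite -zE -e.
have [Y' [j [ij jE TY']]] := TK.
move=> /(_ Y' (i \o j)) [].
- by move=> u v /ii/ij.
- move=> x; split=> [[z /jE[u <-] <-]|[u <-]]; first by exists u.
  by exists (j u) => //; apply/jE; exists u.
move=> n [S [sS SP]].
exists n.+1, (fun k => if unlift ord0 k is Some k' then S k' else S0); split.
  by move=> k; case: unlift.
move=> S' f z sS' fz.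
case: (EM (exists u, f (j u) <> 0)) => [[u fu]|nu].
  have [k kS] := SP S' (f \o j) u sS' fu.
  by exists (lift ord0 k); rewrite liftK.
have [g gE] := @factor_surj _ _ _ _ q f sq ltac:(
  by move=> x /jE[u <-]; apply: contrapT => fu; apply: nu; exists u).
exists ord0; rewrite unlift_none.
by exists g; apply: (simple_bij (x := q z)) => //; rewrite gE.
Qed.

(* X is a minimal T-submodule of T0 with nonzero image under a map T0 -> S. *)
Lemma simple_cover S : wide_simple S -> exists X (f : {linear X -> S}),
  [/\ findim X, T X, relproj T X, surj f &
    forall S' (g : {linear X -> S'}) x, wide_simple S' -> g x <> 0 -> isom S' S].
Proof.
move=> sS; have [WS [s sn] _] := sS; have [TS _] := WS.
have [_ _ /(_ S s TS)[a at_] _] := appT.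
have at0 : a t <> 0 by rewrite at_.
have fT0 := approx_findim0 appT.
have [||N [[TN [x1 Nx1 ax1]] mN]] := @min_submod _ _ T0
  (fun N => smod T N /\ exists2 x, N x & a x <> 0) (fun=> True) (findim_finlen fT0).
- by move=> N [/smod_submod/submod_ksub].
- by split; [exact: smodT|exists t].
have [X [i [ii iE TX]]] := TN.
have /iE[z1 z1E] := Nx1.
have ai1 : (a \o i) z1 <> 0 by rewrite /= z1E.
have sai := simple_surj TX sS ai1.
have fX := findim_inj ii fT0.
have rT0 : relproj T T0 := approx_relproj0 torT appT.
(* Relative projectivity lifts a along its restriction to X. Minimality makes [g \o i] surjective,
   so X is a retract of T0 and inherits relative projectivity. *)
have [g gE] := rT0 _ _ (a \o i) a sai (Wker _ TX WS).
have bg : bijective (g \o i).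
  apply: (finlen_surj_inj (g := g \o i) (findim_finlen fX)) => x.
  have [|||y yE] := mN (fun x => exists y, (i \o (g \o i)) y = x) _ _ (i x).
  - split; first exact: smod_range.
    exists (i (g (i z1))); first by exists z1.
    by have := gE (i z1); rewrite /= => ->; rewrite z1E.
  - by move=> _ [y <-]; apply/iE; exists (g (i y)).
  - by apply/iE; exists x.
  - by exists y; exact: ii.
have [c [cK _]] := linear_inverse bg.
exists X, (a \o i); split=> //.
  exact: (relproj_retract (i := i) (r := c \o g)).
move=> S' f x sS' fx; have [WS' _ _] := sS'.
have Tf := Wker f TX WS'.
(* If [a \o i] were nonzero on ker f, which is in T, minimality would give ker f = X. So [a \o i]
   factors through f, as a nonzero map between simple objects. *)
have af y : f y = 0 -> a (i y) = 0.
  move=> fy; apply: contrapT => ay.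
  have [|||w fw /ii e] := mN (fun x => exists2 y, f y = 0 & i y = x) _ _ (i x).
  - by split; [exact: smod_im|exists (i y) => //; exists y].
  - by move=> _ [w _ <-]; apply/iE; exists w.
  - by apply/iE; exists x.
  - by apply: fx; rewrite -e.
have sf := simple_surj TX sS' fx.
have [h hE] := @factor_surj _ _ _ _ f (a \o i) sf af.
by exists h; apply: (simple_bij (x := f z1)) => //; rewrite hE.
Qed.

(** If T' contains all simple objects, let N be a minimal T-submodule of B with B / N in T'. For N
    nonzero with simple quotient N / N', the module B / N' is an extension of B / N by a simple
    object, against minimality. So B is in T', and B generates T. *)
Lemma simple_missing (T' : rmodType A -> Prop) X : torsion_class T' ->
  (forall Y, T' Y -> T Y) -> T X -> ~ T' X ->
  exists S, wide_simple S /\ ~ T' S.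
Proof.
move=> torT' T'T TX nT'X; apply: contrapT => nS.
have T'S S : wide_simple S -> T' S.
  by move=> sS; apply: contrapT => nS'; apply: nS; exists S.
apply: nT'X; apply: (reflection_generates torT appT spi piE sb bE torT') TX.
have [||N [[TN [Q [q [sq qE T'Q]]]] mN]] := @min_submod _ _ B (fun N => smod T N /\
  exists Q (q : {linear B -> Q}), [/\ surj q, forall x, q x = 0 <-> N x & T' Q])
  (fun=> True) (findim_finlen fB).
- by move=> N [/smod_submod/submod_ksub].
- split; first by apply: smodT; case: WB.
  have [Q [q [sq qE]]] := quotient_ex (submod_all B).
  exists Q, q; split=> //; apply: tors_zero => // y.
  by have [x <-] := sq y; apply/qE.
have N0 x : N x -> x = 0.
  move=> Nx; apply: contrapT => xn.
  have [Y [i [ii iE TY]]] := TN.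
  have WY : W Y := wide_inj ii WB TY.
  have /iE[y yE] := Nx.
  have yn : y <> 0 by move=> y0; apply: xn; rewrite -yE y0 linear0.
  have [S [f [sS sf]]] := findim_simple_quot (findim_inj ii fB) WY yn.
  have [WS [s sn] _] := sS.
  have TK := Wker f TY WS.
  pose N' x := exists2 y, f y = 0 & i y = x.
  have TN' : smod T N' by exact: smod_im.
  have [Q' [q' [sq' q'E]]] := quotient_ex (smod_submod TN').
  have [r rE] := @factor_surj _ _ _ _ q' q sq' ltac:(
    by move=> z /q'E[w _ <-]; apply/qE/iE; exists w).
  have [g gE] := @factor_surj _ _ _ _ f (q' \o i) sf ltac:(
    by move=> w fw; apply/q'E; exists w).
  have gi : injective g.
    apply: linear_inj => s'; have [w <-] := sf s'.
    by rewrite gE => /q'E[w' fw' /ii <-].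
  have T'Q' : T' Q'.
    apply: (tors_extk torT' (p := r)) => //.
      by move=> z; have [w <-] := sq z; exists (q' w); rewrite rE.
    exists S, g; split=> //; last exact: T'S.
    move=> z; have [w <-] := sq' z; rewrite rE qE iE; split=> [[v vE]|[s' s'E]].
      by exists (f v); rewrite gE /= vE.
    have [v vE] := sf s'; move: s'E; rewrite -vE gE => /esym/linear_eq_ker/q'E[u fu uE].
    by exists (v + u); rewrite linearD uE addrC subrK.
  have [w0 w0E] := sf s.
  have [|||w fw /ii e] := mN N' _ _ (i w0).
  - by split=> //; exists Q', q'.
  - by move=> _ [w _ <-]; apply/iE; exists w.
  - by apply/iE; exists w0.
  - by apply: sn; rewrite -w0E -e.
have qi : injective q by apply: linear_inj => x /qE/N0.
have [c [qK _]] := linear_inverse (linear_bij qi sq).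
by apply: (tors_quot torT' (p := c)) T'Q => x; exists (q x); rewrite qK.
Qed.

End Simple.

Lemma maximal_torsion_subclasses (T : rmodType A -> Prop) M :
  torsion_class T -> (forall X, T X <-> gen M X) -> findim M ->
  exists n (G : 'I_n -> rmodType A),
    (forall i, [/\ rigid (G i), forall X, gen (G i) X -> T X
                 & exists2 X, T X & ~ gen (G i) X]) /\
    forall T', torsion_class T' -> (forall X, T' X -> T X) ->
      (exists2 X, T X & ~ T' X) ->
      exists i, forall X, T' X -> gen (G i) X.
Proof.
move=> torT TE fM.
have [T0 [t appT]] := min_approx_ex torT TE fM.
have [h hE] := regular_hom t.
have [T1 [pi [spi pi0]]] := quotient_ex (submod_range h).
have piE y : pi y = 0 <-> exists a : A^c, a *: t = y.
  by rewrite pi0; split=> -[a <-]; exists a.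
have [B [b [sb bE]]] := quotient_ex (trace_submod T1 T0).
have [n [S [sS SP]]] := simple_list_ex torT appT spi piE sb bE.
have TQ X Y (p : {linear X -> Y}) : surj p -> T X -> T Y by exact: tors_quot.
have TT1 := approx_T1 torT appT spi.
have rT1 := approx_relproj1 torT appT spi piE.
have fT1 := approx_findim1 appT spi.
have [X XP] := choice (fun i => simple_cover torT appT spi piE (sS i)).
have GP j : exists G : rmodType A, [/\ findim G, T G, relproj T G,
    forall (f : {linear G -> S j}) x, f x = 0 &
    (exists (u : {linear T1 -> G}) (v : {linear G -> T1}), forall x, v (u x) = x) /\
    forall i, ~ isom (S i) (S j) ->
      exists (u : {linear X i -> G}) (v : {linear G -> X i}), forall x, v (u x) = x].
  (* The requirement Hom(Y, S j) = 0 is what keeps S j out of Gen(G j). It holds for T1 as S j is in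
     W, and for X i unless S i and S j are isomorphic. *)
  pose C (Y : rmodType A) := [/\ findim Y, T Y, relproj T Y &
    forall (f : {linear Y -> S j}) x, f x = 0].
  have CP Y Z : C Y -> C Z -> C (Y * Z)%type.
    move=> [fY TY rY hY] [fZ TZ rZ hZ]; split; [exact: findim_pair|exact: tors_pair|
      exact: relproj_pair|].
    have [k kE] := linear_inl Y Z; have [l lE] := linear_inr Y Z.
    move=> f [y z]; have -> : (y, z) = k y + l z.
      by rewrite kE lE; congr (_, _); rewrite /= ?addr0 ?add0r.
    by rewrite linearD /= [f (k y)](hY (f \o k)) [f (l z)](hZ (f \o l)) addr0.
  have [|||G0 [CG0 GX]] := @finite_sum_ex C n (fun i => ~ isom (S i) (S j)) X.
  - move=> Y Y0; split; [exact: findim_zero|exact: tors_zero| |].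
      move=> Z N p u sp _; have [z zE] := linear_zero Y Z; exists z => m.
      by rewrite (Y0 m) !linear0.
    by move=> f x; rewrite (Y0 x) linear0.
  - exact: CP.
  - move=> i nij; have [f [fX TX rX sf H]] := XP i; split=> // g x.
    apply: contrapT => gx; apply: nij.
    have [k bk] := H _ g x (sS j) gx.
    by have [k' [k'K kK']] := linear_inverse bk; exists k'; exists k.
  have CT1 : C T1 by split=> //; have [[_ H] _ _] := sS j.
  have [fG' TG' rG' hG'] : C (T1 * G0)%type by exact: CP.
  exists (T1 * G0)%type; split=> //; split.
    have [k kE] := linear_inl T1 G0; have [f fE] := linear_fst T1 G0.
    by exists k, f => x; rewrite fE kE.
  move=> i /GX[u [v vu]]; have [l lE] := linear_inr T1 G0.
  have [g gE] := linear_snd T1 G0.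
  by exists (l \o u), (v \o g) => x; rewrite /= gE lE /= vu.
have [G GE] := choice GP.
exists n, G; split=> [j|T' torT' T'T [X0 TX0 nTX0]].
  have [fG TG rG hG _] := GE j; split.
  - exact: relproj_rigid fG TG TQ rG.
  - by move=> Y; exact: tors_gen.
  have [[TS _] [s sn] _] := sS j; exists (S j) => // gS; apply: sn.
  by apply: (gS s (fun s => s = 0)); [exact: submod_0|exact: hG].
have [S' [sS' nT'S']] := simple_missing torT appT spi piE sb bE torT' T'T TX0 nTX0.
have simple_iso S'' : wide_simple T T1 S'' -> exists i, isom (S i) S''.
  move=> sS''; have [WS [s sn] _] := sS''.
  have [k kE] := reflection_ex appT sb bE s WS.
  by apply: (SP _ k (b t)) => //; rewrite kE.
have [j [k bk]] := simple_iso _ sS'.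
have nT'Sj : ~ T' (S j) by move=> T'S; apply: nT'S'; exact: (tors_iso torT' bk T'S).
have [fG TG rG hG [[u1 [v1 vu1]] GX]] := GE j.
exists j => Y T'Y.
(* Y' is in T' and receives no nonzero map from G j, hence none from T1, so it is in W. A simple
   quotient S'' of a nonzero Y' would be in T', thus some S i other than S j, and X i -> S'' would
   lift to a nonzero map X i -> Y', although X i is a summand of G j. *)
have [Y' [q [sq qE]]] := quotient_ex (trace_submod (G j) Y).
have hq := relproj_trace_quot torT TG rG sq qE.
have T'Y' : T' Y' := tors_quot torT' sq T'Y.
have WY' : wide T T1 Y'.
  split; first exact: T'T.
  by move=> u x; rewrite -(vu1 x); exact: (hq (u \o v1)).
suff Y0 : forall y : Y', y = 0 by move=> y; apply/qE; exact: Y0.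
move=> y; apply: contrapT => yn.
have [S'' [p [sS'' sp]]] := simple_quot_ex torT appT spi piE sb bE WY' yn.
have T'S'' : T' S'' := tors_quot torT' sp T'Y'.
have [i [m bm]] := simple_iso _ sS''.
have [m' [mK m'K]] := linear_inverse bm.
have T'Si : T' (S i).
  by apply: (tors_quot torT' (p := m')) T'S'' => s; exists (m s); rewrite mK.
have nij : ~ isom (S i) (S j).
  by move=> [c bc]; apply: nT'Sj; exact: (tors_iso torT' bc T'Si).
have [u [v vu]] := GX i nij.
have [f [fX TX rX sf _]] := XP i.
have [WS'' [s sn] _] := sS''.
have Tp := wide_ker torT appT spi piE p (T'T _ T'Y') WS''.
have [w wE] := rX _ _ p (m \o f) sp Tp.
have [x xE] := sf (m' s).
apply: sn; rewrite -(m'K s) -xE -[m (f x)]/((m \o f) x) -wE.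
by rewrite -(vu x) [w _](hq (w \o v)) linear0.
Qed.

End Covers.

(** * The Auslander-Reiten translate *)

Section Translate.
Context {K : fieldType} {A : falgType K}.
Implicit Types M P Q S X Y Z : rmodType A.

Lemma kscale_left (L : lmodType A) (a : A) c (l : L) :
  a *: ((c%:A : A) *: l) = (c%:A : A) *: (a *: l).
Proof. by rewrite !scalerA mulr_algl mulr_algr. Qed.

Lemma Kdual_ex (L : lmodType A) : exists (N : rmodType A) (pairing : N -> L -> K),
  is_Kdual pairing.
Proof.
pose lin (phi : L -> K) := forall (c : K) (l l' : L),
  phi ((c%:A : A) *: l + l') = c * phi l + phi l'.
pose T := {phi | lin phi}.
have lin0 : lin (fun=> 0) by move=> c l l'; rewrite mulr0 addr0.
have linN (phi : T) : lin (fun l => - sval phi l).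
  by move=> c l l'; rewrite (svalP phi) opprD mulrN.
have linD (phi psi : T) : lin (fun l => sval phi l + sval psi l).
  by move=> c l l'; rewrite (svalP phi) (svalP psi) addrACA mulrDr.
have linZ (a : A^c) (phi : T) : lin (fun l => sval phi ((a : A) *: l)).
  by move=> c l l'; rewrite scalerDr kscale_left (svalP phi).
pose E : quot_data T := @QuotData _ (fun x y => forall l, sval x l = sval y l)
  ltac:(by []) ltac:(by move=> x y /= H l; rewrite H)
  ltac:(by move=> x y z /= H1 H2 l; rewrite H1).
pose Z : zmod_data := @ZmodData T E (exist _ _ lin0)
  (fun x => exist _ _ (linN x)) (fun x y => exist _ _ (linD x y))
  ltac:(by rewrite /E => x y /= H l; rewrite H)
  ltac:(by rewrite /E => x x' y y' /= H1 H2 l; rewrite H1 H2)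
  ltac:(by rewrite /E => x y z l /=; rewrite addrA)
  ltac:(by rewrite /E => x y l /=; rewrite addrC)
  ltac:(by rewrite /E => x l /=; rewrite add0r)
  ltac:(by rewrite /E => x l /=; rewrite addNr).
pose D : lmod_data A^c := @LmodData A^c Z (fun a x => exist _ _ (linZ a x))
  ltac:(by rewrite /Z /E => a x y /= H l; rewrite H)
  ltac:(by rewrite /Z /E => a b x l /=; rewrite scalerA)
  ltac:(by rewrite /Z /E => x l /=; rewrite scale1r)
  ltac:(by [])
  ltac:(by rewrite /Z /E => x a b l /=;
    have := (svalP x) 1 ((a : A) *: l) ((b : A) *: l);
    rewrite scale1r mul1r scale1r -scalerDl => <-).
have [N [pi [spi piD piZ piE]]] := lquotP D.
have [r rK] := choice spi.
have rE n x : pi x = n -> forall l, sval (r n) l = sval x l.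
  by move=> <-; have /piE := rK (pi x).
exists N, (fun n l => sval (r n) l); split.
- by move=> n; exact: svalP (r n).
- by move=> n n' l; rewrite (rE _ (zd_add (r n) (r n'))) // piD !rK.
- by move=> a n l; rewrite (rE _ (@ld_scale _ D a (r n))) // piZ rK.
- move=> phi Hphi; exists (pi (exist _ phi Hphi)); split=> [l|n nE].
    by rewrite (rE _ (exist _ phi Hphi)).
  by rewrite -(rK n); apply/piE => l; rewrite /= -nE.
Qed.

(** The coordinates of a splitting of a free cover A^n -> P. *)
Lemma dual_basis P : projective P -> findim P ->
  exists n (p : 'I_n -> P) (alpha : 'I_n -> {linear P -> regular_rmod A}),
    forall x, x = \sum_i (alpha i x : A^c) *: p i.
Proof.
move=> pP [n [p pE]].
pose F : rmodType A := {ffun 'I_n -> regular_rmod A}.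
have [ev evE] := @linear_of _ F P (fun x => \sum_i (x i : A^c) *: p i) ltac:(
  move=> a x y; rewrite scaler_sumr -big_split /=; apply: eq_bigr => i _;
  by rewrite !ffunE scalerA -scalerDl).
have [s sE] := pP F P ev idfun ltac:(
  by move=> x; have [c ->] := pE x; exists [ffun i => ((c i)%:A : A)];
  rewrite evE; apply: eq_bigr => i _; rewrite ffunE).
have alphaP i : exists h : {linear P -> regular_rmod A}, forall x, h x = s x i.
  by apply: linear_of => a x y; rewrite linearP !ffunE.
have [alpha alphaE] := choice alphaP.
exists n, p, alpha => x; rewrite -[LHS](sE x) evE.
by apply: eq_bigr => i _; rewrite alphaE.
Qed.

(** Hom(P1, A) is realised inside the left module A^n by the values on a spanning family of P1; L is
    then the image of this submodule in A^n modulo the maps that factor through d. *)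
Lemma coker_dual_ex P1 P0 (d : {linear P1 -> P0}) : findim P1 ->
  exists (L : lmodType A) (pi : {linear P1 -> regular_rmod A} -> L),
    is_coker_dual d pi.
Proof.
move=> [n [p pE]].
pose F : lmodType A := {ffun 'I_n -> A^o}.
pose res (al : {linear P1 -> regular_rmod A}) : F := [ffun i => (al (p i) : A)].
have res_inj al be : res al = res be -> al =1 be.
  move=> e x; have [c ->] := pE x; rewrite !linear_sum; apply: eq_bigr => i _.
  by rewrite !linearZ; congr (_ *: _); have /ffunP/(_ i) := e; rewrite !ffunE.
have comb (X : rmodType A) (a : A) (al be : {linear X -> regular_rmod A}) :
    exists ga : {linear X -> regular_rmod A},
      forall x, ga x = a * (al x : A) + (be x : A).
  apply: linear_of => b x y; rewrite !linearP.
  have e (u v w z : A) : a * (u * b + v) + (w * b + z) =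
    (a * u + w) * b + (a * v + z) by rewrite mulrDr mulrA mulrDl addrACA.
  exact: e.
pose S0 (x : F) := exists be : {linear P0 -> regular_rmod A}, res (be \o d) = x.
have sS0 : submod S0.
  split.
    have [z zE] := linear_zero P0 (regular_rmod A).
    by exists z; apply/ffunP => i; rewrite !ffunE /= zE.
  move=> a _ _ [be <-] [be' <-]; have [ga gaE] := comb _ a be be'.
  by exists ga; apply/ffunP => i; rewrite !ffunE /= gaE.
have [Q [q [sq qE]]] := quotient_ex sS0.
pose S1 (y : Q) := exists al, q (res al) = y.
have resP a (al be ga : {linear P1 -> regular_rmod A}) : (forall x, ga x = a * (al x : A) + (be x : A)) ->
    res ga = a *: res al + res be.
  by move=> H; apply/ffunP => i; rewrite !ffunE H.
have sS1 : submod S1.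
  split.
    have [z zE] := linear_zero P1 (regular_rmod A).
    exists z; rewrite (_ : res z = 0) ?linear0 //.
    by apply/ffunP => i; rewrite !ffunE zE.
  move=> a _ _ [be <-] [be' <-]; have [ga gaE] := comb _ a be be'.
  by exists ga; rewrite (resP _ _ _ _ gaE) linearP.
have [L [i [ii iE]]] := submodule_ex sS1.
have piP al : exists l, i l = q (res al) by apply/iE; exists al.
have [pi piE] := choice piP.
exists L, pi; split.
- move=> l; have /iE[al alE] : exists s, i s = i l by exists l.
  by exists al; apply: ii; rewrite piE.
- by move=> a al be ga H; apply: ii; rewrite linearP !piE (resP _ _ _ _ H) linearP.
- move=> al; split=> [al0|[be beE]].
    have /qE[be /res_inj beE] : q (res al) = 0 by rewrite -piE al0 linear0.
    by exists be.
  apply: ii; rewrite piE linear0; apply/qE; exists be.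
  by apply/ffunP => j; rewrite !ffunE /= beE.
Qed.

Section Formula.
Context (P1 P0 N : rmodType A) (d : {linear P1 -> P0}).
Context (L : lmodType A) (pi : {linear P1 -> regular_rmod A} -> L).
Context (pairing : N -> L -> K).
Hypothesis pP1 : projective P1.
Hypothesis pP0 : projective P0.
Hypothesis fP1 : findim P1.
Hypothesis fP0 : findim P0.
Hypothesis cdP : is_coker_dual d pi.
Hypothesis kdP : is_Kdual pairing.

Let ext (P X : rmodType A) (x : X) (al : {linear P -> regular_rmod A}) :
  exists f : {linear P -> X}, forall p, f p = (al p : A^c) *: x.
Proof.
apply: linear_of => a p q; rewrite linearP scalerA.
have e : (a *: al p + al q : regular_rmod A) = (a * (al p : A^c) + (al q : A^c) : A^c) by [].
by rewrite e scalerDl.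
Qed.

Let pairingD n n' l : pairing (n + n') l = pairing n l + pairing n' l.
Proof. by case: kdP. Qed.

Let pairing0l l : pairing 0 l = 0.
Proof. by apply: (@addrI _ (pairing 0 l)); rewrite -pairingD !addr0. Qed.

Lemma pairing_inj n n' :
  (forall al, pairing n (pi al) = pairing n' (pi al)) -> n = n'.
Proof.
move=> H; have [pl _ _ pU] := kdP; have [spi _ _] := cdP.
have [m [_ mU]] := pU _ (pl n').
have <- : m = n by apply: mU => l; have [al <-] := spi l.
exact: mU.
Qed.

Lemma coker_dual_sum (ga : {linear P1 -> regular_rmod A}) k (a : 'I_k -> A)
    (de : 'I_k -> {linear P1 -> regular_rmod A}) :
    (forall y, ga y = \sum_i a i * (de i y : A)) ->
    pi ga = \sum_i a i *: pi (de i).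
Proof.
have [_ piP pi0] := cdP.
elim: k ga a de => [|k IH] ga a de gaE.
  rewrite big_ord0; apply/pi0; have [z zE] := linear_zero P0 (regular_rmod A).
  by exists z => y; rewrite zE gaE big_ord0.
have [ga' ga'E] : exists ga' : {linear P1 -> regular_rmod A},
    forall y, ga' y = \sum_i a (lift ord0 i) * (de (lift ord0 i) y : A).
  apply: linear_of => b y z.
  have e (u v : regular_rmod A) : (b *: u + v) = ((u : A) * (b : A) + (v : A)) by [].
  rewrite e mulr_suml -big_split /=; apply: eq_bigr => i _.
  by rewrite linearP e mulrDr mulrA.
rewrite big_ord_recl -(IH _ _ _ ga'E); apply: piP => y.
by rewrite gaE big_ord_recl ga'E.
Qed.

Let pairingDr n l l' : pairing n (l + l') = pairing n l + pairing n l'.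
Proof. by case: kdP => /(_ n 1 l l'); rewrite scale1r scale1r mul1r. Qed.

Let pairing0r n : pairing n 0 = 0.
Proof. by apply: (@addrI _ (pairing n 0)); rewrite -pairingDr !addr0. Qed.

Let pairing_sumr n (I : finType) (F : I -> L) :
  pairing n (\sum_i F i) = \sum_i pairing n (F i).
Proof. exact: (big_morph (pairing n) (pairingDr n) (pairing0r n)). Qed.

(** A functional on L is determined by its values on the finitely many v_j pi(al_i), for v a
    spanning family of A and al a dual basis of P1. *)
Lemma translate_findim : findim N.
Proof.
have [pl pD pZ _] := kdP.
have [n [p [al alE]]] := dual_basis pP1 fP1.
have [m [v vP]] := @findim_regular K A.
pose I := ('I_n * 'I_m)%type.
pose psi x : 'rV[K]_#|{: I}| := \row_k
  pairing x ((v (enum_val k).2 : A) *: pi (al (enum_val k).1)).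
apply: (@findim_of_coordinates _ _ N N idfun _ psi) => [x|x y|c x|x /rowP e].
- by exists x.
- by apply/rowP => k; rewrite !mxE pD.
- apply/rowP => k; rewrite !mxE pZ.
  by have := pl x c ((v (enum_val k).2 : A) *: pi (al (enum_val k).1)) 0; rewrite !addr0 pairing0r addr0.
apply: pairing_inj => ga; rewrite pairing0l.
rewrite (@coker_dual_sum ga n (fun i => (ga (p i) : A)) al); last first.
  move=> y; rewrite {1}[y](alE y) linear_sum; apply: eq_bigr => i _.
  by rewrite linearZ.
rewrite pairing_sumr big1 // => i _.
have [c cE] := vP (ga (p i)).
have -> : (ga (p i) : A) *: pi (al i) = \sum_j ((c j)%:A : A) *: ((v j : A) *: pi (al i)).
  rewrite [ga (p i) in LHS]cE scaler_suml; apply: eq_bigr => j _.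
  rewrite scalerA; congr (_ *: _).
  by have e1 (u : A) : u * (c j)%:A = (c j)%:A * u by [rewrite mulr_algl mulr_algr]; exact: e1.
rewrite pairing_sumr big1 // => j _.
have := pl x (c j) ((v j : A) *: pi (al i)) 0; rewrite !addr0 pairing0r addr0 => ->.
have := e (enum_rank (i, j)); rewrite !mxE enum_rankK => ->.
by rewrite mulr0.
Qed.

(** One half of the duality between Hom(X, N) and the cokernel of Hom(d, X). The map h yields the
    functional [Lam] on Hom(P1, X), which vanishes on maps factoring through d, here on all maps;
    the pairing of h x with pi ga is the value of [Lam] at y |-> ga(y) x. *)
Lemma silting_class_translate X (h : {linear X -> N}) :
  silting_class d X -> forall x, h x = 0.
Proof.
move=> DX x; have [spi piP pi0] := cdP; have [pl pD pZ _] := kdP.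
have [n [p [al alE]]] := dual_basis pP1 fP1.
have [m [q [be beE]]] := dual_basis pP0 fP0.
have psum (l : L) k (F : 'I_k -> N) : pairing (\sum_i F i) l = \sum_i pairing (F i) l.
  by rewrite (big_morph (pairing^~ l) (fun n n' => pD n n' l) (pairing0l l)).
have plD u l l' : pairing u (l + l') = pairing u l + pairing u l'.
  by have := pl u 1 l l'; rewrite scale1r scale1r mul1r.
have pl0 u : pairing u 0 = 0.
  by apply: (@addrI _ (pairing u 0)); rewrite -plD !addr0.
have psuml u k (F : 'I_k -> L) : pairing u (\sum_i F i) = \sum_i pairing u (F i).
  by rewrite (big_morph (pairing u) (plD u) (pl0 u)).
have piS := coker_dual_sum.
apply: pairing_inj => ga; rewrite pairing0l.
have [f fE] := ext x ga.
pose Lam (f : {linear P1 -> X}) := \sum_i pairing (h (f (p i))) (pi (al i)).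
have -> : pairing (h x) (pi ga) = Lam f.
  rewrite (piS ga n (fun i => (ga (p i) : A)) al).
    by rewrite psuml; apply: eq_bigr => i _; rewrite fE linearZ pZ.
  move=> y; rewrite {1}[y](alE y) linear_sum; apply: eq_bigr => i _.
  by rewrite linearZ.
have [g gE] := DX f.
rewrite /Lam; under eq_bigr => i _.
  rewrite -gE [d (p i)](beE (d (p i))) linear_sum linear_sum psum.
  over.
rewrite exchange_big /= big1 // => j _.
have [e eE] : exists e : {linear P1 -> regular_rmod A}, forall y, e y = be j (d y).
  by exists (be j \o d).
under eq_bigr => i _ do rewrite !linearZ /= pZ -eE.
rewrite -psuml -(piS e n (fun i => (e (p i) : A)) al).
  by rewrite (_ : pi e = 0) //; apply/pi0; exists (be j) => y; rewrite eE.
move=> y; rewrite {1}[y](alE y) linear_sum; apply: eq_bigr => i _.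
by rewrite linearZ.
Qed.

(** The other half. If f does not factor through d, some functional l on Hom(P1, X) kills all maps
    that do and has l f = 1. The values of l at y |-> al(y) x depend only on x and pi al, and so
    define a linear map X -> N. It is zero by hypothesis; but f is a sum of maps of that form, by
    the dual basis. *)
Lemma translate_silting_class X :
  (forall (h : {linear X -> N}) x, h x = 0) -> silting_class d X.
Proof.
move=> hX f; have [spi piP pi0] := cdP; have [pl pD pZ pU] := kdP.
have [n [p [al alE]]] := dual_basis pP1 fP1.
pose V : rmodType A := {ffun 'I_n -> X}.
pose res (g : {linear P1 -> X}) : V := [ffun i => g (p i)].
pose I (v : V) := exists g : {linear P0 -> X}, res (g \o d) = v.
have kI : ksub I.
  split.
  - have [z zE] := linear_zero P0 X; exists z.
    by apply/ffunP => i; rewrite !ffunE /= zE.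
  - move=> _ _ [g <-] [g' <-]; have [k kE] := linear_add g g'; exists k.
    by apply/ffunP => i; rewrite !ffunE /= kE.
  - move=> c _ [g <-]; have [k kE] := linear_kscale_ex g c; exists k.
    by apply/ffunP => i; rewrite !ffunE /= kE.
apply: contrapT => nex.
have nI : ~ I (res f).
  move=> [g gE]; apply: nex; exists g => x.
  rewrite (alE x) !linear_sum; apply: eq_bigr => i _; rewrite !linearZ.
  by congr (_ *: _); have /ffunP/(_ i) := gE; rewrite !ffunE.
have [l [lD lZ lI lf]] := functional_ex kI nI.
have [xa xaE] := choice (fun u : X * {linear P1 -> regular_rmod A} => ext u.1 u.2).
pose mu x al := l (res (xa (x, al))).
have muI x be be' : pi be = pi be' -> mu x be = mu x be'.
  move=> e; have [ga gaE] := linear_sub be be'.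
  have /pi0[de deE] : pi ga = 0.
    rewrite (piP (-1) be' be ga) ?e ?scaleN1r ?addNr // => y.
    by rewrite gaE mulN1r addrC.
  have [k kE] := ext x de.
  have -> : mu x be = mu x be' + l (res (k \o d)).
    rewrite /mu -lD; congr (l _); apply/ffunP => i; rewrite !ffunE !xaE /= kE deE gaE.
    rewrite -scalerDl; congr (_ *: x); rewrite addrC.
    by have e1 (u v : A) : u = u - v + v by [rewrite subrK]; exact: e1.
  by rewrite (lI (res (k \o d))) ?addr0 //; exists k.
have [s sK] := choice spi.
have nuP x : exists m, forall be, pairing m (pi be) = mu x be.
  have [|m [mE _]] := pU (fun y => mu x (s y)).
    move=> c y y'.
    have [ga gaE] : exists ga : {linear P1 -> regular_rmod A},
        forall z, ga z = (c%:A : A) * (s y z : A) + (s y' z : A).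
      have [k kE] := linear_kscale_ex (s y) c.
      have [g gE] := linear_add k (s y'); exists g => z.
      rewrite gE kE; congr (_ + _).
      by have e1 (u : A) : u * c%:A = c%:A * u by [rewrite mulr_algl mulr_algr]; exact: e1.
    have e : pi ga = pi (s ((c%:A : A) *: y + y')).
      by rewrite (piP _ _ _ _ gaE) !sK.
    rewrite -(muI x _ _ e) /mu -lZ -lD; congr (l _); apply/ffunP => i.
    rewrite !ffunE !xaE /= gaE -[_ *: ((s y (p i) : A^c) *: x)]/(kscale c _) kscaleZ.
    by rewrite /kscale scalerA -scalerDl.
  by exists m => be; rewrite mE; apply: muI; rewrite sK.
have [nu nuE] := choice nuP.
have [h hE] : exists h : {linear X -> N}, h =1 nu.
  apply: linear_of => a x y; apply: pairing_inj => be.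
  rewrite pD pZ !nuE.
  have [z zE] := linear_zero P1 (regular_rmod A).
  have [z' z'E] := linear_zero P0 (regular_rmod A).
  have piz : pi z = 0 by apply/pi0; exists z' => w; rewrite z'E zE.
  have [ga gaE] : exists ga : {linear P1 -> regular_rmod A},
      forall w, ga w = (a : A) * (be w : A).
    apply: linear_of => b u v; rewrite linearP.
    have e1 (a' b' u' v' : A) : a' * (u' * b' + v') = (a' * u') * b' + a' * v'.
      by rewrite mulrDr mulrA.
    exact: e1.
  have -> : (a : A) *: pi be = pi ga.
    rewrite (piP a be z ga) ?piz ?addr0 // => w.
    by rewrite zE gaE; have e1 (u : A) : u = u + 0 by [rewrite addr0]; exact: e1.
  rewrite nuE /mu -lD; congr (l _); apply/ffunP => i.
  by rewrite !ffunE !xaE /= gaE scalerDr scalerA.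
have mu0 x be : mu x be = 0 by rewrite -nuE -hE hX pairing0l.
have l0 : l 0 = 0 by apply: (@addrI _ (l 0)); rewrite -lD !addr0.
have : l (res f) = 0.
  have -> : res f = \sum_j res (xa (f (p j), al j)).
    apply/ffunP => i; rewrite sum_ffunE !ffunE [p i in LHS](alE (p i)) linear_sum.
    by apply: eq_bigr => j _; rewrite linearZ !ffunE xaE.
  by rewrite (big_morph l lD l0) big1 // => j _; exact: mu0.
by rewrite lf => /eqP; rewrite oner_eq0.
Qed.

End Formula.

Lemma rigid_tau_rigid M : rigid M -> tau_rigid M.
Proof.
move=> rM; have [fM _] := rM; split=> //.
have [P1 [P0 [d [e [fP1 fP0 mde]]]]] := minimal_presentation_ex fM.
have [pP1 pP0 _ _] := minimal_presentationP mde.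
have [L [pi cd]] := coker_dual_ex d fP1.
have [N [pairing kd]] := Kdual_ex L.
exists N; first by exists P1, P0, d, e, L, pi, pairing.
move=> f; apply: (silting_class_translate pP1 pP0 fP1 fP0 cd kd).
by apply: (rigid_minimal rM mde); exact: gen_refl.
Qed.

Lemma tau_rigid_rigid M : tau_rigid M -> rigid M.
Proof.
move=> [fM [N [P1 [P0 [d [e [L [pi [pairing [mde cd kd]]]]]]]] hN]]; split=> //.
have [fP1 fP0] := minimal_presentation_findim fM mde.
have [pP1 pP0 _ _] := minimal_presentationP mde.
exists P1, P0, d, e; split; first exact: minimal_presentationP.
exact: (translate_silting_class pP1 fP1 cd kd).
Qed.

End Translate.

(** * Indecomposable modules and the classes they generate *)

Section Indecomposables.
Context {K : fieldType} {A : falgType K}.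
Implicit Types M P Q X Y Z : rmodType A.

Lemma indecomposable_retract X M (i : {linear X -> M}) (r : {linear M -> X}) :
  (forall x, r (i x) = x) -> (exists x : X, x != 0) -> indecomposable M ->
  bijective r.
Proof.
move=> ri [x0 x0n] [_ ind].
have [S [j [ij jE]]] := submodule_ex (submod_ker r).
have [h hE] := linear_pair i j.
have rj s : r (j s) = 0 by apply/jE; exists s.
have bh : bijective h.
  apply: linear_bij.
    apply: linear_inj => -[x s]; rewrite hE /= => e.
    have x0' : x = 0 by rewrite -(ri x) -[r (i x)]addr0 -(rj s) -linearD e linear0.
    have s0 : s = 0 by apply: ij; rewrite linear0 -e x0' linear0 add0r.
    by rewrite x0' s0.
  move=> m; have /jE[s sE] : r (m - i (r m)) = 0 by rewrite linearB /= ri subrr.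
  by exists (r m, s); rewrite hE /= sE addrC subrK.
case: (ind _ _ h bh) => [X0|S0]; first by rewrite (X0 x0) eqxx in x0n.
apply: linear_bij; last by move=> x; exists (i x).
by apply: linear_inj => m /jE[s <-]; rewrite (S0 s) linear0.
Qed.

(** Let I be the set of endomorphisms of M factoring through M'. If one is bijective, M is a retract
    of M', hence isomorphic to it. Otherwise all of them are nilpotent by Fitting's lemma, and I M
    is not M by Nakayama's, whereas mutual generation gives I M = M. *)
Lemma indecomposable_gen_isom M M' : findim M -> indecomposable M ->
  indecomposable M' -> gen M M' -> gen M' M -> isom M M'.
Proof.
move=> fM iM iM' gMM' gM'M.
pose I (r : {linear M -> M}) := exists (f : {linear M' -> M}) (g : {linear M -> M'}),
  forall x, r x = f (g x).
case: (EM (exists2 r, I r & bijective r)) => [[r [f [g rE]] br]|nI].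
  have [s [sK Ks]] := linear_inverse br.
  have bsf : bijective (s \o f).
    apply: (indecomposable_retract (i := g)) => //; last by case: iM.
    by move=> x; rewrite /= -rE sK.
  have [h [hK Kh]] := linear_inverse bsf.
  by exists h; exists (s \o f).
have [x0 x0n] := iM.1.
have [||||x _] := @nakayama _ _ M I (fun=> True) (findim_finlen fM).
- move=> e r u Ir uE.
  have Ier : I (e \o r).
    by have [f [g rE]] := Ir; exists (e \o f), g => y /=; rewrite rE.
  case: (fitting (e \o r) (findim_finlen fM) iM) => [b|[k kE]].
    by case: nI; exists (e \o r).
  apply: finlen_inj_surj; first exact: findim_finlen.
  apply: linear_inj => y; rewrite uE => /eqP; rewrite subr_eq0 => /eqP yE.
  by rewrite -(kE y); elim: k {kE} => // k IH; rewrite iterS -IH.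
- by split.
- by [].
- by exists x0 => //; apply/eqP.
case=> N [N0 ND NZ] HN.
(* N is only a K-subspace; the induction on traces needs the largest submodule inside its
   preimage. *)
have sub (Y : rmodType A) (f : {linear Y -> M}) :
    submod (fun y => forall a : A^c, N (f (a *: y))).
  split=> [a|a y z Hy Hz c]; first by rewrite scaler0 linear0.
  by rewrite scalerDr linearD scalerA; apply: ND.
suff H : forall a : A^c, N (a *: x) by rewrite -[x]scale1r.
apply: (gM'M x _ (sub M idfun)) => f m'.
suff H : forall a : A^c, N (f (a *: m')) by move=> a; rewrite /= -linearZ.
apply: (gMM' m' _ (sub M' f)) => g m c.
rewrite -linearZ; apply: (HN (f \o g) (c *: m)) => //.
by exists f, g.
Qed.

(** This takes the place of a decomposition into indecomposables: a minimal direct summand not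
    contained in N is indecomposable, because its proper summands lie in N. *)
Lemma indecomposable_retracts_span M (N : M -> Prop) : findim M -> submod N ->
  (forall X (i : {linear X -> M}) (r : {linear M -> X}), (forall x, r (i x) = x) ->
    indecomposable X -> forall x, N (i x)) -> forall m, N m.
Proof.
move=> fM sN H m0; apply: contrapT => nNm0.
pose P (U : M -> Prop) := (exists X (i : {linear X -> M}) (r : {linear M -> X}),
  (forall x, r (i x) = x) /\ forall x, U x <-> exists y, i y = x) /\
  exists2 x, U x & ~ N x.
have [||U [[[X [i [r [ri iE]]]] [x0 Ux0 nNx0]] mU]] := @min_submod _ _ M P (fun=> True)
  (findim_finlen fM).
- move=> U [[X [i [r [_ iE]]]] _]; apply: submod_ksub.
  have -> : U = fun x => exists y, i y = x by apply/predeqP.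
  exact: submod_range.
- split; last by exists m0.
  by exists M, idfun, idfun; split=> // x; split=> // _; exists x.
have part Y (j : {linear Y -> X}) (s : {linear X -> Y}) :
    (forall y, s (j y) = y) -> (exists x, ~ exists y, j y = x) ->
    forall y, N (i (j y)).
  move=> sj [x nx] y; apply: contrapT => nN; apply: nx.
  have [|||z zE] := mU (fun m => exists y, i (j y) = m) _ _ (i x).
  - split; last by exists (i (j y)) => //; exists y.
    by exists Y, (i \o j), (s \o r); split=> // z; rewrite /= ri.
  - by move=> _ [z <-]; apply/iE; exists (j z).
  - by apply/iE; exists x.
  - by exists z; rewrite -(ri (j z)) zE ri.
have /iE[z0 z0E] := Ux0.
have indX : indecomposable X.
  split.
    exists z0; apply/eqP => z00; apply: nNx0; rewrite -z0E z00 linear0.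
    by case: sN.
  move=> Y Z h bh; apply: contrapT => /not_orP[nY nZ].
  have [y0 y0n] : exists y : Y, y <> 0.
    by apply: contrapT => ny; apply: nY => y; apply: contrapT => yn; apply: ny; exists y.
  have [w0 w0n] : exists z : Z, z <> 0.
    by apply: contrapT => ny; apply: nZ => y; apply: contrapT => yn; apply: ny; exists y.
  have [k [kK Kk]] := linear_inverse bh.
  have [f fE] := linear_fst Y Z; have [g gE] := linear_snd Y Z.
  have [a aE] := linear_inl Y Z; have [c cE] := linear_inr Y Z.
  have NY : forall y, N (i ((h \o a) y)).
    apply: (part Y (h \o a) (f \o k)) => [y|].
      by rewrite /= kK fE aE.
    exists (h (0, w0)) => -[y]; rewrite /= aE => /(can_inj kK)[_ /esym].
    exact: w0n.
  have NZ : forall y, N (i ((h \o c) y)).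
    apply: (part Z (h \o c) (g \o k)) => [y|].
      by rewrite /= kK gE cE.
    exists (h (y0, 0)) => -[y]; rewrite /= cE => /(can_inj kK)[/esym].
    by move=> /y0n.
  apply: nNx0; rewrite -z0E -(Kk z0).
  have -> : k z0 = a (k z0).1 + c (k z0).2.
    by rewrite aE cE; case: (k z0) => u v; congr (_, _); rewrite /= ?addr0 ?add0r.
  by rewrite !linearD; apply: (submodD sN); [exact: NY|exact: NZ].
by apply: nNx0; rewrite -z0E; exact: H ri indX _.
Qed.

(** Modules are counted up to equality of the classes they generate; the representatives G i may lie
    outside C, which makes the notion inherited by smaller C. *)
Definition finite_upto (C : rmodType A -> Prop) : Prop :=
  exists (I : finType) (G : I -> rmodType A),
    forall M, C M -> exists i, forall X, gen (G i) X <-> gen M X.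

(** Indecomposable summands of a rigid module N are rigid, hence listed, so Gen(N) is determined by
    the set [J N] of listed modules that are summands of N. *)
Lemma finite_upto_rigid : tau_tilting_finite A -> finite_upto rigid.
Proof.
move=> [n [M MP]].
pose J (N : rmodType A) : {set 'I_n} := [set i | `[< exists (u : {linear M i -> N})
  (v : {linear N -> M i}), forall x, v (u x) = x >]].
have genJ (N N' : rmodType A) : rigid N -> J N = J N' -> gen N' N.
  move=> rN eJ x; have [fN _] := rN.
  apply: (indecomposable_retracts_span fN (trace_submod N' N)) => X i r ri indX y.
  have [j [h bh]] := MP X (rigid_tau_rigid (rigid_retract ri rN)) indX.
  have [k [hK Kh]] := linear_inverse bh.
  have : j \in J N.
    rewrite inE; apply/asboolP; exists (i \o h), (k \o r) => z.
    by rewrite /= ri hK.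
  rewrite eJ inE => /asboolP[u [v vu]].
  have -> : i y = ((i \o h) \o v) (u (k y)) by rewrite /= vu Kh.
  exact: trace_image.
have GS (S : {set 'I_n}) : exists G, (exists2 N, rigid N & J N = S) ->
    rigid G /\ J G = S.
  case: (EM (exists2 N, rigid N & J N = S)) => [[N rN JN]|nN]; first by exists N.
  by exists (regular_rmod A) => H; case: nN.
have [G GP] := choice GS.
exists {set 'I_n}, G => N rN; exists (J N) => X.
have [rG JG] := GP (J N) (ex_intro2 _ _ N rN erefl).
by split; apply: gen_trans; apply: genJ.
Qed.

(** Each of the finitely many classes is generated by at most one indecomposable rigid module up to
    isomorphism. Indices without one receive A as a default. *)
Lemma tau_tilting_finite_upto : finite_upto rigid -> tau_tilting_finite A.
Proof.
move=> [I [G GP]].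
have HS i : exists H, (exists M, [/\ rigid M, indecomposable M
      & forall X, gen (G i) X <-> gen M X]) ->
    [/\ rigid H, indecomposable H & forall X, gen (G i) X <-> gen H X].
  case: (EM (exists M, [/\ rigid M, indecomposable M
      & forall X, gen (G i) X <-> gen M X])) => [[M HM]|nM]; first by exists M.
  by exists (regular_rmod A) => HM; case: nM.
have [H HP] := choice HS.
exists #|I|, (fun k => H (enum_val k)) => N tN iN.
have rN := tau_rigid_rigid tN.
have [i iE] := GP N rN.
have [|[fH _] iH HE] := HP i; first by exists N.
exists (enum_rank i); rewrite enum_rankK.
apply: indecomposable_gen_isom => //.
  by apply/HE/iE; exact: gen_refl.
by apply/iE/HE; exact: gen_refl.
Qed.

End Indecomposables.

(** * Silting modules *)

Section Silting.
Context {K : fieldType} {A : falgType K}.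
Implicit Types M P Q X Y Z : rmodType A.

Lemma silting_torsion M : silting M -> torsion_class (gen M).
Proof.
move=> [P [Q [sigma [p [pP pQ ex sp DE]]]]].
have D X : silting_class sigma X <-> gen M X by rewrite DE GenE.
split=> [I X S iota cop gX|X Y u|X Y Z i u ii ex' su gX gZ].
- exact: gen_coproduct cop gX.
- exact: gen_quot.
- by apply/D; apply: (silting_class_ext pQ ii ex' su); apply/D.
Qed.

Lemma silting_rigid M : findim M -> silting M -> rigid M.
Proof.
move=> fM [P [Q [sigma [p [pP pQ ex sp DE]]]]]; split=> //.
exists P, Q, sigma, p; split; first by [].
by apply/DE/GenE; exact: gen_refl.
Qed.

Section Completion.
Context (M P Q : rmodType A) (sigma : {linear P -> Q}) (q : {linear Q -> M}) (t : M).
Hypothesis pres : presentation sigma q.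
Hypothesis MD : forall X, gen M X -> silting_class sigma X.
Hypothesis app : forall X (x : X), gen M X -> exists h : {linear M -> X}, h t = x.

(* The mapping cone of a lift of A -> M to a morphism from A to sigma. *)
Lemma cone_ex : exists (rho : {linear (regular_rmod A * P)%type -> Q}) (M1 : rmodType A)
    (q1 : {linear Q -> M1}) (pi : {linear M -> M1}),
  [/\ presentation rho q1, surj pi & forall X, gen M X <-> silting_class rho X].
Proof.
have [pP pQ ex sq] := pres; have [t' t'E] := sq t.
have [h hE] := regular_hom t'.
have [rho rhoE] := linear_pair h sigma.
have qs y : q (sigma y) = 0 by apply/ex; exists y.
have [M1 [pi [spi piE]]] := quotient_ex (submod_range (q \o h)).
exists rho, M1, (pi \o q), pi; split=> //.
  split=> //; first by apply: projective_pair => //; exact: projective_regular.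
    move=> y; split=> [/piE[a /= aE]|[[a x] <-]].
      have /ex[x xE] : q (y - h a) = 0 by rewrite linearB /= aE subrr.
      by exists (a, x); rewrite rhoE /= xE addrC subrK.
    rewrite /= rhoE /= linearD /= qs addr0; apply/piE.
    by exists a.
  by move=> m; have [x <-] := spi m; have [y <-] := sq x; exists y.
(* Given c on A + P, its second component is extended through sigma, and the value at 1 is then
   corrected by a map factoring through M, which does not disturb sigma. Conversely, extending the
   map (a, z) |-> x a yields a map that kills sigma, so a map M -> X with t sent to x. *)
move=> X; split=> [gX c|DX x].
  have [l lE] := linear_inl (regular_rmod A) P.
  have [r rE] := linear_inr (regular_rmod A) P.
  have [g gE] := MD gX (c \o r).
  have [k kE] := app (c ((1 : A), 0) - g t') gX.
  have [m mE] := linear_add g (k \o q); exists m => -[a x].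
  have -> : c (a, x) = (a : A^c) *: c ((1 : A), 0) + c (0, x).
    rewrite -linearZ -linearD; congr (c _).
    have e (u : A) : u = 1 * u + 0 by rewrite mul1r addr0.
    by congr (_, _); rewrite /= ?scaler0 ?add0r //; exact: e.
  rewrite mE rhoE /= !linearD /= qs linear0 addr0 gE /= rE hE !linearZ /= t'E kE.
  by rewrite scalerBr addrAC addrCA subrr addr0.
have [c cE] := linear_fst (regular_rmod A) P.
have [k kE] := regular_hom x.
have [g gE] := DX (k \o c).
have [f fE] := @factor_surj _ _ _ _ q g sq ltac:(
  move=> y /ex[z <-]; have := gE (0, z); rewrite rhoE /= cE /= !linear0 add0r; exact).
have -> : x = f t.
  have := gE ((1 : A), 0); rewrite rhoE /= cE /= linear0 addr0 !hE !kE.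
  have e (V : rmodType A) (v : V) : ((1 : A) : A^c) *: v = v by exact: scale1r.
  by rewrite !e -t'E fE => <-.
exact: trace_image.
Qed.

(** M' = M + M1 is presented by the sum of sigma and rho. M1 is a quotient of M, so Gen is
    unchanged, and the class of the sum is the intersection of both classes, which is that of
    rho. *)
Lemma completion_ex : exists M' : rmodType A,
  [/\ silting M', findim M -> findim M' & forall X, gen M' X <-> gen M X].
Proof.
have [pP pQ ex sq] := pres.
have [rho [M1 [q1 [pi [[pP1 _ ex1 sq1] spi rhoE]]]]] := cone_ex.
have [f fE] := linear_fst M M1; have [g gE] := linear_snd M M1.
have [i iE] := linear_inl M M1; have [j jE] := linear_inr M M1.
pose P' : rmodType A := (P * (regular_rmod A * P))%type.
have genE X : gen (M * M1)%type X <-> gen M X.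
  split; apply: gen_trans.
    move=> [m m1]; have -> : (m, m1) = i m + j m1.
      by rewrite iE jE; congr (_, _); rewrite /= ?addr0 ?add0r.
    apply: (submodD (trace_submod _ _)); first exact: trace_image.
    by have [x <-] := spi m1; exact: (trace_image (j \o pi)).
  by move=> m; rewrite (_ : m = f (i m)); [exact: trace_image|rewrite iE fE].
exists (M * M1)%type; split=> //; last first.
  by move=> fM; apply: findim_pair => //; exact: findim_quot spi fM.
have [s sE] := @linear_of _ P' (Q * Q)%type (fun x => (sigma x.1, rho x.2)) ltac:(
  by move=> a x y; rewrite /= !linearP).
have [p pE] := @linear_of _ (Q * Q)%type (M * M1)%type (fun x => (q x.1, q1 x.2)) ltac:(
  by move=> a x y; rewrite /= !linearP).
exists P', (Q * Q)%type, s, p; split.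
- exact: projective_pair.
- exact: projective_pair.
- move=> [y z]; split=> [|[[x w] <-]].
    rewrite pE /= => -[/ex[x xE] /ex1[w wE]]; exists (x, w).
    by rewrite sE /= xE wE.
  rewrite sE pE /=; congr (_, _); [apply/ex; by exists x|apply/ex1; by exists w].
- move=> [m m1]; have [y yE] := sq m; have [z zE] := sq1 m1.
  by exists (y, z); rewrite pE /= yE zE.
move=> X; rewrite GenE genE; split=> [DX|gX c].
  apply/rhoE => c.
  have [k kE] := linear_snd P (regular_rmod A * P)%type.
  have [h hE] := DX (c \o k).
  have [l lE] := linear_inr Q Q; exists (h \o l) => x.
  by have := hE (0, x); rewrite sE /= linear0 lE kE.
have [a aE] := linear_inl P (regular_rmod A * P)%type.
have [b bE] := linear_inr P (regular_rmod A * P)%type.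
have [h hE] := MD gX (c \o a).
have [k kE] := (rhoE X).1 gX (c \o b).
have [l lE] := linear_pair h k; exists l => -[x y].
rewrite sE lE /= hE kE /= aE bE -linearD; congr (c _).
by congr (_, _); rewrite /= ?addr0 ?add0r.
Qed.

End Completion.

(** Applied to the minimal approximation T0 instead of M, since only T0 carries an element t that
    can be sent anywhere. Finite dimensional P and Q make T accessible both to linear systems and to
    the translate. *)
Lemma ftors_cone (T : rmodType A -> Prop) M : torsion_class T ->
  (forall X, T X <-> gen M X) -> findim M ->
  exists (P Q : rmodType A) (rho : {linear P -> Q}),
    [/\ projective P, projective Q, findim P, findim Q
      & forall X, T X <-> silting_class rho X].
Proof.
move=> torT TE fM; have [T0 [t appT]] := min_approx_ex torT TE fM.
have [fT0 TT0 app minT] := appT.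
have gT0 X : T X <-> gen T0 X.
  by split; [exact: approx_gen appT X|exact: tors_gen].
have [P1 [P0 [d [e [fP1 fP0 mde]]]]] := minimal_presentation_ex fT0.
have TQ X Y (p : {linear X -> Y}) : surj p -> T X -> T Y by exact: tors_quot.
have TD X : gen T0 X -> silting_class d X.
  move=> /gT0; apply: (relproj_silting_class TQ mde).
  exact: approx_relproj0 torT appT.
have [rho [M1 [q1 [pi [[pP1 pP0 _ _] _ rhoE]]]]] := cone_ex
  (minimal_presentationP mde) TD (fun X x gX => app X x ((gT0 X).2 gX)).
exists (regular_rmod A * P1)%type, P0, rho; split=> //.
  by apply: findim_pair => //; exact: findim_regular.
by move=> X; rewrite gT0 rhoE.
Qed.

Lemma ftors_silting (T : rmodType A -> Prop) M : torsion_class T ->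
  (forall X, T X <-> gen M X) -> findim M ->
  exists M' : rmodType A, [/\ findim M', silting M' & forall X, T X <-> Gen M' X].
Proof.
move=> torT TE fM; have [T0 [t appT]] := min_approx_ex torT TE fM.
have [fT0 TT0 app minT] := appT.
have gT0 X : T X <-> gen T0 X.
  by split; [exact: approx_gen appT X|exact: tors_gen].
have [P1 [P0 [d [e [fP1 fP0 mde]]]]] := minimal_presentation_ex fT0.
have TQ X Y (p : {linear X -> Y}) : surj p -> T X -> T Y by exact: tors_quot.
have TD X : gen T0 X -> silting_class d X.
  move=> /gT0; apply: (relproj_silting_class TQ mde).
  exact: approx_relproj0 torT appT.
have [M' [sM' fM' gM']] := completion_ex
  (minimal_presentationP mde) TD (fun X x gX => app X x ((gT0 X).2 gX)).
by exists M'; split=> //; [exact: fM'|move=> X; rewrite GenE gM'].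
Qed.

End Silting.

Lemma projective_coproduct (R : pzRingType) I (P : I -> lmodType R) (S : lmodType R)
    (iota : forall i, {linear P i -> S}) :
  is_coproduct iota -> (forall i, projective (P i)) -> projective S.
Proof.
move=> cop pP X Y p f sp.
have [g gE] : exists g : forall i, {linear P i -> X}, forall i x, p (g i x) = f (iota i x).
  have H i : exists g : {linear P i -> X}, forall x, p (g x) = f (iota i x).
    exact: (pP i _ _ p (f \o iota i) sp).
  by exists (fun i => sval (cid (H i))) => i x; exact: svalP (cid (H i)) x.
have [[h hE] _] := cop X g; exists h.
have [_ U] := cop Y (fun i => f \o iota i).
by apply: (U (p \o h) f) => i x; rewrite /= hE gE.
Qed.

(** * Linear systems over A and their formal solutions *)

Section System.
Context {K : fieldType} {A : falgType K}.
Implicit Types M P Q X Y Z : rmodType A.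

Definition solvable_in (J : finType) m (a : J -> 'I_m -> A) X : Prop :=
  forall y : 'I_m -> X, exists x : J -> X,
    forall l, \sum_k (a k l : A^c) *: x k = y l.

Lemma free_hom n X (y : 'I_n -> X) :
  exists h : {linear ({ffun 'I_n -> regular_rmod A} : rmodType A) -> X},
    forall x, h x = \sum_i (x i : A^c) *: y i.
Proof.
apply: linear_of => a x z; rewrite scaler_sumr -big_split /=; apply: eq_bigr => i _.
by rewrite !ffunE scalerA -scalerDl.
Qed.

(** P is the image of an idempotent matrix on A^m, with entries al_k(p_l). The unknowns [inl k]
    stand for values on the generators of Q; the unknowns [inr k], with the complementary idempotent
    as coefficients, absorb the part of a right-hand side that does not come from a map P -> X. *)
Lemma silting_class_solvable P Q (sigma : {linear P -> Q}) :
  projective P -> projective Q -> findim P -> findim Q ->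
  exists (J : finType) m (a : J -> 'I_m -> A),
    forall X, silting_class sigma X <-> solvable_in a X.
Proof.
move=> pP pQ fP fQ.
have [m [p [al alE]]] := dual_basis pP fP.
have [n [q [be beE]]] := dual_basis pQ fQ.
exists ('I_n + 'I_m)%type, m, (fun k l => match k with
  | inl k => (be k (sigma (p l)) : A)
  | inr k => ((l == k)%:R - (al k (p l) : A)) end) => X.
have sumE (x : 'I_n + 'I_m -> X) l : \sum_k ((match k with
  | inl k => (be k (sigma (p l)) : A)
  | inr k => ((l == k)%:R - (al k (p l) : A)) end) : A^c) *: x k =
  \sum_k (be k (sigma (p l)) : A^c) *: x (inl k) +
  (x (inr l) - \sum_k (al k (p l) : A^c) *: x (inr k)).
  rewrite big_sumType /=; congr (_ + _).
  under eq_bigr => k _.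
    have e (u v : A) (w : X) : ((u - v : A) : A^c) *: w = (u : A^c) *: w - (v : A^c) *: w.
      exact: scalerBl.
    rewrite e; over.
  rewrite sumrB; congr (_ - _).
  rewrite (bigD1 l) //= eqxx big1 ?addr0 => [|k ne].
    exact: scale1r.
  by rewrite eq_sym (negPf ne); exact: scale0r.
split=> [DX y|SX f].
  have [f fE] : exists f : {linear P -> X}, forall z, f z = \sum_k (al k z : A^c) *: y k.
    apply: linear_of => a z w; rewrite scaler_sumr -big_split /=; apply: eq_bigr => k _.
    rewrite linearP scalerA.
    have e (u v : regular_rmod A) : (a *: u + v : regular_rmod A) = (a * (u : A^c) + (v : A^c) : A^c) by [].
    by rewrite e scalerDl.
  have [g gE] := DX f.
  exists (fun k => match k with inl k => g (q k) | inr k => y k end) => l.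
  rewrite sumE -(fE (p l)) addrC -[RHS](subrK (f (p l))); congr (_ + _).
  rewrite -gE [in RHS](beE (sigma (p l))) linear_sum.
  by apply: eq_bigr => k _; rewrite linearZ.
have [x xE] := SX (fun l => f (p l)).
have [g gE] : exists g : {linear Q -> X}, forall z, g z = \sum_k (be k z : A^c) *: x (inl k).
  apply: linear_of => a z w; rewrite scaler_sumr -big_split /=; apply: eq_bigr => k _.
  rewrite linearP scalerA.
  have e (u v : regular_rmod A) : (a *: u + v : regular_rmod A) = (a * (u : A^c) + (v : A^c) : A^c) by [].
  by rewrite e scalerDl.
exists g => z.
have H l : g (sigma (p l)) + (x (inr l) - \sum_k (al k (p l) : A^c) *: x (inr k)) = f (p l).
  by rewrite -xE sumE gE.
rewrite {1}(alE z) [in RHS](alE z) !linear_sum.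
under eq_bigr => i _ do rewrite !linearZ.
under [RHS]eq_bigr => i _ do rewrite linearZ /= -H scalerDr scalerBr.
(* What the unknowns [inr k] contribute cancels: the row of the al_l(z) is fixed by the idempotent
   matrix. *)
rewrite big_split /= -[LHS]addr0; congr (_ + _).
rewrite sumrB; apply/esym/eqP; rewrite subr_eq0; apply/eqP.
under [RHS]eq_bigr => i _ do rewrite scaler_sumr.
rewrite exchange_big /=; apply: eq_bigr => k _.
under eq_bigr => i _ do rewrite scalerA.
rewrite -scaler_suml; congr (_ *: _).
rewrite {1}(alE z) linear_sum; apply: eq_bigr => i _; rewrite linearZ.
by [].
Qed.

Section Skolem.
Context (J : Type) (kt : J -> finType) (m : J -> nat).
Context (a : forall j, kt j -> 'I_(m j) -> A).

(* Names for the generators of a module in which all the systems are solvable: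
   tsk j k ys is the k-th component of a solution of the j-th system with
   right-hand side ys, a sequence of formal linear combinations of names. *)
Inductive skolem : Type :=
| tone : skolem
| tsk : forall j, kt j -> seq (seq (A * skolem)) -> skolem.

Section Evaluation.
Context (X : rmodType A) (x0 : X) (f : forall j, 'I_(m j) -> seq (seq (A * skolem)) -> X).
Context (sol : forall j, ('I_(m j) -> X) -> kt j -> X).

(** The values satisfy the relations up to the prescribed error f. Taking for f the values of an
    arbitrary map P -> X gives its extension along sigma; f = 0 gives a map out of M sending the
    class of [tone] to x0. *)
Fixpoint skolem_eval (s : skolem) : X :=
  match s with
  | tone => x0
  | tsk j k ys =>
    let vs := map (foldr (fun as_ v => (as_.1 : A^c) *: skolem_eval as_.2 + v) 0) ys in
    sol (fun l => f l ys + nth 0 vs l) k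
  end.

End Evaluation.

Lemma skolem_module : exists (M P Q : rmodType A) (sigma : {linear P -> Q})
    (q : {linear Q -> M}) (t : M),
  [/\ presentation sigma q, forall j, solvable_in (@a j) M &
    forall X, (forall j, solvable_in (@a j) X) -> silting_class sigma X /\
      forall x : X, exists h : {linear M -> X}, h t = x].
Proof.
have [Q [iota copQ]] := coproduct_ex (fun _ : skolem => regular_rmod A : rmodType A).
pose e s : Q := iota s (1 : A).
pose val (l : seq (A * skolem)) : Q := \sum_(b <- l) (b.1 : A^c) *: e b.2.
pose I := ({j : J & 'I_(m j)} * seq (seq (A * skolem)))%type.
have [P [kappa copP]] := coproduct_ex (fun _ : I => regular_rmod A : rmodType A).
(* The l-th equation of system j with right-hand side ys. Entries missing from ys default to [[::]],
   the zero combination, which makes relations available for sequences of every length. *)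
pose rel (i : I) : Q := \sum_k (a k (tagged i.1) : A^c) *: e (tsk k i.2) -
  val (nth [::] i.2 (tagged i.1)).
have [sigma sigmaE] : exists sigma : {linear P -> Q}, forall i, sigma (kappa i (1 : A)) = rel i.
  have H i := regular_hom (rel i).
  have [[s sE] _] := copP Q (fun i => sval (cid (H i))).
  exists s => i; rewrite sE (svalP (cid (H i))); exact: scale1r.
have [M [q [sq qE]]] := quotient_ex (submod_range sigma).
have ex : exact sigma q by move=> y; exact: qE.
have valP (y : Q) : exists l, val l = y.
  move: y; apply: (coproduct_span copQ).
    split; first by exists [::]; rewrite /val big_nil.
    move=> b _ _ [l <-] [l' <-]; exists (map (fun c : A * skolem => (c.1 * (b : A), c.2)) l ++ l').
    rewrite /val big_cat /= big_map scaler_sumr; congr (_ + _).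
    by apply: eq_bigr => i _; rewrite scalerA.
  move=> s b; exists [:: ((b : A), s)].
  by rewrite /val big_seq1 (regular_homE (iota s)).
exists M, P, Q, sigma, q, (q (e tone)); split.
- split=> //.
    by apply: (projective_coproduct copP) => i; exact: projective_regular.
  by apply: (projective_coproduct copQ) => i; exact: projective_regular.
- move=> j y; have H l : exists c, q (val c) = y l.
    by have [z <-] := sq (y l); have [c <-] := valP z; exists c.
  have [c cE] := choice H.
  pose ys := [seq c l | l <- enum 'I_(m j)].
  exists (fun k => q (e (tsk k ys))) => l.
  have : q (rel (existT _ j l, ys)) = 0.
    by apply/ex; eexists; exact: sigmaE.
  rewrite /rel /= linearB /= linear_sum => /eqP; rewrite subr_eq0 => /eqP rel0.
  transitivity (\sum_k q ((a k l : A^c) *: e (tsk k ys))).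
    by apply: eq_bigr => k _; rewrite linearZ.
  rewrite rel0 (nth_map l) ?size_enum_ord // nth_ord_enum.
  exact: cE.
move=> X SX.
have [sol solE] : exists sol : forall j, ('I_(m j) -> X) -> kt j -> X,
    forall j y l, \sum_k (a k l : A^c) *: sol j y k = y l.
  exists (fun j y => sval (cid (SX j y))) => j y l.
  exact: svalP (cid (SX j y)) l.
have key (f : {linear P -> X}) (x : X) : exists g : {linear Q -> X},
    (forall y, g (sigma y) = f y) /\ g (e tone) = x.
  pose ff j (l : 'I_(m j)) ys := f (kappa (existT _ j l, ys) (1 : A)).
  pose h := skolem_eval x ff sol.
  have H s := regular_hom (h s).
  have [[g gE] _] := copQ X (fun s => sval (cid (H s))).
  have geE s : g (e s) = h s.
    by rewrite gE (svalP (cid (H s))); exact: scale1r.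
  exists g; split; last by rewrite geE.
  have [_ U] := copP X (fun i => f \o kappa i).
  apply: (U (g \o sigma) f) => i b.
  rewrite /= (regular_homE (kappa i)) !linearZ /=; congr (_ *: _).
  rewrite sigmaE /rel linearB /= linear_sum.
  under eq_bigr => k _ do rewrite linearZ /= geE.
  case: i => [[j l] ys] /=.
  rewrite solE /ff; apply/eqP; rewrite subr_eq; apply/eqP; congr (_ + _).
  have gval r : g (val r) = foldr (fun as_ v => (as_.1 : A^c) *: h as_.2 + v) 0 r.
    rewrite /val linear_sum; elim: r => [|c r IH]; first by rewrite big_nil.
    by rewrite big_cons IH /= linearZ /= geE.
  rewrite gval; case: (ltnP l (size ys)) => lt; first by rewrite (nth_map [::]).
  by rewrite !nth_default ?size_map.
split=> [f|x].
  by have [g [gE _]] := key f 0; exists g.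
have [z zE] := linear_zero P X.
have [g [gE gx]] := key z x.
have [h hE] := @factor_surj _ _ _ _ q g sq ltac:(
  by move=> y /ex[w <-]; rewrite gE zE).
by exists h; rewrite hE.
Qed.

End Skolem.
End System.

(** * Chains of classes Gen(M) and finiteness *)

Section Finiteness.
Context {K : fieldType} {A : falgType K}.
Implicit Types M P Q X Y Z : rmodType A.

Lemma large_silting_ex (J : Type) (G : J -> rmodType A) : (forall j, rigid (G j)) ->
  exists M : rmodType A, silting M /\ forall X, gen M X <-> forall j, gen (G j) X.
Proof.
move=> rG.
have H j : exists s : {kt : finType & {m : nat & kt -> 'I_m -> A}},
    forall X, gen (G j) X <-> solvable_in (tagged (tagged s)) X.
  have [fG _] := rG j.
  have [|P [Q [rho [pP pQ fP fQ rhoE]]]] :=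
    @ftors_cone _ _ (gen (G j)) (G j) (rigid_torsion (rG j)) _ fG; first by [].
  have [kt [m [a aE]]] := silting_class_solvable rho pP pQ fP fQ.
  exists (Tagged (fun kt : finType => {m : nat & kt -> 'I_m -> A})
    (Tagged (fun m => kt -> 'I_m -> A) a)) => X.
  by rewrite rhoE aE.
have [s sE] := choice H.
have [M [P [Q [sigma [q [t [pres SM SX]]]]]]] := @skolem_module K A J
  (fun j => tag (s j)) (fun j => tag (tagged (s j))) (fun j => tagged (tagged (s j))).
have genM j : gen (G j) M by apply/sE; exact: SM.
have gM X : gen M X <-> forall j, gen (G j) X.
  split=> [gX j|gX x]; first exact: gen_trans (genM j) gX.
  have [|_ /(_ x)[h <-]] := SX X; last exact: trace_image.
  by move=> j; apply/sE.
have SX' X : gen M X -> silting_class sigma X /\ forall x : X, exists h : {linear M -> X}, h t = x.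
  by move=> /gM gX; apply: SX => j; apply/sE.
have [M' [sM' _ gM']] := completion_ex pres (fun X gX => (SX' X gX).1)
  (fun X x gX => (SX' X gX).2 x).
by exists M'; split=> // X; rewrite gM' gM.
Qed.

(* Write gen M as the class of the modules with no map to N. The traces of the
   G k in N stabilise at a submodule lying in every gen (G k), hence zero. *)
Lemma descending_compact (G : nat -> rmodType A) M :
  (forall k, findim (G k)) -> (forall k X, gen (G k.+1) X -> gen (G k) X) ->
  rigid M -> (forall X, gen M X <-> forall k, gen (G k) X) ->
  exists k, forall X, gen (G k) X -> gen M X.
Proof.
move=> fG desc rM gM; have [fM _] := rM.
have [|P [Q [rho [pP pQ fP fQ rhoE]]]] :=
  @ftors_cone _ _ (gen M) M (rigid_torsion rM) _ fM; first by [].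
have [L [pi cd]] := coker_dual_ex rho fP.
have [N [pairing kd]] := Kdual_ex L.
have fN := translate_findim pP fP cd kd.
have decr k l X : (k <= l)%N -> gen (G l) X -> gen (G k) X.
  by move=> /subnK <-; elim: (l - k)%N => // n IH /desc.
have [||U [[k ->] mU]] := @min_submod _ _ N (fun U => exists k, U = @trace _ (G k) N)
  (@trace _ (G 0) N) (findim_finlen fN).
- by move=> U [k ->]; apply: submod_ksub; exact: trace_submod.
- by exists 0%N.
exists k.
have tr_sub j (x : N) : trace (G k) x -> trace (G j) x.
  move=> tx; case: (leqP j k) => [jk|/ltnW kj].
    by apply: trace_trans tx; apply: decr jk _; exact: gen_refl.
  apply: (mU (@trace _ (G j) N)) => [|y ty|//]; first by exists j.
  by apply: trace_trans ty; apply: decr kj _; exact: gen_refl.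
have [S [i [ii iE gS]]] := trace_smod (G k) N.
(* For j beyond k the traces of G j and G k in N coincide; for smaller j the class Gen(G j) contains
   Gen(G k). *)
have gjS j : gen (G j) S.
  have [S' [i' [ii' i'E gS']]] := trace_smod (G j) N.
  have : smod (gen (G j)) (fun x : N => trace (G k) x).
    case: (leqP j k) => [jk|/ltnW kj].
      by exists S, i; split=> //; exact: decr gS.
    have -> : (fun x : N => trace (G k) x) = @trace _ (G j) N.
      apply/funext => x; apply/propext; split; first exact: tr_sub.
      by apply: trace_trans; apply: decr kj _; exact: gen_refl.
    by exists S', i'.
  by apply: smodP iE => // ? ? ?; exact: gen_quot.
have i0 := silting_class_translate pP pQ fP fQ cd kd i ((rhoE S).1 ((gM S).2 gjS)).
have GD : silting_class rho (G k).
  apply: (translate_silting_class pP fP cd kd) => h x.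
  have /iE[s <-] : trace (G k) (h x) by exact: trace_image.
  exact: i0.
by move=> X; apply: gen_trans; apply/rhoE.
Qed.

Lemma gen_regular X : gen (regular_rmod A) X.
Proof.
move=> x; have [h hE] := regular_hom x.
rewrite (_ : x = h (1 : A)); first exact: trace_image.
by rewrite hE; apply/esym; exact: scale1r.
Qed.

Lemma rigid_regular : rigid (regular_rmod A).
Proof.
apply: (@relproj_rigid _ _ (fun=> True)) => //; first exact: findim_regular.
by move=> Y N p u sp _; exact: projective_regular.
Qed.

(** Among the rigid M with T inside Gen(M), take one with the fewest listed classes below Gen(M). If
    T were strictly smaller, one of the maximal subclasses of Gen(M) would contain T and have
    fewer. *)
Lemma finite_torsion_ftors (T : rmodType A -> Prop) : finite_upto (@rigid K A) ->
  torsion_class T -> exists2 M, rigid M & forall X, T X <-> gen M X.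
Proof.
move=> [I [G GP]] torT.
pose below M : {set I} := [set i | `[< forall X, gen (G i) X -> gen M X >]].
have ex : exists n, `[< exists M, [/\ rigid M, forall X, T X -> gen M X & #|below M| = n] >].
  exists #|below (regular_rmod A)|; apply/asboolP; exists (regular_rmod A); split=> //.
    exact: rigid_regular.
  by move=> X _; exact: gen_regular.
case: (ex_minnP ex) => n /asboolP[M [rM TM <-]] nmin.
exists M => // X; split; first exact: TM.
move=> gX; apply: contrapT => nTX; have [fM _] := rM.
have [k [C [CP Cmax]]] := @maximal_torsion_subclasses _ _ (gen M) M
  (rigid_torsion rM) (fun X => iff_refl _) fM.
have [|i iT] := Cmax T torT TM; first by exists X.
have [rC CM [Y gY nY]] := CP i.
have : (#|below (C i)| < #|below M|)%N.
  apply: proper_card; apply/properP; split.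
    apply/subsetP => j; rewrite !inE => /asboolP H; apply/asboolP => Z /H; exact: CM.
  have [j jE] := GP M rM; exists j; rewrite inE; first by apply/asboolP => Z /jE.
  by apply/negP => /asboolP/(_ Y) H; apply: nY; exact: (H ((jE Y).2 gY)).
rewrite ltnNge => /negP; apply; apply: nmin; apply/asboolP.
by exists (C i).
Qed.

Lemma finite_upto_sub (C C' : rmodType A -> Prop) : (forall M, C M -> C' M) ->
  finite_upto C' -> finite_upto C.
Proof. by move=> CC' [I [G GP]]; exists I, G => M /CC'/GP. Qed.

Lemma finite_upto_cover n (C : rmodType A -> Prop) (D : 'I_n -> rmodType A -> Prop) M0 :
  (forall i, finite_upto (D i)) ->
  (forall M, C M -> (forall X, gen M0 X <-> gen M X) \/ exists i, D i M) ->
  finite_upto C.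
Proof.
move=> fD CD.
have H i : exists s : {I : finType & I -> rmodType A}, forall M, D i M ->
    exists k, forall X, gen (tagged s k) X <-> gen M X.
  by have [I [G GP]] := fD i; exists (Tagged (fun I : finType => I -> rmodType A) G).
have [s sE] := choice H.
exists (option {i : 'I_n & tag (s i)}), (fun o => if o is Some k then
  tagged (s (tag k)) (tagged k) else M0) => M /CD[M0M|[i /sE[k kE]]].
  by exists None.
by exists (Some (Tagged (fun i => tag (s i)) k)).
Qed.

(** As in König's lemma: if infinitely many rigid classes lie below M, they do so below one of the
    finitely many maximal subclasses of Gen(M), since these cover everything below M but Gen(M)
    itself. *)
Lemma infinite_descent : ~ finite_upto (@rigid K A) ->
  exists G : nat -> rmodType A, (forall k, rigid (G k)) /\
    forall k, (forall X, gen (G k.+1) X -> gen (G k) X) /\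
      exists2 X, gen (G k) X & ~ gen (G k.+1) X.
Proof.
move=> nfin.
pose below M N := rigid N /\ forall X, gen N X -> gen M X.
pose big M := rigid M /\ ~ finite_upto (below M).
have big0 : big (regular_rmod A).
  split; first exact: rigid_regular.
  move=> fin; apply: nfin; apply: finite_upto_sub fin => M rM; split=> // X _.
  exact: gen_regular.
have step (M : {M | big M}) : exists N : {N | big N},
    (forall X, gen (sval N) X -> gen (sval M) X) /\
    exists2 X, gen (sval M) X & ~ gen (sval N) X.
  case: M => M [rM bM] /=; have [fM _] := rM.
  have [n [C [CP Cmax]]] := @maximal_torsion_subclasses _ _ (gen M) M
    (rigid_torsion rM) (fun X => iff_refl _) fM.
  apply: contrapT => nex; apply: bM.
  apply: (@finite_upto_cover n _ (fun i => below (C i)) M).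
    move=> i; apply: contrapT => ninf; apply: nex; have [rC CM nC] := CP i.
    by exists (exist big (C i) (conj rC ninf)).
  move=> N [rN NM].
  case: (EM (exists2 X, gen M X & ~ gen N X)) => [ex|nx]; [right|left].
    by have [i iE] := Cmax (gen N) (rigid_torsion rN) NM ex; exists i.
  move=> X; split; last exact: NM.
  by move=> gX; apply: contrapT => ngX; apply: nx; exists X.
have [next nextP] := choice step.
pose G k := sval (iter k next (exist big _ big0)).
exists G; split=> k; first by case: (svalP (iter k next (exist big _ big0))).
by rewrite /G iterS; exact: nextP.
Qed.

Lemma silting_findim_finite :
  (forall M : rmodType A, silting M -> exists M' : rmodType A,
    [/\ findim M', silting M' & silting_equiv M M']) ->
  finite_upto (@rigid K A).
Proof.
move=> H3; apply: contrapT => /infinite_descent[G [rG GP]].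
have [M [sM gM]] := large_silting_ex rG.
have [M' [fM' sM' eqM]] := H3 M sM.
have gM' X : gen M' X <-> forall k, gen (G k) X by rewrite -gM -!GenE -eqM.
have [k kE] := descending_compact (fun k => (rG k).1) (fun k => (GP k).1)
  (silting_rigid fM' sM') gM'.
have [_ [X gX ngX]] := GP k.
by apply: ngX; exact: (gM' X).1 (kE X gX) _.
Qed.

End Finiteness.

(** * Ring epimorphisms *)

Record ring_data := RingData {
  rd_zmod :> zmodType;
  rd_one : rd_zmod;
  rd_mul : rd_zmod -> rd_zmod -> rd_zmod;
  rd_mulA : associative rd_mul;
  rd_mul1l : left_id rd_one rd_mul;
  rd_mul1r : right_id rd_one rd_mul;
  rd_mulDl : left_distributive rd_mul +%R;
  rd_mulDr : right_distributive rd_mul +%R }.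

Definition data_ring (D : ring_data) : Type := D.

HB.instance Definition _ (D : ring_data) := GRing.Zmodule.copy (data_ring D) D.
HB.instance Definition _ (D : ring_data) :=
  GRing.Zmodule_isPzRing.Build (data_ring D)
    (@rd_mulA D) (@rd_mul1l D) (@rd_mul1r D) (@rd_mulDl D) (@rd_mulDr D).

Lemma rmorphism_of (A B : pzRingType) (f : A -> B) :
  (forall x y, f (x + y) = f x + f y) -> f 1 = 1 -> (forall x y, f (x * y) = f x * f y) ->
  exists g : {rmorphism A -> B}, forall x, g x = f x.
Proof.
move=> fD f1 fM.
have f0 : f 0 = 0 by apply: (@addrI _ (f 0)); rewrite -fD !addr0.
have fB : {morph f : x y / x - y}.
  move=> x y; apply/esym/eqP; rewrite subr_eq; apply/eqP.
  by rewrite -fD subrK.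
pose fa := GRing.isZmodMorphism.Build A B f fB.
pose fm := GRing.isMonoidMorphism.Build A B f (f1, fM).
by exists (HB.pack_for {rmorphism A -> B} f fa fm).
Qed.

Lemma additive_of (U V : zmodType) (f : U -> V) : (forall x y, f (x + y) = f x + f y) ->
  exists g : {additive U -> V}, forall x, g x = f x.
Proof.
move=> fD.
have f0 : f 0 = 0 by apply: (@addrI _ (f 0)); rewrite -fD !addr0.
have fB : {morph f : x y / x - y}.
  move=> x y; apply/esym/eqP; rewrite subr_eq; apply/eqP.
  by rewrite -fD subrK.
pose fa := GRing.isZmodMorphism.Build U V f fB.
by exists (HB.pack_for {additive U -> V} f fa).
Qed.

(** * Tensor products of free modules with a ring *)

Section FreeTensor.
Context {K : fieldType} {A : falgType K}.
Implicit Types M P Q X Y Z : rmodType A.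
Local Notation free n := ({ffun 'I_n -> regular_rmod A} : rmodType A).

Definition unit_vector n (i : 'I_n) : free n := [ffun j => ((j == i)%:R : A)].

Lemma free_span n (x : free n) : x = \sum_i (x i : A^c) *: unit_vector i.
Proof.
apply/ffunP => j; rewrite sum_ffunE (bigD1 j) //= big1 ?addr0 => [|i ne].
  rewrite !ffunE eqxx; have e (u : A) : u = 1 * u by rewrite mul1r.
  exact: e.
rewrite !ffunE eq_sym (negPf ne); have e (u : A) : 0 * u = 0 by rewrite mul0r.
exact: e.
Qed.

Lemma projective_free n : projective (free n).
Proof.
move=> X Y p f sp.
have [x xE] := choice (fun i => sp (f (unit_vector i))).
have [h hE] := free_hom x; exists h => y.
rewrite hE linear_sum [y in RHS]free_span linear_sum; apply: eq_bigr => i _.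
by rewrite !linearZ /= xE.
Qed.

Lemma findim_free n : findim (free n).
Proof.
elim: n => [|n IH].
  by apply: findim_zero => x; apply/ffunP => -[].
have [h hE] := @linear_of _ (regular_rmod A * free n)%type (free n.+1)
  (fun x => [ffun i => if unlift ord0 i is Some j then x.2 j else x.1]) ltac:(
  by move=> a x y; apply/ffunP => i; rewrite !ffunE; case: unlift => *; rewrite /= ?ffunE).
apply: (findim_quot (p := h)); last by apply: findim_pair => //; exact: findim_regular.
move=> x; exists (x ord0, [ffun j => x (lift ord0 j)]); apply/ffunP => i.
by rewrite hE ffunE /=; case: unliftP => [j ->|->]; rewrite ?ffunE.
Qed.

Lemma free_cover M : findim M -> exists n (p : {linear free n -> M}), surj p.
Proof.
move=> [n [v vP]]; have [h hE] := free_hom v; exists n, h => x.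
have [c ->] := vP x; exists [ffun i => ((c i)%:A : A)]; rewrite hE.
by apply: eq_bigr => i _; rewrite ffunE.
Qed.

Context (C : pzRingType) (f : {rmorphism A -> C}).

(** The tensor of x and c under the identification of the tensor product of A^n and C with C^n. *)
Definition free_tensor n (x : free n) (c : left_via f) : {ffun 'I_n -> C} :=
  [ffun i => f (x i : A) * (c : C)].
Local Notation tens := free_tensor.

Lemma tensDl n (x x' : free n) c : tens (x + x') c = tens x c + tens x' c.
Proof. by apply/ffunP => i; rewrite !ffunE rmorphD mulrDl. Qed.
Lemma tensDr n (x : free n) c c' : tens x (c + c') = tens x c + tens x c'.
Proof. by apply/ffunP => i; rewrite !ffunE mulrDr. Qed.
Lemma tens0l n c : tens (0 : free n) c = 0.
Proof. by apply/ffunP => i; rewrite !ffunE rmorph0 mul0r. Qed.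
Lemma tensZ n (a : A) (x : free n) c : tens ((a : A^c) *: x) c = tens x (a *: c).
Proof.
apply/ffunP => i; rewrite !ffunE.
have e (u : A) : f (u * a) * (c : C) = f u * (f a * c) by rewrite rmorphM mulrA.
exact: e.
Qed.
Lemma tens_sum n (I : finType) (F : I -> free n) c :
  tens (\sum_i F i) c = \sum_i tens (F i) c.
Proof.
apply: (big_ind2 (fun x w => tens x c = w)) => [|x w y z <- <-|] //.
  exact: tens0l.
exact: tensDl.
Qed.

Lemma tens_span n (w : {ffun 'I_n -> C}) : w = \sum_i tens (unit_vector i) (w i).
Proof.
apply/ffunP => j; rewrite sum_ffunE (bigD1 j) //= big1 ?addr0 => [|i ne].
  by rewrite !ffunE eqxx rmorph1 mul1r.
by rewrite !ffunE eq_sym (negPf ne) rmorph0 mul0r.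
Qed.

Lemma free_tensorP n : @is_tensor A (free n) (left_via f) {ffun 'I_n -> C} (@free_tensor n).
Proof.
split; first by split; [exact: tensDl|exact: tensDr|exact: tensZ].
move=> U u [uD uDr uZ].
have u0 c : u 0 c = 0 by apply: (@addrI _ (u 0 c)); rewrite -uD !addr0.
split; last first.
  by move=> g g' H w; rewrite (tens_span w) !raddf_sum; apply: eq_bigr => i _; exact: H.
have [g gE] := @additive_of {ffun 'I_n -> C} U
  (fun w => \sum_i u (unit_vector i) (w i : left_via f)) ltac:(
  by move=> w w'; rewrite -big_split /=; apply: eq_bigr => i _; rewrite ffunE uDr).
exists g => x c; rewrite gE [x in RHS]free_span.
rewrite (big_morph (u^~ c) (fun x y => uD x y c) (u0 c)); apply: eq_bigr => i _.
by rewrite uZ ffunE.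
Qed.

Lemma free_tensor_map n m (d : {linear free n -> free m}) :
  exists D : {additive {ffun 'I_n -> C} -> {ffun 'I_m -> C}},
    (forall w, D w = \sum_i tens (d (unit_vector i)) (w i)) /\
    forall x c, D (tens x c) = tens (d x) c.
Proof.
have [D DE] := @additive_of {ffun 'I_n -> C} {ffun 'I_m -> C}
  (fun w => \sum_i tens (d (unit_vector i)) (w i : left_via f)) ltac:(
  by move=> w w'; rewrite -big_split /=; apply: eq_bigr => i _; rewrite ffunE tensDr).
exists D; split=> // x c; rewrite DE [x in RHS]free_span linear_sum tens_sum.
by apply: eq_bigr => i _; rewrite linearZ tensZ ffunE.
Qed.

End FreeTensor.

Lemma pullback_ex (R : pzRingType) (C : lmodType R -> Prop) (Y N M : lmodType R)
    (p : {linear Y -> N}) (u : {linear M -> N}) : surj p ->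
  smod C (fun y => p y = 0) ->
  exists (P : lmodType R) (f : {linear P -> Y}) (g : {linear P -> M}),
    [/\ surj g, forall x, p (f x) = u (g x) & smod C (fun x => g x = 0)].
Proof.
move=> sp [S [i [ii iE CS]]].
have [f fE] := linear_fst Y M; have [g gE] := linear_snd Y M.
have [w wE] := linear_sub (p \o f) (u \o g).
have [P [j [ij jE]]] := submodule_ex (submod_ker w).
have wj x : p (f (j x)) = u (g (j x)).
  have : w (j x) = 0 by apply/jE; exists x.
  by rewrite wE /= => /eqP; rewrite subr_eq0 => /eqP.
exists P, (f \o j), (g \o j); split=> //.
  move=> s; have [y yE] := sp (u s).
  have /jE[x xE] : w (y, s) = 0 by rewrite wE /= fE gE /= yE subrr.
  by exists x; rewrite /= xE gE.
have [k kE] := linear_inl Y M.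
have [l lE] := @factor_inj _ _ _ _ j (k \o i) ij ltac:(
  move=> s; apply/jE; rewrite /= wE /= fE gE kE /= linear0 subr0;
  by apply/iE; exists s).
exists S, l; split=> // [x y e|x].
  have : k (i x) = k (i y) by rewrite -[k (i x)]/((k \o i) x) -lE e lE.
  by rewrite !kE => -[/ii].
split=> [gx|[s <-]]; last by rewrite /= lE gE /= kE.
have /iE[s sE] : p (f (j x)) = 0 by rewrite wj [g (j x)]gx linear0.
exists s; apply: ij; rewrite lE /= kE sE fE.
by have := gx; rewrite /= gE; case: (j x) => a b /= ->.
Qed.

(** * The ring structure on the reflection of A and its homological properties *)

Section RingOfReflection.
Context {K : fieldType} {A : falgType K}.
Implicit Types M P Q X Y Z : rmodType A.
Context (T : rmodType A -> Prop) (T0 T1 : rmodType A) (t : T0).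
Context (pi : {linear T0 -> T1}).
Hypothesis torT : torsion_class T.
Hypothesis appT : min_approx T t.
Hypothesis spi : surj pi.
Hypothesis piE : forall y, pi y = 0 <-> exists a : A^c, a *: t = y.
Context (B : rmodType A) (b : {linear T0 -> B}).
Hypothesis sb : surj b.
Hypothesis bE : forall y, b y = 0 <-> trace T1 y.

Let TQ X Y (p : {linear X -> Y}) : surj p -> T X -> T Y.
Proof. exact: tors_quot. Qed.
Local Notation W := (wide T T1).
Local Notation b1 := (b t).
Let WB : W B. Proof. exact: (reflection_wide torT appT spi piE sb bE). Qed.
Let TB : T B. Proof. by case: WB. Qed.
Let Wquot X Y (p : {linear X -> Y}) : surj p -> smod T (fun x => p x = 0) -> W X -> W Y.
Proof. exact: wide_quot torT appT spi piE _ _ _. Qed.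
Let Bex X (x : X) : W X -> exists h : {linear B -> X}, h b1 = x.
Proof. exact: (reflection_ex appT sb bE). Qed.
Let Buniq0 X (h : {linear B -> X}) : W X -> h b1 = 0 -> forall y, h y = 0.
Proof. exact: (reflection_uniq spi piE sb). Qed.
Let fB : findim B. Proof. exact: findim_quot sb (approx_findim0 appT). Qed.

Let Buniq X (h h' : {linear B -> X}) : W X -> h b1 = h' b1 -> forall y, h y = h' y.
Proof.
move=> WX e y; have [k kE] := linear_sub h h'.
have := Buniq0 WX (h := k); rewrite kE e subrr => /(_ erefl y).
by rewrite kE => /eqP; rewrite subr_eq0 => /eqP.
Qed.

(** By the universal property of the reflection, evaluation at [b1] identifies End(B) with B; the
    product of B is composition of endomorphisms. *)
Let eta : B -> {linear B -> B} := fun x => sval (cid (Bex x WB)).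
Let eta1 x : eta x b1 = x. Proof. exact: svalP (cid (Bex x WB)). Qed.

Let mul (x y : B) : B := eta x y.

Let mulA : associative mul.
Proof. by move=> x y z; apply: (Buniq (h := eta x \o eta y)) => //; rewrite /= !eta1. Qed.
Let mul1l : left_id b1 mul.
Proof. by move=> x; apply: (Buniq (h := eta b1) (h' := idfun)) => //; rewrite eta1. Qed.
Let mul1r : right_id b1 mul.
Proof. exact: eta1. Qed.
Let mulDl : left_distributive mul +%R.
Proof.
move=> x y z; rewrite /mul; have [k kE] := linear_add (eta x) (eta y).
by rewrite -kE; apply: Buniq => //; rewrite kE !eta1.
Qed.
Let mulDr : right_distributive mul +%R.
Proof. by move=> x y z; rewrite /mul linearD. Qed.

Definition reflection_ring : pzRingType :=
  data_ring (RingData mulA mul1l mul1r mulDl mulDr).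
Local Notation C := reflection_ring.

Lemma reflection_rmorphism : exists f : {rmorphism A -> C},
  forall a : A, f a = ((a : A^c) *: b1 : B).
Proof.
apply: (@rmorphism_of A C (fun a : A => (a : A^c) *: b1)).
- by move=> x y; exact: scalerDl.
- exact: scale1r.
- move=> x y; have e : ((x * y : A) : A^c) *: b1 = (y : A^c) *: ((x : A^c) *: b1) by rewrite scalerA.
  have e' : mul ((x : A^c) *: b1) ((y : A^c) *: b1) = (y : A^c) *: ((x : A^c) *: b1).
    by rewrite /mul linearZ /= eta1.
  by rewrite e; exact: esym e'.
Qed.

Context (f : {rmorphism A -> C}).
Hypothesis fE : forall a : A, f a = ((a : A^c) *: b1 : B).
Local Notation Br := (right_via f : rmodType A).

Lemma right_via_scale (a : A^c) (x : B) : (a *: (x : Br) : B) = a *: x.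
Proof.
have e : mul x (f a) = a *: x by rewrite /mul fE linearZ /= eta1.
exact: e.
Qed.

Lemma right_via_isom : exists (h : {linear B -> Br}) (h' : {linear Br -> B}),
  (forall x, h x = x) /\ forall x, h' x = x.
Proof.
have [h hE] := @linear_of _ B Br id ltac:(
  by move=> a x y; have := right_via_scale a x => e; congr (_ + _); exact: esym e).
have [h' h'E] := @linear_of _ Br B id ltac:(
  by move=> a x y; have := right_via_scale a x => e; congr (_ + _); exact: e).
by exists h, h'.
Qed.

(* X is a module over the ring B: m x u is the action of u on x. *)
Lemma wide_of_action X (m : X -> {linear B -> X}) : (forall x, m x b1 = x) ->
  (forall x y u, m (x + y) u = m x u + m y u) ->
  (forall x u v, m (m x u) v = m x (mul u v)) -> W X.
Proof.
move=> m1 mD mM.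
have m0 u : m 0 u = 0 by apply: (@addrI _ (m 0 u)); rewrite -mD !addr0.
have [S [iota cop]] := coproduct_ex (fun _ : X => B).
have [[p pE] _] := cop X m.
have WS : W S := wide_coproduct torT cop WB.
have sp : surj p by move=> x; exists (iota x b1); rewrite pE m1.
(* The cover p is B-linear. Its kernel is therefore stable under B, hence generated by B and in T,
   so X is a quotient of a wide module by a T-submodule. *)
have key : forall (k : S) (h : {linear B -> S}), h b1 = k -> forall v, p (h v) = m (p k) v.
  apply: (coproduct_span cop).
    split=> [h h1 v|a k l Hk Hl h h1 v].
      by rewrite linear0 m0 (Buniq0 WS h1) linear0.
    have [hk hkE] := Bex k WS; have [hl hlE] := Bex l WS.
    have [g gE] := linear_add (hk \o eta (a *: b1)) hl.
    have -> : h v = g v.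
      by apply: (Buniq WS); rewrite gE /= eta1 linearZ /= hkE hlE.
    rewrite gE /= linearD (Hl hl) // (Hk hk) // linearD mD; congr (_ + _).
    by rewrite -/(mul (a *: b1) v) -mM linearZ /= m1 -linearZ.
  move=> x u h h1 v; rewrite pE.
  have -> : h v = (iota x \o eta u) v by apply: (Buniq WS); rewrite /= eta1.
  by rewrite /= pE mM.
apply: (Wquot sp _ WS).
have [Y [i [ii iE]]] := submodule_ex (submod_ker p).
exists Y, i; split=> //; apply: (tors_gen torT TB) => y.
have [h hE] := Bex (i y) WS.
have [g gE] := @factor_inj _ _ _ _ i h ii ltac:(
  move=> v; apply/iE; rewrite (key _ h hE) (_ : p (i y) = 0) ?m0 //;
  by apply/iE; exists y).
rewrite (_ : y = g b1); first exact: trace_image.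
by apply: ii; rewrite gE hE.
Qed.

(** C' becomes an A-module with an action of B through g, so it is in W. Both g and h are A-linear
    maps from B to it that agree at the unit, and the universal property makes them equal. *)
Lemma reflection_ring_epi : ring_epi f.
Proof.
move=> C' g h gh x.
pose rho : {rmorphism A -> C'} := g \o f.
pose Z : rmodType A := right_via rho.
have gZP : exists k : {linear B -> Z}, forall u, k u = g u.
  apply: linear_of => a u v.
  have e : g ((u : C) * f a + v) = g u * g (f a) + g v by rewrite rmorphD rmorphM.
  by rewrite -(right_via_scale a u); exact: e.
have hZP : exists k : {linear B -> Z}, forall u, k u = h u.
  apply: linear_of => a u v.
  have e : h ((u : C) * f a + v) = h u * g (f a) + h v by rewrite gh rmorphD rmorphM.
  by rewrite -(right_via_scale a u); exact: e.
have [gZ gZE] := gZP; have [hZ hZE] := hZP.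
have mP (z : Z) : exists k : {linear B -> Z}, forall u, k u = (z : C') * g u.
  apply: linear_of => a u v.
  have e : (z : C') * g ((u : C) * f a + v) = z * g u * g (f a) + z * g v.
    by rewrite rmorphD rmorphM mulrDr mulrA.
  by rewrite -(right_via_scale a u); exact: e.
have [m mE] := choice mP.
have WZ : W Z.
  apply: (@wide_of_action Z m).
  - move=> z; rewrite mE; have e : (z : C') * g (1 : C) = z by rewrite rmorph1 mulr1.
    exact: e.
  - by move=> z z' u; rewrite !mE; exact: mulrDl.
  - move=> z u v; rewrite !mE.
    have e : (z : C') * g u * g v = z * g ((u : C) * (v : C)) by rewrite rmorphM mulrA.
    exact: e.
rewrite -gZE -hZE; apply: (Buniq WZ); rewrite gZE hZE.
have e : g (1 : C) = h 1 by rewrite !rmorph1.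
exact: e.
Qed.

(** The pullback of p along u is in W by extension closure, and the universal property of B splits
    it. *)
Lemma relproj_wide : relproj W B.
Proof.
move=> Y N p u sp WK; have [P [k [g [sg pk [S [i [ii iE WS]]]]]]] := pullback_ex u sp WK.
have WP : W P := wide_ext torT ii (fun x => iE x) sg WS WB.
have [y yE] := sg b1; have [h hE] := Bex y WP.
exists (k \o h) => x; rewrite /= pk; congr (u _).
by apply: (Buniq (h := g \o h) (h' := idfun)) => //; rewrite /= hE.
Qed.

Local Notation free n := ({ffun 'I_n -> regular_rmod A} : rmodType A).
Local Notation freeB n := ({ffun 'I_n -> Br} : rmodType A).

Lemma wide_free n : W (freeB n).
Proof.
have [h [h' [hE h'E]]] := right_via_isom.
split.
  apply: (tors_gen torT TB) => v.
  have iP (i : 'I_n) : exists k : {linear B -> freeB n}, forall x,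
      k x = [ffun j => if j == i then (x : Br) else 0].
    apply: linear_of => a x y; apply/ffunP => j; rewrite !ffunE.
    case: eqP => _; last by rewrite scaler0 addr0.
    by rewrite -(hE (a *: x + y)) linearP !hE.
  have [k kE] := choice iP.
  rewrite (_ : v = \sum_i k i (v i)).
    by apply: (@submod_sum _ _ (@trace _ B (freeB n))) => // i _; exact: trace_image.
  apply/ffunP => j; rewrite sum_ffunE (bigD1 j) //= big1 ?addr0 => [|i ne].
    by rewrite kE ffunE eqxx.
  by rewrite kE ffunE eq_sym (negPf ne).
move=> u x; apply/ffunP => i; rewrite ffunE.
have [k kE] := @linear_of _ (freeB n) Br (fun v => v i) ltac:(
  by move=> a v w; rewrite /= !ffunE).
rewrite -(kE (u x)) -(h'E (k (u x))).
by case: WB => _ /(_ (h' \o (k \o u)) x).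
Qed.

(** Tor_1 is computed from a free resolution, whose tensor product with C is the sequence of the
    C^(n_i). The cokernel Z of D2 is in W. The map x |-> q (x tensor 1) vanishes on the image of d2,
    so it extends along d1 to the next term because Ext^1(B, Z) = 0. Extending C-linearly shows that
    q factors through D1, hence ker D1 is contained in ker q, the image of D2. *)
Lemma reflection_Tor1 : Tor1_vanishes (right_via f) (left_via f).
Proof.
have [h [h' [hE h'E]]] := right_via_isom.
have sh : surj h by move=> x; exists x; rewrite hE.
have fBr : findim Br := findim_quot sh fB.
have [n0 [e se]] := free_cover fBr.
have [S0 [i0 [ii0 iE0]]] := submodule_ex (submod_ker e).
have [n1 [c1 sc1]] := free_cover (findim_inj ii0 (findim_free (A := A) n0)).
have [S1 [i1 [ii1 iE1]]] := submodule_ex (submod_ker (i0 \o c1)).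
have [n2 [c2 sc2]] := free_cover (findim_inj ii1 (findim_free (A := A) n1)).
have [d1 d1E] : exists d1 : {linear free n1 -> free n0}, d1 =1 i0 \o c1 by exists (i0 \o c1).
have [d2 d2E] : exists d2 : {linear free n2 -> free n1}, d2 =1 i1 \o c2 by exists (i1 \o c2).
have ex1 : exact d1 e.
  move=> y; split=> [/iE0[s <-]|[x <-]]; last by apply/iE0; exists (c1 x); rewrite d1E.
  by have [x <-] := sc1 s; exists x; rewrite d1E.
have ex2 : exact d2 d1.
  move=> y; rewrite d1E; split=> [/iE1[s <-]|[x <-]]; last by apply/iE1; exists (c2 x); rewrite d2E.
  by have [x <-] := sc2 s; exists x; rewrite d2E.
exists (free n2), (free n1), (free n0), d2, d1, e.
split; first by split; exact: projective_free.
split; first by [].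
have [D2 [D2E D2t]] := free_tensor_map f d2.
have [D1 [D1E D1t]] := free_tensor_map f d1.
exists {ffun 'I_n2 -> C}, {ffun 'I_n1 -> C}, {ffun 'I_n0 -> C},
  (@free_tensor _ _ _ f n2), (@free_tensor _ _ _ f n1), (@free_tensor _ _ _ f n0), D2, D1.
split; first by split; exact: free_tensorP.
split=> // w; split=> [D1w|[v <-]]; last first.
  rewrite (tens_span f v) !raddf_sum /= big1 // => i _.
  rewrite D2t D1t (_ : d1 _ = 0) ?tens0l //; apply/ex2; by eexists.
have [D2l D2lE] : exists D2l : {linear freeB n2 -> freeB n1}, forall v, D2l v = D2 v.
  apply: linear_of => a u v; apply/ffunP => j; rewrite !D2E !ffunE !sum_ffunE.
  have e3 (F G H : 'I_n2 -> C) : (forall i, F i = G i * f a + H i) ->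
      \sum_i F i = (\sum_i G i) * f a + \sum_i H i.
    by move=> H'; rewrite mulr_suml -big_split /=; apply: eq_bigr => i _.
  apply: e3 => i; rewrite !ffunE.
  have e4 (x y z : C) : x * (y * f a + z) = x * y * f a + x * z by rewrite mulrDr mulrA.
  exact: e4.
have [Z [q [sq qE]]] := quotient_ex (submod_range D2l).
have WZ : W Z.
  apply: (Wquot sq _ (wide_free n1)).
  apply: smod_ext (smod_range TQ D2l (proj1 (wide_free n2))) => v.
  by rewrite qE.
have teP n (x : free n) : exists k : {linear B -> freeB n},
    forall u, k u = free_tensor x (u : left_via f).
  apply: linear_of => a u v; apply/ffunP => i; rewrite !ffunE.
  have e4 (y : C) : y * ((u : C) * f a + v) = y * u * f a + y * v.
    by rewrite mulrDr mulrA.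
  by rewrite -(right_via_scale a u); exact: e4.
have te1 n (x : free n) : free_tensor x (b1 : left_via f) = [ffun i => f (x i : A)].
  by apply/ffunP => i; rewrite !ffunE; exact: mulr1.
have [phi phiE] : exists phi : {linear free n1 -> freeB n1},
    forall x, phi x = free_tensor x (b1 : left_via f).
  apply: linear_of => a x y; apply/ffunP => i; rewrite !te1 !ffunE.
  have e4 (u v : A) : f (u * a + v) = f u * f a + f v by rewrite rmorphD rmorphM.
  exact: e4.
have [g gE] : exists g : {linear free n0 -> Z}, forall x, g (d1 x) = q (phi x).
  apply: (@relproj_extend _ W B _ _ Z d1 (h' \o e) (q \o phi) relproj_wide WZ).
  - move=> y; rewrite -ex1 /= h'E; exact: iff_refl.
  - by move=> x; have [y yE] := se x; exists y; rewrite /= yE h'E.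
  - move=> x /ex2[y <-]; rewrite /= phiE -D2t -D2lE; apply/qE.
    by exists (free_tensor y (b1 : left_via f)).
have [et etE] := choice (fun z => Bex z WZ).
have etD z z' x : et (z + z') x = et z x + et z' x.
  have [k kE] := linear_add (et z) (et z').
  by rewrite -kE; apply: (Buniq WZ); rewrite kE !etE.
have et0 x : et 0 x = 0 by apply: (@addrI _ (et 0 x)); rewrite -etD !addr0.
have [Ch ChE] := @additive_of {ffun 'I_n0 -> C} Z (fun w => \sum_i et (g (unit_vector i)) (w i)) ltac:(
  by move=> u v; rewrite -big_split /=; apply: eq_bigr => i _; rewrite ffunE linearD).
have Cht p x : Ch (free_tensor p (x : left_via f)) = et (g p) x.
  rewrite ChE [p in RHS]free_span linear_sum.
  rewrite (big_morph (et^~ x) (fun z z' => etD z z' x) (et0 x)).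
  apply: eq_bigr => i _; rewrite ffunE linearZ.
  have -> : et (g (unit_vector i)) (f (p i) * (x : C)) =
      (et (g (unit_vector i)) \o eta (f (p i))) x by [].
  by apply: (Buniq WZ); rewrite /= eta1 fE linearZ /= !etE.
have qt x : q (x : freeB n1) = Ch (D1 x).
  rewrite (tens_span f x) !raddf_sum; apply: eq_bigr => j _.
  rewrite D1t Cht gE; have [k kE] := teP n1 (unit_vector j).
  rewrite -kE; apply: (Buniq (h := q \o k) WZ).
  by rewrite /= etE kE phiE.
have /qE[v vE] : q (w : freeB n1) = 0 by rewrite qt D1w raddf0.
by exists v; rewrite -D2lE.
Qed.

End RingOfReflection.

Section AdditiveEndomorphisms.
Context (V : zmodType).

(** The product is composition in reverse order, so that right actions on V are ring morphisms. *)
Definition additive_endo : Type :=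
  {F : V -> V | forall x y, F (x + y) = F x + F y}.

Lemma additive_endo_eq (F G : additive_endo) : (forall v, sval F v = sval G v) -> F = G.
Proof. by case: F G => F HF [G HG] /= H; apply: eq_exist; apply/funext. Qed.

Let add (F G : additive_endo) : additive_endo.
Proof.
exists (fun v => sval F v + sval G v) => x y.
by rewrite (svalP F) (svalP G) addrACA.
Defined.
Let opp (F : additive_endo) : additive_endo.
Proof. by exists (fun v => - sval F v) => x y; rewrite (svalP F) opprD. Defined.
Let zero : additive_endo.
Proof. by exists (fun=> 0) => x y; rewrite addr0. Defined.
Let one : additive_endo.
Proof. by exists (fun v => v). Defined.
Let mul (F G : additive_endo) : additive_endo.
Proof. by exists (fun v => sval G (sval F v)) => x y; rewrite (svalP F) (svalP G). Defined.

Let addA : associative add.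
Proof. by move=> F G H; apply: additive_endo_eq => v /=; rewrite addrA. Qed.
Let addC : commutative add.
Proof. by move=> F G; apply: additive_endo_eq => v /=; rewrite addrC. Qed.
Let add0 : left_id zero add.
Proof. by move=> F; apply: additive_endo_eq => v /=; rewrite add0r. Qed.
Let addN : left_inverse zero opp add.
Proof. by move=> F; apply: additive_endo_eq => v /=; rewrite addNr. Qed.

HB.instance Definition _ := gen_eqMixin additive_endo.
HB.instance Definition _ := gen_choiceMixin additive_endo.
HB.instance Definition _ :=
  GRing.isZmodule.Build additive_endo addA addC add0 addN.

Let mulA : associative mul.
Proof. by move=> F G H; apply: additive_endo_eq. Qed.
Let mul1 : left_id one mul.
Proof. by move=> F; apply: additive_endo_eq. Qed.
Let mulr1 : right_id one mul.
Proof. by move=> F; apply: additive_endo_eq. Qed.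
Let mulDl : left_distributive mul +%R.
Proof. by move=> F G H; apply: additive_endo_eq => v /=; rewrite (svalP H). Qed.
Let mulDr : right_distributive mul +%R.
Proof. by move=> F G H; apply: additive_endo_eq. Qed.
HB.instance Definition _ := GRing.Zmodule_isPzRing.Build additive_endo
  mulA mul1 mulr1 mulDl mulDr.

End AdditiveEndomorphisms.

Lemma zmod_quotient_ex (V : zmodType) (N : V -> Prop) : N 0 ->
  (forall x y, N x -> N y -> N (x - y)) ->
  exists (Q : zmodType) (q : V -> Q), [/\ surj q, forall x y, q (x + y) = q x + q y
    & forall x, q x = 0 <-> N x].
Proof.
move=> N0 NB.
have NN x : N x -> N (- x) by move=> Nx; rewrite -sub0r; exact: NB.
have ND x y : N x -> N y -> N (x + y).
  by move=> Nx Ny; rewrite -[y]opprK; apply: NB => //; exact: NN.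
pose E : quot_data V := @QuotData _ (fun x y => N (x - y))
  ltac:(move=> x; by rewrite /= subrr)
  ltac:(move=> x y /= H; rewrite -opprB; exact: NN)
  ltac:(move=> x y z /= H1 H2; rewrite -(subrKA y); exact: ND).
pose Z : zmod_data := @ZmodData V E 0 -%R +%R
  ltac:(move=> x y H; rewrite /E /= -opprD; exact (NN _ H))
  ltac:(move=> x x' y y' H1 H2; rewrite /E /= opprD addrACA; exact (ND _ _ H1 H2))
  ltac:(move=> x y z; by rewrite /E /= addrA subrr)
  ltac:(move=> x y; by rewrite /E /= [x + y]addrC subrr)
  ltac:(move=> x; by rewrite /E /= add0r subrr)
  ltac:(move=> x; by rewrite /E /= addNr subrr).
have qD x y : (qpi E (x + y) : zquot Z) = (qpi E x : zquot Z) + qpi E y.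
  exact: (@zquot_piD Z).
exists (zquot Z), (qpi E : V -> zquot Z); split=> // [y|x].
  by exists (qrepr y); exact: qreprK.
have e0 : (qpi E 0 : zquot Z) = 0 by apply: (@addrI _ (qpi E 0 : zquot Z)); rewrite -qD !addr0.
rewrite -e0; split=> [/qpi_eq|Nx]; first by rewrite /= subr0.
by apply/qpi_eq; rewrite /= subr0.
Qed.

(** * Modules over the target of a ring epimorphism *)

Section Epimorphism.
Context {K : fieldType} {A : falgType K}.
Implicit Types M P Q S X Y Z : rmodType A.
Context (C : pzRingType) (f : {rmorphism A -> C}).
Hypothesis epi : ring_epi f.
Local Notation Cr := (right_via f : rmodType A).

(* h is compared with its conjugates on C + X, which coincide on A. *)
Lemma epi_linear (X : zmodType) (act : X -> C -> X) (h : C -> X) :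
  (forall x y c, act (x + y) c = act x c + act y c) ->
  (forall x c c', act x (c + c') = act x c + act x c') ->
  (forall x c c', act (act x c) c' = act x (c * c')) -> (forall x, act x 1 = x) ->
  (forall c c', h (c + c') = h c + h c') ->
  (forall c a, h (c * f a) = act (h c) (f a)) -> forall c, h c = act (h 1) c.
Proof.
move=> aDl aDr aA a1 hD hA c.
pose V : zmodType := (C * X)%type.
have r1P c' : {F : additive_endo V | forall v, sval F v = (v.1 * c', act v.2 c')}.
  unshelve eexists; first exists (fun v => (v.1 * c', act v.2 c')); last by [].
  by move=> x y; congr (_, _); rewrite /= ?mulrDl ?aDl.
have r2P c' : {F : additive_endo V |
    forall v, sval F v = (v.1 * c', act (v.2 + h v.1) c' - h (v.1 * c'))}.
  unshelve eexists.
    exists (fun v => (v.1 * c', act (v.2 + h v.1) c' - h (v.1 * c'))).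
    move=> x y; congr (_, _); rewrite /= mulrDl //.
    by rewrite (hD x.1) (hD (x.1 * c')) [x.2 + y.2 + _]addrACA (aDl (x.2 + h x.1)) opprD; exact: addrACA.
  by [].
have [r1 r1E] : exists r1 : {rmorphism C -> additive_endo V},
    forall c' v, sval (r1 c') v = (v.1 * c', act v.2 c').
  have [r rE] := @rmorphism_of C (additive_endo V) (fun c' => sval (r1P c')) ltac:(
    by move=> x y; apply: additive_endo_eq => v; rewrite /= !(svalP (r1P _)) mulrDr aDr) ltac:(
    by apply: additive_endo_eq => -[u v]; rewrite !(svalP (r1P _)) /= mulr1 a1) ltac:(
    by move=> x y; apply: additive_endo_eq => v; rewrite /= !(svalP (r1P _)) /= mulrA aA).
  by exists r => c' v; rewrite rE (svalP (r1P _)).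
have [r2 r2E] : exists r2 : {rmorphism C -> additive_endo V},
    forall c' v, sval (r2 c') v = (v.1 * c', act (v.2 + h v.1) c' - h (v.1 * c')).
  have [r rE] := @rmorphism_of C (additive_endo V) (fun c' => sval (r2P c')) ltac:(
    by move=> x y; apply: additive_endo_eq => v; rewrite /= !(svalP (r2P _)) mulrDr aDr hD opprD;
      congr (_, _); rewrite addrACA) ltac:(
    by apply: additive_endo_eq => -[u v]; rewrite !(svalP (r2P _)) /= mulr1 a1 addrK) ltac:(
    by move=> x y; apply: additive_endo_eq => v; rewrite /= !(svalP (r2P _)) /= mulrA subrK aA).
  by exists r => c' v; rewrite rE (svalP (r2P _)).
have e : r1 c = r2 c.
  apply: epi => a; apply: additive_endo_eq => v.
  by rewrite r1E r2E hA aDl addrK.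
have := congr1 (fun F : additive_endo V => sval F (1, 0)) e.
rewrite r1E r2E /= => -[/esym/eqP].
have a0 : act 0 c = 0 by apply: (@addrI _ (act 0 c)); rewrite -aDl !addr0.
by rewrite a0 add0r mul1r subr_eq0 => /eqP.
Qed.

(* The essential image of the restriction of scalars along f. *)
Definition epi_class X : Prop :=
  (forall x : X, exists h : {linear Cr -> X}, h (1 : C) = x) /\
  forall h : {linear Cr -> X}, h (1 : C) = 0 -> forall c, h c = 0.

Lemma epi_class_uniq X (h h' : {linear Cr -> X}) : epi_class X ->
  h (1 : C) = h' (1 : C) -> forall c, h c = h' c.
Proof.
move=> [_ U] e c; have [k kE] := linear_sub h h'.
have := U k; rewrite kE e subrr => /(_ erefl c).
by rewrite kE => /eqP; rewrite subr_eq0 => /eqP.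
Qed.

Lemma left_mult (c : C) : exists k : {linear Cr -> Cr}, forall c', k c' = c * c'.
Proof.
apply: linear_of => a x y.
have e : c * ((x : C) * f a + y) = c * x * f a + c * y by rewrite mulrDr mulrA.
exact: e.
Qed.

Lemma epi_class_action X : epi_class X -> exists act : X -> C -> X,
  [/\ forall x y c, act (x + y) c = act x c + act y c,
      forall x c c', act x (c + c') = act x c + act x c',
      forall x c c', act (act x c) c' = act x (c * c'),
      (forall x, act x 1 = x) /\ (forall x (a : A), act x (f a) = (a : A^c) *: x)
    & forall (h : {linear Cr -> X}) c, h c = act (h (1 : C)) c].
Proof.
move=> EX; have [h hE] := choice EX.1.
exists (fun x c => h x c); split.
- move=> x y c; have [k kE] := linear_add (h x) (h y).
  by rewrite -kE; apply: (epi_class_uniq EX); rewrite kE !hE.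
- by move=> x c c'; exact: linearD.
- move=> x c c'; have [k kE] := left_mult c.
  rewrite -kE; apply: (epi_class_uniq (h' := h x \o k) EX).
  by rewrite hE /= kE; congr (h x _); rewrite mulr1.
- split=> // x a; have e : (a : A^c) *: ((1 : C) : Cr) = f a.
    by have e' : 1 * f a = f a :> C by [rewrite mul1r]; exact: e'.
  by rewrite -e linearZ /= hE.
- by move=> g c; apply: (epi_class_uniq EX); rewrite hE.
Qed.

Lemma action_epi_class X (act : X -> C -> X) :
  (forall x y c, act (x + y) c = act x c + act y c) ->
  (forall x c c', act x (c + c') = act x c + act x c') ->
  (forall x c c', act (act x c) c' = act x (c * c')) -> (forall x, act x 1 = x) ->
  (forall x (a : A), act x (f a) = (a : A^c) *: x) -> epi_class X.
Proof.
move=> aDl aDr aA a1 af; split=> [x|h h1 c].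
  have [k kE] := @linear_of _ Cr X (fun c => act x c) ltac:(
    by move=> a c c'; have e := aDr x ((c : C) * f a) c'; rewrite -aA af in e; exact: e).
  by exists k; rewrite kE a1.
rewrite (epi_linear aDl aDr aA a1 (h := h)) ?h1.
- by apply: (@addrI _ (act 0 c)); rewrite -aDl !addr0.
- by move=> x y; exact: linearD.
- by move=> x a; rewrite af -linearZ.
Qed.

Lemma epi_class_self : epi_class Cr.
Proof.
apply: (@action_epi_class Cr (fun x c => (x : C) * c)).
- exact: mulrDl.
- exact: mulrDr.
- by move=> x c c'; rewrite mulrA.
- exact: mulr1.
- by [].
Qed.

Lemma epi_class_zero X : (forall x : X, x = 0) -> epi_class X.
Proof.
move=> H; split=> [x|h _ c]; last exact: H.
by have [z zE] := linear_zero Cr X; exists z; rewrite zE (H x).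
Qed.

(** The last hypothesis says that the kernel of q is stable under C, so that the action descends. *)
Lemma epi_class_quot X Y (q : {linear X -> Y}) : epi_class X -> surj q ->
  (forall x, q x = 0 -> forall h : {linear Cr -> X}, h (1 : C) = x -> forall c, q (h c) = 0) ->
  epi_class Y.
Proof.
move=> EX sq H; have [act [aDl aDr aA [a1 af] aE]] := epi_class_action EX.
have st x x' c : q x = q x' -> q (act x c) = q (act x' c).
  move=> e; have [h hE] := EX.1 (x - x').
  have := H (x - x') (linear_eq_ker e) h hE c.
  rewrite aE hE => e0; apply/eqP; rewrite -subr_eq0 -linearB; apply/eqP.
  have e1 := aDl (x - x') x' c; rewrite subrK in e1.
  by rewrite e1 addrK.
have [r rK] := choice sq.
apply: (@action_epi_class Y (fun y c => q (act (r y) c))).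
- move=> x y c; rewrite -linearD -aDl; apply: st.
  by rewrite linearD !rK.
- by move=> x c c'; rewrite aDr linearD.
- by move=> x c c'; rewrite -aA; apply: st; rewrite rK.
- by move=> x; rewrite a1.
- by move=> x a; rewrite af linearZ /= rK.
Qed.

Lemma epi_class_inj X Y (i : {linear X -> Y}) : epi_class Y -> injective i ->
  (forall x (h : {linear Cr -> Y}), h (1 : C) = i x -> forall c, exists x', i x' = h c) ->
  epi_class X.
Proof.
move=> EY ii H; split=> [x|h h1 c].
  have [h hE] := EY.1 (i x).
  have [g gE] := @factor_inj _ _ _ _ i h ii (H x h hE).
  by exists g; apply: ii; rewrite gE.
by apply: ii; rewrite linear0; apply: (EY.2 (i \o h)); rewrite /= h1 linear0.
Qed.

Lemma epi_class_coproduct I (S : rmodType A) (iota : I -> {linear Cr -> S}) :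
  @is_coproduct A^c I (fun=> Cr) S iota -> epi_class S.
Proof.
move=> cop; split=> [|h h1 c].
  apply: (coproduct_span cop) => [|i c].
    split=> [|a x y [h hx] [g gy]]; first by have [z zE] := linear_zero Cr S; exists z.
    have [k kE] := left_mult (f a).
    have [l lE] := linear_add (h \o k) g; exists l.
    rewrite lE /= kE gy; congr (_ + _); rewrite -hx -linearZ; congr (h _).
    by have e : f a * 1 = 1 * f a by [rewrite mulr1 mul1r]; exact: e.
  have [k kE] := left_mult c; exists (iota i \o k).
  by rewrite /= kE; congr (iota i _); exact: mulr1.
apply: (coproduct_joint_inj cop) => p _.
by apply: (epi_class_self.2 (p \o h)); rewrite /= h1 linear0.
Qed.

Lemma epi_class_gen X : epi_class X -> gen Cr X.
Proof. by move=> EX x; have [h <-] := EX.1 x; exact: trace_image. Qed.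

Lemma epi_class_ker X Y (g : {linear X -> Y}) (S : rmodType A) (i : {linear S -> X}) :
  epi_class X -> epi_class Y -> injective i ->
  (forall x, g x = 0 <-> exists s, i s = x) -> epi_class S.
Proof.
move=> EX EY ii iE; apply: (epi_class_inj EX ii) => s h hs c; apply/iE.
apply: (EY.2 (g \o h)); rewrite /= hs; apply/iE; by exists s.
Qed.

Lemma epi_class_coker X Y Z (g : {linear X -> Y}) (q : {linear Y -> Z}) :
  epi_class X -> epi_class Y -> surj q ->
  (forall y, q y = 0 <-> exists x, g x = y) -> epi_class Z.
Proof.
move=> EX EY sq qE; apply: (epi_class_quot EY sq) => y /qE[x <-] h h1 c; apply/qE.
have [k kE] := EX.1 x; exists (k c).
by apply: (epi_class_uniq (h := g \o k) EY); rewrite /= kE h1.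
Qed.

End Epimorphism.

(** * Vanishing of Tor_1 and extension of maps *)

Section TorEpimorphism.
Context {K : fieldType} {A : falgType K}.
Implicit Types M P Q S X Y Z : rmodType A.
Context (C : pzRingType) (f : {rmorphism A -> C}).
Hypothesis epi : ring_epi f.
Hypothesis tor : Tor1_vanishes (right_via f) (left_via f).
Local Notation Cr := (right_via f : rmodType A).
Local Notation Cl := (left_via f : lmodType A).

Let additive_inj (M : rmodType A) (U : zmodType) (Tn : zmodType) (tn : M -> Cl -> Tn)
    (g g' : Tn -> U) : is_tensor tn ->
  (forall x y, g (x + y) = g x + g y) -> (forall x y, g' (x + y) = g' x + g' y) ->
  (forall x c, g (tn x c) = g' (tn x c)) -> forall w, g w = g' w.
Proof.
move=> [bt H] gD g'D e w.
have [k kE] := additive_of gD; have [k' k'E] := additive_of g'D.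
have [tDl tDr tZ] := bt.
have [_ U'] := H U (fun x c => k (tn x c)) (And3
  (fun x x' y => etrans (congr1 k (tDl x x' y)) (raddfD k _ _))
  (fun x y y' => etrans (congr1 k (tDr x y y')) (raddfD k _ _))
  (fun a x y => congr1 k (tZ a x y))).
by rewrite -kE -k'E; apply: U' => x c; rewrite kE k'E.
Qed.

(** This is Ext^1(C, X) = 0 for C-modules X. By exactness of D2 and D1, the map g1 : p tensor y |->
    c(p) y descends to the image of D1. That image contains p tensor 1 - p1 tensor e p for every p
    in P0, where e p1 = 1, and h p is the value there. *)
Lemma Tor1_extend : exists (P1 P0 : rmodType A) (d1 : {linear P1 -> P0})
    (e : {linear P0 -> Cr}),
  [/\ projective P0, exact d1 e, surj e &
   exists P2 (d2 : {linear P2 -> P1}), exact d2 d1 /\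
   forall X (c : {linear P1 -> X}), epi_class f X -> (forall x, c (d2 x) = 0) ->
     exists h : {linear P0 -> X}, forall x, h (d1 x) = c x].
Proof.
have [P2 [P1 [P0 [d2 [d1 [e [[_ pP1 pP0] [[ex2 ex1 se] HT]]]]]]]] := tor.
have [T2 [T1 [T0 [t2 [t1 [t0 [D2 [D1 [[ten2 ten1 ten0] [D2t D1t exD]]]]]]]]]] := HT.
exists P1, P0, d1, e; split=> //; exists P2, d2; split=> // X c EX cd2.
have [act [aDl aDr aA [a1 af] _]] := epi_class_action EX.
have act0 x : act 0 x = 0 by apply: (@addrI _ (act 0 x)); rewrite -aDl !addr0.
have [[tl0 tr0 tz0] U0] := ten0; have [[tl1 tr1 tz1] U1] := ten1.
have [[tl2 tr2 tz2] U2] := ten2.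
have [[g1 g1E] _] := U1 X (fun p x => act (c p) x) (And3
  (fun p p' x => etrans (congr1 (act^~ x) (linearD c p p')) (aDl _ _ x))
  (fun p x x' => aDr _ x x')
  (fun a p x => etrans (congr1 (act^~ x) (linearZ_LR c a p))
     (etrans (congr1 (act^~ x) (esym (af _ a))) (aA _ _ _)))).
have g1D2 w : g1 (D2 w) = 0.
  apply: (additive_inj (g := g1 \o D2) (g' := fun=> 0) ten2) => [x y|x y|p x].
  - by rewrite raddfD.
  - by rewrite addr0.
  - by rewrite /= D2t g1E cd2 act0.
have g1D1 w w' : D1 w = D1 w' -> g1 w = g1 w'.
  move=> eD; have /exD[v vE] : D1 (w - w') = 0 by rewrite raddfB eD subrr.
  by apply/eqP; rewrite -subr_eq0 -raddfB -vE g1D2.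
have t0_0l x : t0 0 x = 0 by apply: (@addrI _ (t0 0 x)); rewrite -tl0 !addr0.
have t0_0r p : t0 p 0 = 0 by apply: (@addrI _ (t0 p 0)); rewrite -tr0 !addr0.
(* Right multiplication by y on a tensor product with C; it has to be produced from the universal
   property. *)
have rhoP (M : rmodType A) (Tn : zmodType) (tn : M -> Cl -> Tn) (tenn : is_tensor tn) (y : C) :
    exists r : {additive Tn -> Tn}, forall p (x : C), r (tn p x) = tn p (x * y : C).
  have [[tl tr tz] U] := tenn.
  have [[r rE] _] := U Tn (fun p x => tn p ((x : C) * y : C)) (And3
    (fun p p' x => tl p p' _)
    (fun p x x' => etrans (congr1 (tn p) (mulrDl (x : C) x' y)) (tr p _ _))
    (fun a p x => etrans (tz a p _) (congr1 (tn p) (mulrA (f a) (x : C) y)))).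
  by exists r.
have [r0 r0E] := choice (rhoP P0 T0 t0 ten0).
have [r1 r1E] := choice (rhoP P1 T1 t1 ten1).
have D1r y w : D1 (r1 y w) = r0 y (D1 w).
  apply: (additive_inj (g := D1 \o r1 y) (g' := r0 y \o D1) ten1) => [u v|u v|p x] /=.
  - by rewrite !raddfD.
  - by rewrite !raddfD.
  - by rewrite r1E !D1t r0E.
have g1r y w : g1 (r1 y w) = act (g1 w) y.
  apply: (additive_inj (g := g1 \o r1 y) (g' := fun w => act (g1 w) y) ten1) => [u v|u v|p x] /=.
  - by rewrite !raddfD.
  - by rewrite raddfD aDl.
  - by rewrite r1E !g1E aA.
have [p1 p1E] := se (1 : C).
(* The cokernel of D1 is C (x) C, where p (x) 1 = p1 (x) e p because f is epi. *)
have key p : exists w, D1 w = t0 p (1 : C) - t0 p1 (e p : C).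
  have [Q [q [sq qD qE]]] := @zmod_quotient_ex T0 (fun z => exists w, D1 w = z) ltac:(
    by exists 0; rewrite raddf0) ltac:(
    by move=> _ _ [w <-] [w' <-]; exists (w - w'); rewrite raddfB).
  have q0 : q 0 = 0 by apply: (@addrI _ (q 0)); rewrite -qD !addr0.
  have qB x y : q x = q y <-> q (x - y) = 0.
    split=> [exy|e0]; last by rewrite -[x](subrK y) qD e0 add0r.
    by apply: (@addIr _ (q y)); rewrite -qD subrK add0r.
  have [s sK] := choice sq.
  have qr y u v : q u = q v -> q (r0 y u) = q (r0 y v).
    move=> /qB/qE[w wE]; apply/qB/qE; exists (r1 y w).
    by rewrite D1r wE raddfB.
  have [k kK] := choice se.
  have qe p' p'' x : e p' = e p'' -> q (t0 p' x) = q (t0 p'' x).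
    move=> /linear_eq_ker/ex1[w wE]; apply/qB/qE; exists (t1 w x).
    by rewrite D1t wE; apply/eqP; rewrite eq_sym subr_eq -tl0 subrK.
  have r0M y z w : r0 z (r0 y w) = r0 (y * z) w.
    apply: (additive_inj (g := r0 z \o r0 y) (g' := r0 (y * z)) ten0) => [u v|u v|p' x] /=.
    - by rewrite !raddfD.
    - by rewrite raddfD.
    - by rewrite !r0E mulrA.
  have r0D y z w : r0 (y + z) w = r0 y w + r0 z w.
    apply: (additive_inj (g := r0 (y + z)) (g' := fun w => r0 y w + r0 z w) ten0) => [u v|u v|p' x] /=.
    - by rewrite raddfD.
    - by rewrite !raddfD addrACA.
    - by rewrite !r0E -tr0; congr (t0 _ _); exact: mulrDr.
  have r01 w : r0 1 w = w.
    apply: (additive_inj (g := r0 1) (g' := id) ten0) => [u v|u v|p' x] //=.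
      by rewrite raddfD.
    by rewrite r0E mulr1.
  have qs u : q (s (q u)) = q u by rewrite sK.
  have e1 : q (t0 (k (e p)) (1 : C)) = q (r0 (e p) (s (q (t0 (k (1 : C)) (1 : C))))).
    apply: (@epi_linear K A C f epi Q (fun u y => q (r0 y (s u)))
      (fun y => q (t0 (k y) (1 : C)))).
    - move=> x y z; rewrite -qD -raddfD; apply: qr.
      by rewrite qD !sK.
    - by move=> x y z; rewrite r0D qD.
    - by move=> x y z; rewrite -r0M; apply: qr; rewrite qs.
    - by move=> x; rewrite r01 sK.
    - move=> y z; rewrite -qD -tl0; apply: qe.
      by rewrite linearD !kK.
    - move=> y a; rewrite (qr (f a) _ _ (qs _)) r0E.
      rewrite (qe _ ((a : A^c) *: k y)); last by rewrite kK linearZ /= kK.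
      rewrite tz0; congr (q (t0 _ _)).
      by have e2 : f a * 1 = 1 * f a by [rewrite mulr1 mul1r]; exact: e2.
  apply/qE/qB; rewrite (qe p (k (e p))) ?kK // e1 (qr _ _ _ (qs _)) r0E mul1r.
  by apply: qe; rewrite kK p1E.
have [w0 w0E] := choice key.
have [h hE] : exists h : {linear P0 -> X}, forall p, h p = g1 (w0 p).
  apply: linear_of => a p p'.
  rewrite -af -g1r -raddfD; apply: g1D1.
  rewrite raddfD D1r !w0E raddfB !r0E mul1r tl0 tz0 linearP.
  have e2 : t0 p ((a : A) *: ((1 : C) : Cl)) = t0 p (f a : C).
    by congr (t0 p _); exact: mulr1.
  have e3 : t0 p1 ((a *: e p + e p' : Cr) : C) = t0 p1 ((e p : C) * f a : C) + t0 p1 (e p').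
    exact: tr0.
  by rewrite e2 e3 opprD addrACA.
exists h => x; rewrite hE; have -> : g1 (w0 (d1 x)) = g1 (t1 x (1 : C)).
  apply: g1D1; rewrite w0E D1t (_ : e (d1 x) = 0) ?t0_0r ?subr0 //.
  by apply/ex1; exists x.
by rewrite g1E a1.
Qed.

End TorEpimorphism.

(** * Epimorphisms with vanishing Tor_1: the modules over C form the wide subcategory *)

Section HomologicalEpimorphism.
Context {K : fieldType} {A : falgType K}.
Implicit Types M P Q S X Y Z : rmodType A.
Context (C : pzRingType) (f : {rmorphism A -> C}).
Hypothesis epi : ring_epi f.
Hypothesis tor : Tor1_vanishes (right_via f) (left_via f).
Local Notation Cr := (right_via f : rmodType A).
Local Notation E := (epi_class f).

(** A map C -> Z lifts to P0 -> Y. On P1 the lift takes values in X and kills the image of d2, so it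
    extends to P0 by [Tor1_extend]; after subtraction the lift descends to C -> Y. *)
Lemma epi_class_ext X Y Z (i : {linear X -> Y}) (p : {linear Y -> Z}) :
  injective i -> exact i p -> surj p -> E X -> E Z -> E Y.
Proof.
move=> ii ex sp EX EZ.
have [P1 [P0 [d1 [e [pP0 ex1 se [P2 [d2 [ex2 extend]]]]]]]] := Tor1_extend epi tor.
have pi0 x : p (i x) = 0 by apply/ex; exists x.
split=> [y|h h1 c].
  have [hz hzE] := EZ.1 (p y).
  have [l lE] := pP0 _ _ p (hz \o e) sp.
  have ed x : e (d1 x) = 0 by apply/ex1; exists x.
  have [c cE] := @factor_inj _ _ _ _ i (l \o d1) ii ltac:(
    by move=> x; apply/ex; rewrite /= lE /= ed linear0).
  have [c' c'E] := extend X c EX ltac:(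
    by move=> x; apply: ii; rewrite cE /= (_ : d1 (d2 x) = 0) ?linear0 //; apply/ex2; exists x).
  have [v vE] := linear_sub l (i \o c').
  have [h hE] := @factor_surj _ _ _ _ e v se ltac:(
    by move=> x /ex1[w <-]; rewrite vE /= c'E cE subrr).
  have ph z : p (h z) = hz z.
    by have [x <-] := se z; rewrite hE vE linearB /= pi0 subr0 lE.
  have /ex[x xE] : p (y - h (1 : C)) = 0 by rewrite linearB /= ph hzE subrr.
  have [hx hxE] := EX.1 x; have [k kE] := linear_add h (i \o hx).
  by exists k; rewrite kE /= hxE xE addrC subrK.
have hp z : p (h z) = 0 by apply: (EZ.2 (p \o h)); rewrite /= h1 linear0.
have [g gE] := @factor_inj _ _ _ _ i h ii ltac:(by move=> z; apply/ex).
rewrite -gE (_ : g c = 0) ?linear0 //; apply: EX.2; apply: ii.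
by rewrite gE h1 linear0.
Qed.

(* The smallest torsion class containing C. *)
Definition torsion_closure X : Prop := forall F : rmodType A,
  (forall (h : {linear Cr -> F}) c, h c = 0) -> forall (u : {linear X -> F}) x, u x = 0.

Lemma torsion_closure_torsion : torsion_class torsion_closure.
Proof.
split=> [I X S iota cop TX F hF u|X Y p sp TX F hF u y|X Y Z i p ii ex sp TX TZ F hF u y].
- apply: (coproduct_span cop); first exact: submod_ker.
  by move=> i x; apply: (TX i F hF (u \o iota i)).
- by have [x <-] := sp y; apply: (TX F hF (u \o p)).
have [g gE] := @factor_surj _ _ _ _ p u sp ltac:(
  by move=> z /ex[x <-]; apply: (TX F hF (u \o i))).
by rewrite -gE; apply: (TZ F hF g).
Qed.

Lemma torsion_closure_gen X : gen Cr X -> torsion_closure X.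
Proof.
move=> gX F hF u x; apply: (gX x (fun x => u x = 0)); first exact: submod_ker.
by move=> h c; apply: (hF (u \o h)).
Qed.

Lemma torsion_closure_epi_class X : E X -> torsion_closure X.
Proof. by move=> EX; apply: torsion_closure_gen; exact: epi_class_gen. Qed.

Lemma torsion_closure_hom X : torsion_closure X -> (exists x : X, x <> 0) ->
  exists (h : {linear Cr -> X}) c, h c <> 0.
Proof.
move=> TX [x xn]; apply: contrapT => nh; apply: xn.
apply: (TX X _ idfun) => h c; apply: contrapT => hc; apply: nh.
by exists h, c.
Qed.

Section Wide.
Context (T0 T1 : rmodType A) (t : T0) (pi : {linear T0 -> T1}).
Local Notation T := torsion_closure.
Let torT := torsion_closure_torsion.
Hypothesis appT : min_approx T t.
Hypothesis spi : surj pi.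
Hypothesis piE : forall y, pi y = 0 <-> exists a : A^c, a *: t = y.

Let TQ X Y (p : {linear X -> Y}) : surj p -> T X -> T Y.
Proof. exact: tors_quot. Qed.

(* If N is a maximal submodule such that v N is a C-module and the kernel of v
   on N is in T, then N = T0: otherwise T0 / N has a nonzero map from C, whose
   image can be added to N. *)
Lemma epi_class_approx_ker X (v : {linear T0 -> X}) : E X -> smod T (fun y => v y = 0).
Proof.
move=> EX; have TT0 : T T0 := approx_T0 appT.
pose good (N : T0 -> Prop) := [/\ submod N, smod E (fun x => exists2 y, N y & v y = x)
  & smod T (fun y => N y /\ v y = 0)].
have [||N [[sN [S [i [ii iE ES]]] TN] mN]] := @max_submod _ _ T0 good (fun y => y = 0)
  (findim_finlen (approx_findim0 appT)).
- by move=> N [/submod_ksub].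
- split; first exact: submod_0.
    have [S [i [ii iE]]] := submodule_ex (submod_0 X).
    exists S, i; split=> // [x|]; last first.
      by apply: epi_class_zero => s; apply: ii; rewrite linear0; apply/iE; exists s.
    rewrite -iE; split=> [[y -> <-]|->]; first by rewrite linear0.
    by exists 0; rewrite ?linear0.
  have [S [i [ii iE]]] := submodule_ex (submod_0 T0).
  exists S, i; split=> // [x|]; last first.
    by apply: tors_zero => // s; apply: ii; rewrite linear0; apply/iE; exists s.
  by rewrite -iE; split=> [[]|->] //; rewrite linear0.
suff Nall y : N y by apply: smod_ext TN => y; split=> [[]|].
have [Q [q [sq qE]]] := quotient_ex sN.
apply: contrapT => nNy.
have [h [c0 hc0]] : exists (h : {linear Cr -> Q}) c, h c <> 0.
  apply: torsion_closure_hom; first exact: TQ sq TT0.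
  by exists (q y) => /qE.
have [X' [r [sr rE]]] := quotient_ex (submod_range i).
have EX' : E X' := epi_class_coker epi ES EX sr rE.
have [w wE] := @factor_surj _ _ _ _ q (r \o v) sq ltac:(
  by move=> z /qE Nz; apply/rE/iE; exists z).
have [X'' [r' [sr' r'E]]] := quotient_ex (submod_range (w \o h)).
have EX'' : E X'' := epi_class_coker epi (epi_class_self epi) EX' sr' r'E.
(* N' is N enlarged by the image of C in T0 / N. S' will be v N': the preimage in X of the image of
   C in X / v N, a C-module as a kernel between C-modules. *)
have [S' [i' [ii' i'E]]] := submodule_ex (submod_ker (r' \o r)).
have ES' : E S' := epi_class_ker EX EX'' ii' i'E.
pose N' z := exists c, h c = q z.
have sN' : submod N'.
  split; first by exists 0; rewrite !linear0.
  by move=> a z z' [c hc] [c' hc']; exists (a *: c + c'); rewrite !linearP hc hc'.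
have NN' z : N z -> N' z by move=> /qE e; exists 0; rewrite linear0 e.
have gN' : good N'.
  split=> //.
    exists S', i'; split=> // x; rewrite -i'E /=; split=> [[z [c hc] <-]|].
      by apply/r'E; exists c; rewrite /= hc wE.
    move=> /r'E[c /= cE]; have [z zE] := sq (h c).
    have /rE/iE[n Nn nE] : r (x - v z) = 0.
      by rewrite linearB /= -cE -zE wE subrr.
    exists (z + n); last by rewrite linearD /= nE addrC subrK.
    by exists c; rewrite linearD /= ((qE n).2 Nn) addr0.
  (* The kernel U of v on N' is an extension of h(U1), for U1 the kernel of C -> X / v N, by the
     kernel of v on N; both are in T. *)
  have [U [j [ij jE]]] := submodule_ex (submodI sN' (submod_ker v)).
  have [U1 [k [ik kE]]] := submodule_ex (submod_ker (w \o h)).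
  have EU1 : E U1 := epi_class_ker (epi_class_self epi) EX' ik kE.
  have TU1 := torsion_closure_epi_class EU1.
  have [U2 [l [il lE TU2]]] := smod_range TQ (h \o k) TU1.
  exists U, j; split=> //.
  have qj u : exists u2, l u2 = q (j u).
    have /jE[[c hc] vj] : exists u', j u' = j u by exists u.
    have /kE[u1 u1E] : (w \o h) c = 0 by rewrite /= hc wE /= vj linear0.
    by apply/lE; exists u1; rewrite /= u1E.
  have [g gE] := @factor_inj _ _ _ _ l (q \o j) il qj.
  apply: (tors_extk torT (p := g)) TU2.
    move=> u2; have /lE[u1 u1E] : exists u', l u' = l u2 by exists u2.
    have wk : w (h (k u1)) = 0 by apply/kE; exists u1.
    have [z zE] := sq (h (k u1)).
    have /rE/iE[n Nn nE] : r (v z) = 0 by have := wE z; rewrite /= => <-; rewrite zE.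
    have /jE[u uE] : N' (z - n) /\ v (z - n) = 0.
      split; last by rewrite linearB /= nE subrr.
      by exists (k u1); rewrite linearB /= ((qE n).2 Nn) subr0 zE.
    exists u; apply: il; rewrite gE /= uE linearB /= ((qE n).2 Nn) subr0 zE.
    exact: u1E.
  have [V [m [im mE TV]]] := TN.
  have [g' g'E] := @factor_inj _ _ _ _ j m ij ltac:(
    by move=> z; apply/jE; have /mE[Nz vz] : exists z', m z' = m z by [exists z];
       split=> //; exact: NN').
  exists V, g'; split=> // [z z' e|u].
    by apply: im; rewrite -!g'E e.
  split=> [gu|[z <-]].
    have Nj : N (j u) by apply/qE; have := gE u; rewrite gu linear0 /= => <-.
    have /jE[_ vj] : exists u', j u' = j u by exists u.
    have /mE[z zE] : N (j u) /\ v (j u) = 0 by [].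
    by exists z; apply: ij; rewrite g'E.
  apply: il; rewrite linear0 gE /= g'E; apply/qE.
  by have /mE[] : exists z', m z' = m z by exists z.
have [z zE] := sq (h c0).
by apply: hc0; rewrite -zE; apply/qE; apply: (mN N' gN' NN'); exists c0.
Qed.

(** For u : T1 -> X, the kernel of [u \o pi] is in T and contains t, so T0 maps to it with t fixed.
    By minimality it is all of T0, and u = 0. *)
Lemma epi_class_wide X : E X -> wide T T1 X.
Proof.
move=> EX; split=> [|u x]; first exact: torsion_closure_epi_class.
have [S [i [ii iE TS]]] := epi_class_approx_ker (u \o pi) EX.
have [s sE] : exists s, i s = t.
  by apply/iE; rewrite /= (approx_pi0 piE) linear0.
have [_ _ app minT] := appT.
have [h ht] := app S s TS.
have [w _ Kw] := minT (i \o h) ltac:(by rewrite /= ht sE).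
have [y <-] := spi x; rewrite -(Kw y).
by apply: (iE _).2; exists (h (w y)).
Qed.

(* The C-trace of a wide module is a quotient of S = C^(I) by the C-trace of
   its kernel in S. *)
Lemma wide_trace_epi_class X : wide T T1 X -> smod E (@trace _ Cr X).
Proof.
move=> WX.
have [S [iota cop]] := coproduct_ex (fun _ : {linear Cr -> X} => Cr).
have [[p pE] _] := cop X (fun h => h).
have ES : E S := epi_class_coproduct epi cop.
have TS := torsion_closure_epi_class ES.
have TK := wide_ker torT appT spi piE p TS WX.
(* K' is the trace of C in the kernel of p, described inside S. *)
pose K' (s : S) := forall N : S -> Prop, submod N -> (forall h : {linear Cr -> S},
  (forall c, p (h c) = 0) -> forall c, N (h c)) -> N s.
have sK' : submod K'.
  split=> [N [] //|a x y Hx Hy N sN H].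
  by apply: sN.2; [exact: Hx|exact: Hy].
have K'K s : K' s -> p s = 0.
  by move=> /(_ (fun s => p s = 0)); apply; first exact: submod_ker.
have [Q [q [sq qE]]] := quotient_ex sK'.
have EQ : E Q.
  apply: (epi_class_quot epi ES sq) => s /qE K's h h1 c; apply/qE.
  move: h h1 c; apply: (K's (fun s => forall h : {linear Cr -> S}, h (1 : C) = s -> forall c, K' (h c))).
    split=> [h h1 c|a x y Hx Hy h h1 c].
      by rewrite (ES.2 h h1); case: sK'.
    have [hx hxE] := ES.1 x; have [hy hyE] := ES.1 y.
    have [m mE] := left_mult f (f a).
    have [k kE] := linear_add (hx \o m) hy.
    have -> : h c = k c.
      apply: (epi_class_uniq ES); rewrite kE h1 /= mE hyE; congr (_ + _).
      rewrite -hxE -linearZ; congr (hx _).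
      by have e : 1 * f a = f a * 1 by [rewrite mulr1 mul1r]; exact: e.
    by rewrite kE; exact: (submodD sK' (Hx hx hxE (m c)) (Hy hy hyE c)).
  move=> h hp c0 g g1 c N sN H.
  have [m mE] := left_mult f c0.
  have -> : g c = (h \o m) c.
    by apply: (epi_class_uniq ES); rewrite g1 /= mE; congr (h _); exact: (esym (mulr1 _)).
  exact: (H h hp (m c)).
have [p' p'E] := @factor_surj _ _ _ _ q p sq ltac:(by move=> s /qE/K'K).
have p'i : injective p'.
  apply: linear_inj => z; have [s <-] := sq z; rewrite p'E => ps.
  have [S1 [k [ik kE TS1]]] := TK.
  (* R is the image of ker p in Q = S / K'. It is in T as ker p is, and a map C -> R lifts to one C
     -> ker p, whose image lies in K'; so R receives no nonzero map from C and vanishes. *)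
  have [R [j [ij jE]]] := submodule_ex (submod_range (q \o k)).
  have [g gE] := @factor_inj _ _ _ _ j (q \o k) ij ltac:(
    by move=> u; apply/jE; exists u).
  have sg : surj g.
    move=> u; have /jE[u' u'E] : exists u', j u' = j u by exists u.
    by exists u'; apply: ij; rewrite gE.
  have TR : T R := TQ sg TS1.
  have hR (h : {linear Cr -> R}) c : h c = 0.
    have [s' s'E] := sg (h (1 : C)).
    have [hs hsE] := ES.1 (k s').
    have qh c' : q (hs c') = j (h c').
      apply: (epi_class_uniq (h := q \o hs) (h' := j \o h) EQ).
      by rewrite /= hsE -s'E gE.
    have ph c' : p (hs c') = 0.
      rewrite -p'E qh; have [s'' s''E] := sg (h c').
      by rewrite -s''E gE /= p'E; apply/kE; exists s''.
    apply: ij; rewrite linear0 -qh; apply/qE => N sN H; exact: H.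
  have /kE[s1 s1E] : p s = 0 by [].
  have /jE[z1 z1E] : exists u, (q \o k) u = q s by exists s1; rewrite /= s1E.
  by rewrite -z1E (_ : z1 = 0) ?linear0 //; apply: (TR R hR idfun).
exists Q, p'; split=> // x; split=> [tx|[z <-]].
  apply: (tx (fun x => exists z, p' z = x)); first exact: submod_range.
  by move=> h c; exists (q (iota h c)); rewrite p'E pE.
have [s <-] := sq z; rewrite p'E; move: s.
apply: (coproduct_span cop); first exact: submod_pre (trace_submod _ _).
by move=> h c; rewrite pE; exact: trace_image.
Qed.

(** Let Y = X / tr_C(X), again wide. The preimage of tr_C(Y) in X is an extension of C-modules,
    hence a C-module and contained in tr_C(X). So tr_C(Y) = 0, which forces Y = 0 as Y is in T. *)
Lemma wide_epi_class X : wide T T1 X -> E X.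
Proof.
move=> WX; have [TX _] := WX.
have [S1 [i1 [ii1 i1E ES1]]] := wide_trace_epi_class WX.
have [Y [q [sq qE]]] := quotient_ex (trace_submod Cr X).
have TS1 := torsion_closure_epi_class ES1.
have TK : smod T (fun x => q x = 0).
  by exists S1, i1; split=> // x; rewrite qE i1E.
have WY : wide T T1 Y := wide_quot torT appT spi piE sq TK WX.
have [S2 [i2 [ii2 i2E ES2]]] := wide_trace_epi_class WY.
have [S3 [i3 [ii3 i3E]]] := submodule_ex (submod_pre q (trace_submod Cr Y)).
have [p pE] := @factor_inj _ _ _ _ i2 (q \o i3) ii2 ltac:(
  by move=> z; apply/i2E/i3E; exists z).
have [j jE] := @factor_inj _ _ _ _ i3 i1 ii3 ltac:(
  by move=> z; apply/i3E; rewrite ((qE (i1 z)).2 _); [case: (trace_submod Cr Y)|apply/i1E; exists z]).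
have ES3 : E S3.
  apply: (@epi_class_ext S1 S3 S2 j p) => //.
  - by move=> z z' e; apply: ii1; rewrite -!jE e.
  - move=> z; split=> [pz|[z' <-]]; last first.
      by apply: ii2; rewrite pE linear0 /= jE; apply/qE/i1E; exists z'.
    have /qE/i1E[z' z'E] : q (i3 z) = 0 by have := pE z; rewrite pz linear0.
    by exists z'; apply: ii3; rewrite jE.
  - move=> z; have [x xE] := sq (i2 z).
    have /i3E[z3 z3E] : trace Cr (q x) by rewrite xE; apply/i2E; exists z.
    by exists z3; apply: ii2; rewrite pE /= z3E.
have Y0 (y : Y) : y = 0.
  apply: contrapT => yn; have [TY _] := WY.
  have [h [c hc]] := torsion_closure_hom TY (ex_intro _ y yn).
  apply: hc; have [x xE] := sq (h c).
  have /i3E[z zE] : trace Cr (q x) by rewrite xE; exact: trace_image.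
  rewrite -xE -zE; apply/qE.
  by have := trace_map i3 (epi_class_gen ES3 z).
have si1 : surj i1 by move=> x; apply/i1E/qE; exact: Y0.
have [k [i1K kK]] := linear_inverse (linear_bij ii1 si1).
apply: (epi_class_inj ES1 (can_inj kK)) => x h _ c.
by exists (i1 (h c)); rewrite i1K.
Qed.

End Wide.
End HomologicalEpimorphism.

(** * Epiclasses and rigid modules determine each other *)

Section Epiclasses.
Context {K : fieldType} {A : falgType K}.
Implicit Types M P Q S X Y Z : rmodType A.

Lemma rigid_ring_epi M : rigid M ->
  exists (C : pzRingType) (g : {rmorphism A -> C}),
    [/\ ring_epi g, Tor1_vanishes (right_via g) (left_via g), gen M (right_via g) &
      forall T', torsion_class T' -> T' (right_via g) -> forall X, gen M X -> T' X].
Proof.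
move=> rM; have [fM _] := rM; have torT := rigid_torsion rM.
have [T0 [t appT]] := min_approx_ex torT (fun X => iff_refl _) fM.
have [h hE] := regular_hom t.
have [T1 [pi [spi pi0]]] := quotient_ex (submod_range h).
have piE y : pi y = 0 <-> exists a : A^c, a *: t = y.
  by rewrite pi0; split=> -[a <-]; exists a.
have [B [b [sb bE]]] := quotient_ex (trace_submod T1 T0).
have [f fE] := reflection_rmorphism torT appT spi piE sb bE.
have [k [k' [kE k'E]]] := right_via_isom fE.
exists (reflection_ring torT appT spi piE sb bE), f; split.
- exact: reflection_ring_epi fE.
- exact: reflection_Tor1 fE.
- apply: (gen_quot (p := k)); first by move=> x; exists x; rewrite kE.
  by have [] := reflection_wide torT appT spi piE sb bE.
- move=> T' torT' T'C; apply: (reflection_generates torT appT spi piE sb bE torT').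
  by apply: (tors_quot torT' (p := k')) T'C => x; exists x; rewrite k'E.
Qed.

(** Gen(M) is the smallest torsion class containing C, so it depends only on the A-module C.
    Epimorphisms equivalent to the same [f i] have targets with A-linear surjections both ways, so
    they yield the same class. *)
Lemma finite_epiclasses_rigid : finitely_many_Tor1_epiclasses A ->
  finite_upto (@rigid K A).
Proof.
move=> [n [B [f fP]]].
pose good i M (C : pzRingType) (g : {rmorphism A -> C}) :=
  [/\ epi_equiv (f i) g, gen M (right_via g : rmodType A) &
      forall T', torsion_class T' -> T' (right_via g : rmodType A) ->
        forall X, gen M X -> T' X].
have GS i : exists G : rmodType A,
    (exists M, rigid M /\ exists C g, @good i M C g) ->
    rigid G /\ exists C g, @good i G C g.
  case: (EM (exists M, rigid M /\ exists C g, @good i M C g)) => [[M HM]|nM].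
    by exists M.
  by exists (regular_rmod A) => H; case: nM.
have [G GP] := choice GS.
exists 'I_n, G => M rM.
have [C [g [eg tg gg Tg]]] := rigid_ring_epi rM.
have [i [h bh hE]] := fP C g eg tg; exists i.
have [|rG [C' [g' [[h' bh' h'E] gg' Tg']]]] := GP i.
  by exists M; split=> //; exists C, g; split=> //; exists h.
have [k hK Kh] := bh; have [k' h'K Kh'] := bh'.
have kP (D D' : pzRingType) (r : {rmorphism A -> D}) (r' : {rmorphism A -> D'})
    (u : {rmorphism B i -> D}) (u' : {rmorphism B i -> D'}) (w : D -> B i) :
    cancel u w -> cancel w u -> (forall a, r a = u (f i a)) ->
    (forall a, r' a = u' (f i a)) -> bijective u' ->
    exists l : {linear (right_via r : rmodType A) -> (right_via r' : rmodType A)}, surj l.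
  move=> uK wK rE r'E [w' u'K w'K].
  have [l lE] := @linear_of _ (right_via r : rmodType A) (right_via r' : rmodType A)
    (fun x => u' (w x)) ltac:(
    move=> a x y;
    have e : u' (w ((x : D) * r a + y)) = u' (w x) * r' a + u' (w y) by
      [rewrite rE r'E -(wK x) -(wK y) -rmorphM -rmorphD !uK rmorphD rmorphM];
    exact: e).
  by exists l => x; exists (u (w' x)); rewrite lE uK w'K.
have [l sl] := kP _ _ _ _ h h' k hK Kh hE h'E bh'.
have [l' sl'] := kP _ _ _ _ h' h k' h'K Kh' h'E hE bh.
move=> X; split.
  apply: Tg'; first exact: rigid_torsion rM.
  exact: gen_quot sl gg.
apply: Tg; first exact: rigid_torsion rG.
exact: gen_quot sl' gg'.
Qed.

(** The pair (C, 1) represents the forgetful functor on the class of f, so equal classes give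
    mutually inverse maps exchanging the units; multiplicativity follows by uniqueness. *)
Lemma epi_class_equiv (C D : pzRingType) (f : {rmorphism A -> C}) (g : {rmorphism A -> D}) :
  ring_epi f -> ring_epi g -> (forall X, epi_class f X <-> epi_class g X) ->
  epi_equiv f g.
Proof.
move=> ef eg EE.
pose Cr : rmodType A := right_via f; pose Dr : rmodType A := right_via g.
have fC : epi_class f Cr := epi_class_self ef.
have gD : epi_class g Dr := epi_class_self eg.
have fD : epi_class f Dr by apply/EE.
have gC : epi_class g Cr by apply/EE.
have [p p1] := fD.1 (1 : D); have [q q1] := gC.1 (1 : C).
have qp x : q (p x) = x.
  by apply: (epi_class_uniq (h := q \o p) (h' := idfun) fC); rewrite /= p1 q1.
have pq x : p (q x) = x.
  by apply: (epi_class_uniq (h := p \o q) (h' := idfun) gD); rewrite /= q1 p1.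
have [h hE] := @rmorphism_of C D p (fun x y => linearD p x y) p1 ltac:(
  move=> x y; have [k kE] := left_mult f x; have [l lE] := left_mult g (p x);
  rewrite -[RHS](lE (p y)) -kE;
  apply: (epi_class_uniq (h := p \o k) (h' := l \o p) fD);
  rewrite /= kE p1 lE [(p x : D) * 1]mulr1; congr (p _); exact: mulr1).
exists h; first by exists q => x; rewrite hE.
move=> a; rewrite hE.
have e : (a : A^c) *: ((1 : C) : Cr) = f a.
  by have e' : 1 * f a = f a :> C by [rewrite mul1r]; exact: e'.
rewrite -e linearZ /= p1.
by have e' : g a = 1 * g a :> D by [rewrite mul1r]; exact: e'.
Qed.

(** The C-modules and the D-modules are both the wide subcategory computed from one and the same
    approximation t of the common torsion class. *)
Lemma torsion_closure_equiv (C D : pzRingType) (f : {rmorphism A -> C})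
    (g : {rmorphism A -> D}) M :
  ring_epi f -> Tor1_vanishes (right_via f) (left_via f) ->
  ring_epi g -> Tor1_vanishes (right_via g) (left_via g) -> findim M ->
  (forall X, torsion_closure f X <-> gen M X) ->
  (forall X, torsion_closure g X <-> gen M X) -> epi_equiv f g.
Proof.
move=> ef tf eg tg fM fE gE.
have [T0 [t appf]] := min_approx_ex (torsion_closure_torsion f) fE fM.
have e : torsion_closure f = torsion_closure g.
  by apply/funext => X; apply/propext; rewrite fE gE.
have appg : min_approx (torsion_closure g) t by rewrite -e.
have [h hE] := regular_hom t.
have [T1 [pi [spi pi0]]] := quotient_ex (submod_range h).
have piE y : pi y = 0 <-> exists a : A^c, a *: t = y.
  by rewrite pi0; split=> -[a <-]; exists a.
apply: epi_class_equiv => // X; split=> EX.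
  apply: (wide_epi_class eg tg appg spi piE); rewrite -e.
  exact: (epi_class_wide ef appf spi piE).
apply: (wide_epi_class ef tf appf spi piE); rewrite e.
exact: (epi_class_wide eg appg spi piE).
Qed.

Lemma finite_rigid_epiclasses : finite_upto (@rigid K A) ->
  finitely_many_Tor1_epiclasses A.
Proof.
move=> fin; have [I [G GP]] := fin.
pose good i (s : {C : pzRingType & {rmorphism A -> C}}) :=
  [/\ ring_epi (tagged s), Tor1_vanishes (right_via (tagged s)) (left_via (tagged s))
    & forall X, torsion_closure (tagged s) X <-> gen (G i) X].
have BS i : exists s, (exists s', good i s') -> good i s.
  case: (EM (exists s', good i s')) => [[s Hs]|ns]; first by exists s.
  (* The identity of A is a default for indices whose class comes from no epimorphism. *)
  by exists (Tagged (fun C : pzRingType => {rmorphism A -> C}) (idfun : {rmorphism A -> A})) => H; case: ns.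
have [s sP] := choice BS.
exists #|I|, (fun k => tag (s (enum_val k))), (fun k => tagged (s (enum_val k))).
move=> C g eg tg.
have [M rM TM] := finite_torsion_ftors fin (torsion_closure_torsion g).
have [fM _] := rM.
have [i iE] := GP M rM; exists (enum_rank i); rewrite enum_rankK.
have [|es ts sE] := sP i.
  exists (Tagged (fun C : pzRingType => {rmorphism A -> C}) g); split=> // X.
  by rewrite TM iE.
by apply: (torsion_closure_equiv (M := M)) => // X; rewrite sE iE.
Qed.

End Epiclasses.

Theorem theorem4p8 (K : closedFieldType) (A : falgType K) :
  [<-> tau_tilting_finite A;
       forall T : rmodType A -> Prop, torsion_class T ->
         exists M : rmodType A,
           [/\ findim M, silting M & forall X, T X <-> Gen M X];
       forall M : rmodType A, silting M ->
         exists M' : rmodType A,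
           [/\ findim M', silting M' & silting_equiv M M'];
       finitely_many_Tor1_epiclasses A].
Proof.
tfae.
- move=> /finite_upto_rigid fin T torT.
  have [M [fM _] TM] := finite_torsion_ftors fin torT.
  exact: ftors_silting torT TM fM.
- move=> H M sM; have [M' [fM' sM' M'E]] := H _ (silting_torsion sM).
  by exists M'; split=> // X; rewrite GenE M'E.
- by move=> /silting_findim_finite/finite_rigid_epiclasses.
- by move=> /finite_epiclasses_rigid/tau_tilting_finite_upto.
Qed.
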